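(* Let $k\in\mathbb N$, $W\in\mathbb R^k$, and let $A_N$ be drawn from the $N\times N$ $(k,W)$-checkerboard ensemble, independently for each $N$. Let $\nu_{A_N}=\frac1N\sum_{\lambda}\delta_{\lambda/\sqrt N}$ be the empirical spectral measure (sum over the eigenvalues $\lambda$ of $A_N$ with multiplicity). Then $\nu_{A_N}$ converges weakly almost surely to the Wigner semicircle measure $\sigma_R$ with radius $R=2\sqrt{1-1/k}$, where $\sigma_R$ has density $\frac{2}{\pi R^2}\sqrt{R^2-x^2}$ for $|x|\le R$ and $0$ otherwise.
   Context: Fix $k\in\mathbb N$ and $W=(w_1,\dots,w_k)\in\mathbb R^k$. The $N\times N$ $(k,W)$-checkerboard ensemble consists of real symmetric matrices $M=(m_{ij})$ with $m_{ij}=w_u$ if $i\equiv j\equiv u \pmod k$ (where $u\in\{1,\dots,k\}$) and $m_{ij}=a_{ij}$ if $i\not\equiv j\pmod k$, where the $a_{ij}=a_{ji}$ ($i<j$) are i.i.d. real random variables with mean $0$, variance $1$ and finite moments of all orders, with the natural product probability measure. *)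

(* Defs.v *)
From HB Require Import structures.
From mathcomp Require Import all_boot all_order all_algebra.
From mathcomp Require Import all_classical all_reals all_analysis.
Set Implicit Arguments. Unset Strict Implicit. Unset Printing Implicit Defensive.
Import Order.TTheory GRing.Theory Num.Def Num.Theory.
Import numFieldNormedType.Exports.
Local Open Scope classical_set_scope.
Local Open Scope ring_scope.

Definition mutually_independent {d} {T : measurableType d} {R : realType}
  (P : probability T R) (I : eqType) (J : set I) (X : I -> T -> R) : Prop :=
  forall (s : seq I), uniq s -> (forall i, i \in s -> J i) ->
  forall (B : I -> set R), (forall i, measurable (B i)) ->
  P (\big[setI/setT]_(i <- s) (X i @^-1` B i)) =
  (\prod_(i <- s) P (X i @^-1` B i))%E.

Definition identically_distributed {d} {T : measurableType d} {R : realType}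
  (P : probability T R) (I : Type) (J : set I) (X : I -> T -> R) : Prop :=
  forall i i', J i -> J i' -> forall B : set R, measurable B ->
  P (X i @^-1` B) = P (X i' @^-1` B).

(** Index set of the upper-triangular entries (N, i, j), 0 <= i < j < N. *)
Definition upper_idx : set (nat * nat * nat) :=
  [set t | (t.1.2 < t.2 < t.1.1)%N].

Definition checkerboard {R : realType} (k : nat) (W : seq R)
  (a : nat -> nat -> R) (N : nat) : 'M[R]_N :=
  \matrix_(i < N, j < N)
    if (i %% k == j %% k)%N then nth 0 W (i %% k)
    else a (minn i j) (maxn i j).

(** Eigenvalues with multiplicity: a sequence s with
    char_poly A = prod_(x <- s) (X - x) (exists for real symmetric A). *)
Definition eigenvalues {R : realType} (N : nat) (A : 'M[R]_N) : seq R :=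
  match pselect (exists s : seq R, char_poly A = \prod_(x <- s) ('X - x%:P)) with
  | left h => projT1 (cid h)
  | right _ => [::]
  end.

Definition esm_integral {R : realType} (N : nat) (A : 'M[R]_N) (f : R -> R) : R :=
  N%:R^-1 * \sum_(l <- eigenvalues A) f (l / Num.sqrt N%:R).

(** Integral of f against the semicircle law sigma_R with density
    2/(pi R^2) sqrt(R^2 - x^2) on [-R,R]; for R = 0, sigma_0 = delta_0. *)
Definition semicircle_integral {R : realType} (r : R) (f : R -> R) : R :=
  if r == 0 then f 0 else
  Rintegral lebesgue_measure `[- r, r]
    (fun x => f x * (2 / (pi * r ^+ 2) * Num.sqrt (r ^+ 2 - x ^+ 2))).

(** Weak convergence of measures given through their integration functionals. *)
Definition weak_cvg {R : realType} (mu : nat -> (R -> R) -> R) (nu : (R -> R) -> R) :=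
  forall f : R -> R, continuous f -> (exists M : R, forall x, `|f x| <= M) ->
  (fun N => mu N f) @ \oo --> nu f.

(* Main.v *)
(** With H the N x N matrix divided by sqrt N, the resolvent at the point i eta of the imaginary
    axis is A + i B for two real symmetric matrices A and B.  Let al_u and be_u be the traces
    of A and B over the indices congruent to u modulo k, divided by N, and let
    eta c = 1/k - (k-1) c^2.  The equations H A + eta B = 1 and H B = eta A give
      eta al_u + al_u sum_(v != u) be_v + be_u sum_(v != u) al_v = small,
      eta be_u - 1/k - al_u sum_(v != u) al_v + be_u sum_(v != u) be_v = small;
    multiplied by al_u^3 and (be_u - c)^3 and summed over u, for eta >= 2k + 1 the left-hand sides
    dominate S = sum_u al_u^4 + (be_u - c)^4.  Removing one entry a_ij at a time, a change of
    rank two, and using its independence of the other entries bounds the mean of the right-hand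
    sides by E S / 2 + O(1/N^2).  Hence E S = O(1/N^2), which is summable, and almost surely the
    normalized traces of A and B converge to 0 and k c.  The constant entries w_u only contribute
    the quadratic form of A or B at the indicator of a class, of lower order.

    This is done for a sequence of eta decreasing to 2k + 1.  The spectral measures thus converge on
    1/(x^2 + eta^2) and x/(x^2 + eta^2) for these eta; the limits are those of the semicircle
    law, and uniform approximation extends the convergence to all bounded continuous functions. *)
Require Import Defs.
From HB Require Import structures.
From mathcomp Require Import all_boot all_order all_algebra.
From mathcomp Require Import all_classical all_reals all_analysis.
From mathcomp Require Import measurable_realfun complex.
From mathcomp Require Import ring lra zify.
Set Implicit Arguments. Unset Strict Implicit. Unset Printing Implicit Defensive.
Import Order.TTheory GRing.Theory Num.Def Num.Theory.
Import numFieldNormedType.Exports.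
Local Open Scope classical_set_scope.
Local Open Scope ring_scope.

(** * Resolvents of symmetric matrices on the imaginary axis *)

(** Each nonzero [w_u] contributes an eigenvalue of order N, so high moments of the spectral
    measures are unbounded in N and traces of powers are a poor tool. The entries of the resolvent
    stay bounded by 1 whatever the matrix is, and on the imaginary axis the resolvent splits into
    two real matrices, so that the field remains real until the spectral theorem is needed.

    The deviation from the deterministic value is estimated in mean at once, with no separate
    concentration inequality. Fourth powers are taken because each power of the deviation is worth a
    factor 1/sqrt N: the same method applied to squares would give a mean of order 1/N, which is not
    summable.

    The price of this direct argument is a large eta: the terms with eta must outweigh the coupling
    of the k classes. The test functions reached in this way are only those with poles far from the
    real axis, and an accumulation point of the values of eta makes up for this: it gives access to
    all powers of one function 1/(x^2 + s), and these suffice for uniform approximation. *)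

Section Resolvent.
Variables (F : realFieldType) (n : nat) (eta : F).
Implicit Types (H : 'M[F]_n) (v : 'rV[F]_n).

Definition normsq v : F := \sum_j v 0 j ^+ 2.

Lemma normsqE v : normsq v = (v *m v^T) 0 0.
Proof. by rewrite mxE; apply: eq_bigr => j _; rewrite mxE expr2. Qed.

Lemma normsq_ge0 v : 0 <= normsq v.
Proof. by apply: sumr_ge0 => j _; exact: sqr_ge0. Qed.

Lemma normsq_eq0 v : normsq v <= 0 -> v = 0.
Proof.
move=> v0; apply/rowP => j; rewrite mxE; apply/eqP; rewrite -sqrf_eq0.
have /eqP : normsq v = 0 by apply/eqP; rewrite eq_le v0 normsq_ge0.
by rewrite psumr_eq0 => [/allP/(_ j (mem_index_enum _))|i _]; rewrite ?sqr_ge0.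
Qed.

Lemma normsqZ a v : normsq (a *: v) = a ^+ 2 * normsq v.
Proof. by rewrite /normsq mulr_sumr; apply: eq_bigr => j _; rewrite mxE exprMn. Qed.

(* For K = (H^2 + eta^2)^-1, the resolvent (H - i eta)^-1 is A + i B with A = H K, B = eta K. *)
Definition resK H := invmx (H *m H + (eta ^+ 2)%:M).
Definition resA H := H *m resK H.
Definition resB H := eta *: resK H.

Hypothesis eta_ge1 : 1 <= eta.
Variable H : 'M[F]_n.
Hypothesis Hsym : H^T = H.

Local Notation K := (resK H).
Local Notation A := (resA H).
Local Notation B := (resB H).

(** The quadratic form of the matrix at [v] is |v H|^2 + eta^2 |v|^2, which vanishes only for
    [v = 0]. *)
Lemma res_unit : H *m H + (eta ^+ 2)%:M \in unitmx.
Proof.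
rewrite -row_free_unit; apply: inj_row_free => v.
rewrite mulmxDr mul_mx_scalar => /(congr1 (fun u => (u *m v^T) 0 0)).
rewrite mulmxDl mul0mx mulmxA -mulmxA -{2}Hsym -trmx_mul -scalemxAl !mxE.
rewrite -/(normsq _) => e.
have := normsqE (v *m H); rewrite mxE => e1.
have := normsqE v; rewrite mxE => e2.
move: e; rewrite -e1 -e2 => e; apply: normsq_eq0.
have := normsq_ge0 (v *m H); have := normsq_ge0 v => ? ?.
have : 0 < eta ^+ 2 by rewrite exprn_gt0 // (lt_le_trans ltr01).
nra.
Qed.

Lemma mulKr : (H *m H + (eta ^+ 2)%:M) *m K = 1%:M.
Proof. exact: mulmxV res_unit. Qed.

Lemma mulKl : K *m (H *m H + (eta ^+ 2)%:M) = 1%:M.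
Proof. exact: mulVmx res_unit. Qed.

Lemma resK_sym : K^T = K.
Proof. by rewrite /resK trmx_inv linearD /= trmx_mul Hsym tr_scalar_mx. Qed.

Lemma resK_comm : H *m K = K *m H.
Proof.
have hc : (H *m H + (eta ^+ 2)%:M) *m H = H *m (H *m H + (eta ^+ 2)%:M).
  by rewrite mulmxDl mulmxDr mulmxA scalar_mxC.
by rewrite -[LHS]mul1mx -mulKl -!mulmxA (mulmxA _ H K) hc -mulmxA mulKr mulmx1.
Qed.

Lemma resA_sym : A^T = A.
Proof. by rewrite /resA trmx_mul resK_sym Hsym resK_comm. Qed.

Lemma resB_sym : B^T = B.
Proof. by rewrite /resB linearZ /= resK_sym. Qed.

Lemma mulHA : H *m A + eta *: B = 1%:M.
Proof.
rewrite /resA /resB scalerA -expr2 mulmxA -mul_scalar_mx -mulmxDl; exact: mulKr.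
Qed.

Lemma mulHB : H *m B = eta *: A.
Proof. by rewrite /resA /resB -scalemxAr. Qed.

Lemma mulAH : A *m H + eta *: B = 1%:M.
Proof.
have /(congr1 trmx) := mulHA.
by rewrite trmx1 raddfD /= trmx_mul resA_sym Hsym [(eta *: B)^T]linearZ /= resB_sym.
Qed.

Lemma mulBH : B *m H = eta *: A.
Proof.
have /(congr1 trmx) := mulHB.
by rewrite trmx_mul resB_sym Hsym [(eta *: A)^T]linearZ /= resA_sym.
Qed.

Lemma mulAA_BB : A *m A + B *m B = K.
Proof.
have -> : A *m A = K *m (H *m A) by rewrite (mulmxA K H A) -resK_comm.
have -> : B *m B = K *m (eta *: B) by rewrite -(scalemxAr eta K B) scalemxAl.
by rewrite -mulmxDr mulHA mulmx1.
Qed.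

(* The Ward identity A^2 + B^2 = K, as a quadratic form. *)
Lemma normsq_resAB v :
  normsq (v *m A) + normsq (v *m B) = (v *m K *m v^T) 0 0.
Proof.
rewrite !normsqE !(trmx_mul v) resA_sym resB_sym -mulAA_BB mulmxDr mulmxDl (mulmxA v A) (mulmxA v B) (mulmxA (v *m A)) (mulmxA (v *m B)).
by rewrite [RHS]mxE.
Qed.

(** The bound [K <= 1 / eta^2] without diagonalization. With q = v K v^T, the Ward identity gives
    eta^2 |v K|^2 <= q, and expanding 0 <= |eta^2 v K - v|^2 then yields eta^2 q <= |v|^2. *)
Lemma normsq_resAB_le v : normsq (v *m A) + normsq (v *m B) <= normsq v / eta ^+ 2.
Proof.
rewrite normsq_resAB.
have e0 : 0 < eta ^+ 2 by rewrite exprn_gt0 // (lt_le_trans ltr01).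
rewrite ler_pdivlMr //.
set q := (v *m K *m v^T) 0 0.
have h1 : eta ^+ 2 * normsq (v *m K) <= q.
  rewrite /q -normsq_resAB -normsqZ scalemxAr -/B lerDr; exact: normsq_ge0.
have h2 : normsq (eta ^+ 2 *: (v *m K) - v) =
   eta ^+ 2 * (eta ^+ 2 * normsq (v *m K)) - 2 * eta ^+ 2 * q + normsq v.
  rewrite mulrA -expr2 -normsqZ /q /normsq [in RHS]mxE mulr_sumr -sumrN.
  rewrite -big_split -big_split /=; apply: eq_bigr => j _.
  rewrite !mxE; ring.
have := normsq_ge0 (eta ^+ 2 *: (v *m K) - v); rewrite h2.
have : eta ^+ 2 * (eta ^+ 2 * normsq (v *m K)) <= eta ^+ 2 * q by rewrite ler_pM2l.
lra.
Qed.

Lemma normsq_resAB_le1 v : normsq (v *m A) + normsq (v *m B) <= normsq v.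
Proof.
apply: le_trans (normsq_resAB_le v) _.
have e0 : 1 <= eta ^+ 2 by rewrite exprn_ege1.
rewrite ler_pdivrMr ?(lt_le_trans ltr01) // ler_peMr // normsq_ge0 //.
Qed.

Lemma row_resAB i : \sum_j A i j ^+ 2 + \sum_j B i j ^+ 2 <= 1.
Proof.
have := normsq_resAB_le1 (delta_mx 0 i); rewrite -!rowE.
have -> : normsq (delta_mx 0 i) = 1 :> F.
  rewrite /normsq (bigD1 i) //= big1 ?mxE ?eqxx ?expr1n ?addr0 // => j ji.
  by rewrite mxE eqxx (negbTE ji) expr0n.
rewrite /normsq.
by under eq_bigr do rewrite mxE; under [X in _ + X <= _ -> _]eq_bigr do rewrite mxE.
Qed.

Lemma row_resA i : \sum_j A i j ^+ 2 <= 1.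
Proof.
apply: le_trans (row_resAB i); rewrite lerDl; apply: sumr_ge0 => j _; exact: sqr_ge0.
Qed.

Lemma row_resB i : \sum_j B i j ^+ 2 <= 1.
Proof.
apply: le_trans (row_resAB i); rewrite lerDr; apply: sumr_ge0 => j _; exact: sqr_ge0.
Qed.

Lemma resA_le1 i j : `|A i j| <= 1.
Proof.
rewrite -(@ler_sqr _ `|_| 1) ?nnegrE // expr1n real_normK ?num_real //.
apply: le_trans (row_resA i); rewrite (bigD1 j) //= lerDl.
by apply: sumr_ge0 => l _; exact: sqr_ge0.
Qed.

Lemma resB_le1 i j : `|B i j| <= 1.
Proof.
rewrite -(@ler_sqr _ `|_| 1) ?nnegrE // expr1n real_normK ?num_real //.
apply: le_trans (row_resB i); rewrite (bigD1 j) //= lerDl.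
by apply: sumr_ge0 => l _; exact: sqr_ge0.
Qed.

(** By the Ward identity [K i i] is a sum of squares. The sign makes the partial traces of [B]
    nonnegative, on which the contraction relies. *)
Lemma resB_ge0 i : 0 <= B i i.
Proof.
rewrite mxE mulr_ge0 //; first exact: le_trans ler01 _.
have := normsq_resAB (delta_mx 0 i); rewrite -!rowE.
have -> : (row i K *m (delta_mx 0 i : 'rV[F]_n)^T) 0 0 = K i i.
  rewrite mxE (bigD1 i) //= big1 => [|j ji]; last first.
    by rewrite [_^T _ _]mxE [delta_mx _ _ _ _]mxE (negbTE ji) andbF mulr0.
  by rewrite [_^T _ _]mxE [delta_mx _ _ _ _]mxE !eqxx mulr1 addr0 mxE.
by move=> <-; rewrite addr_ge0 // normsq_ge0.
Qed.

Lemma quad_le v (M : 'M[F]_n) : normsq (v *m M) <= normsq v ->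
  `|(v *m M *m v^T) 0 0| <= normsq v.
Proof.
move=> h; rewrite mxE.
apply: (@le_trans _ _ (\sum_j ((v *m M) 0 j ^+ 2 + v 0 j ^+ 2) / 2)).
  apply: le_trans (ler_norm_sum _ _ _) _; apply: ler_sum => j _.
  rewrite [v^T _ _]mxE ler_norml; apply/andP; split;
  have := sqr_ge0 ((v *m M) 0 j - v 0 j); have := sqr_ge0 ((v *m M) 0 j + v 0 j); lra.
rewrite -mulr_suml big_split /= -/(normsq _) -/(normsq _); lra.
Qed.

Lemma quad_resA v : `|(v *m A *m v^T) 0 0| <= normsq v.
Proof.
apply: quad_le; apply: le_trans (normsq_resAB_le1 v); rewrite lerDl; exact: normsq_ge0.
Qed.

Lemma quad_resB v : `|(v *m B *m v^T) 0 0| <= normsq v.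
Proof.
apply: quad_le; apply: le_trans (normsq_resAB_le1 v); rewrite lerDr; exact: normsq_ge0.
Qed.

End Resolvent.

(** With G = A + i B, this and [resolvent_idB] are the real and imaginary parts of G - G0 = - G (H -
    H0) G0. *)
Lemma resolvent_idA (F : realFieldType) n (eta : F) (H H0 : 'M[F]_n) : 1 <= eta ->
  H^T = H -> H0^T = H0 ->
  resA eta H - resA eta H0 =
   - (resA eta H *m (H - H0) *m resA eta H0 - resB eta H *m (H - H0) *m resB eta H0).
Proof.
move=> e1 Hs H0s.
have := mulHA e1 H0s; have := mulAH e1 Hs; have := mulHB eta H0; have := mulBH e1 Hs.
move: (resA eta H) (resB eta H) (resA eta H0) (resB eta H0) => A B A0 B0 e2 e3.
move=> /(canRL (addrK _)) e4 /(canRL (addrK _)) e5.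
rewrite !mulmxBr !mulmxBl e2 e4 -!mulmxA e3 e5 !mulmxBl !mulmxBr !mul1mx !mulmx1.
rewrite -!scalemxAl -!scalemxAr.
by apply/matrixP => i j; rewrite !mxE; ring.
Qed.

Lemma resolvent_idB (F : realFieldType) n (eta : F) (H H0 : 'M[F]_n) : 1 <= eta ->
  H^T = H -> H0^T = H0 ->
  resB eta H - resB eta H0 =
   - (resA eta H *m (H - H0) *m resB eta H0 + resB eta H *m (H - H0) *m resA eta H0).
Proof.
move=> e1 Hs H0s.
have := mulHA e1 H0s; have := mulAH e1 Hs; have := mulHB eta H0; have := mulBH e1 Hs.
move: (resA eta H) (resB eta H) (resA eta H0) (resB eta H0) => A B A0 B0 e2 e3.
move=> /(canRL (addrK _)) e4 /(canRL (addrK _)) e5.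
rewrite !mulmxBr !mulmxBl e2 e4 -!mulmxA e3 e5 !mulmxBl !mulmxBr !mul1mx !mulmx1.
rewrite -!scalemxAl -!scalemxAr.
by apply/matrixP => i j; rewrite !mxE; ring.
Qed.

(** * Rank-two perturbations *)

Lemma mulmx_delta (F : realFieldType) n (A B : 'M[F]_n) i j p q :
  (A *m delta_mx i j *m B) p q = A p i * B j q.
Proof.
rewrite mxE (bigD1 j) //= big1 => [|l lj]; last first.
  rewrite mxE big1 ?mul0r // => m _.
  by rewrite [delta_mx _ _ _ _]mxE (negbTE lj) andbF mulr0.
rewrite addr0 mxE (bigD1 i) //= big1 => [|m mi]; last first.
  by rewrite [delta_mx _ _ _ _]mxE (negbTE mi) mulr0.
by rewrite [delta_mx _ _ _ _]mxE !eqxx mulr1 addr0.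
Qed.

Lemma ler_norm2M (F : realFieldType) (x y : F) : `|x| <= 1 -> `|y| <= 1 -> `|x * y| <= 1.
Proof. by move=> hx hy; rewrite normrM mulr_ile1. Qed.

Lemma normB_mul (F : realFieldType) (x y x0 y0 t : F) :
  `|x| <= 1 -> `|y0| <= 1 -> `|x - x0| <= t -> `|y - y0| <= t ->
  `|x * y - x0 * y0| <= 2 * t.
Proof.
move=> hx hy h1 h2.
have -> : x * y - x0 * y0 = x * (y - y0) + (x - x0) * y0 by ring.
apply: le_trans (ler_normD _ _) _; rewrite !normrM.
have : `|x| * `|y - y0| <= 1 * `|y - y0| by rewrite ler_wpM2r.
have : `|x - x0| * `|y0| <= `|x - x0| * 1 by rewrite ler_wpM2l.
lra.
Qed.

Section Perturbation.
Variables (F : realFieldType) (n : nat) (eta : F).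
Hypothesis eta_ge1 : 1 <= eta.
Variables (H H0 : 'M[F]_n) (eps : F) (i j : 'I_n).
Hypotheses (Hs : H^T = H) (H0s : H0^T = H0).
Hypothesis HE : H = H0 + eps *: (delta_mx i j + delta_mx j i).

Local Notation A := (resA eta H).
Local Notation B := (resB eta H).
Local Notation A0 := (resA eta H0).
Local Notation B0 := (resB eta H0).

Lemma rank2_mul (X Y : 'M[F]_n) p q :
  (X *m (H - H0) *m Y) p q = eps * (X p i * Y j q + X p j * Y i q).
Proof.
rewrite HE addrC addKr -scalemxAr -scalemxAl mxE mulmxDr mulmxDl mxE.
by rewrite !mulmx_delta.
Qed.

Lemma resA_diff p q : A p q - A0 p q =
  - (eps * (A p i * A0 j q + A p j * A0 i q - B p i * B0 j q - B p j * B0 i q)).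
Proof.
have /matrixP/(_ p q) := resolvent_idA eta_ge1 Hs H0s.
rewrite mxE [(- A0) p q]mxE => ->; rewrite mxE [in LHS]mxE rank2_mul.
rewrite [(- (B *m _ *m _)) p q]mxE rank2_mul; ring.
Qed.

Lemma resB_diff p q : B p q - B0 p q =
  - (eps * (A p i * B0 j q + A p j * B0 i q + B p i * A0 j q + B p j * A0 i q)).
Proof.
have /matrixP/(_ p q) := resolvent_idB eta_ge1 Hs H0s.
rewrite mxE [(- B0) p q]mxE => ->; rewrite mxE [in LHS]mxE !rank2_mul; ring.
Qed.

Lemma norm4_le (x1 x2 x3 x4 t : F) : `|x1| <= t -> `|x2| <= t -> `|x3| <= t ->
  `|x4| <= t -> `|x1 + x2 + x3 + x4| <= 4 * t.
Proof.
move=> h1 h2 h3 h4; have := ler_normD (x1 + x2 + x3) x4; have := ler_normD (x1 + x2) x3; have := ler_normD x1 x2; lra.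
Qed.

Lemma resA_diff_le p q : `|A p q - A0 p q| <= 4 * `|eps|.
Proof.
rewrite resA_diff normrN normrM mulrC; apply: ler_wpM2r => //.
rewrite -[4]mulr1; apply: norm4_le; rewrite ?normrN ler_norm2M //;
  do ?[exact: resA_le1 | exact: resB_le1].
Qed.

Lemma resB_diff_le p q : `|B p q - B0 p q| <= 4 * `|eps|.
Proof.
rewrite resB_diff normrN normrM mulrC; apply: ler_wpM2r => //.
rewrite -[4]mulr1; apply: norm4_le; rewrite ler_norm2M //;
  do ?[exact: resA_le1 | exact: resB_le1].
Qed.

Lemma sum_mul_le1 (u : pred 'I_n) (f g : 'I_n -> F) :
  \sum_l f l ^+ 2 <= 1 -> \sum_l g l ^+ 2 <= 1 -> `|\sum_(l | u l) f l * g l| <= 1.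
Proof.
move=> hf hg; apply: le_trans (ler_norm_sum _ _ _) _.
apply: (@le_trans _ _ (\sum_l (f l ^+ 2 + g l ^+ 2) / 2)).
  apply: (@le_trans _ _ (\sum_l `|f l * g l|)).
    rewrite big_mkcond; apply: ler_sum => l _; case: (u l) => //.
  apply: ler_sum => l _; rewrite ler_norml; apply/andP; split;
  have := sqr_ge0 (f l - g l); have := sqr_ge0 (f l + g l); lra.
rewrite -mulr_suml big_split /=; lra.
Qed.

Lemma row_sum_sym (M : 'M[F]_n) q : M^T = M -> \sum_l M l q ^+ 2 = \sum_l M q l ^+ 2.
Proof. by move=> Ms; apply: eq_bigr => l _; rewrite -{1}Ms mxE. Qed.

Lemma colA_le1 q : \sum_l A l q ^+ 2 <= 1.
Proof. by rewrite row_sum_sym ?resA_sym // row_resA. Qed.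
Lemma colB_le1 q : \sum_l B l q ^+ 2 <= 1.
Proof. by rewrite row_sum_sym ?resB_sym // row_resB. Qed.

(** Each of the four sums over [l] pairs a column of [A] or [B] with a row of [A0] or [B0], all of
    norm at most 1. A sum of up to n diagonal changes therefore obeys the same bound as a single
    one. *)
Lemma trA_diff_le (u : pred 'I_n) :
  `|\sum_(l | u l) A l l - \sum_(l | u l) A0 l l| <= 4 * `|eps|.
Proof.
rewrite -sumrB; under eq_bigr do rewrite resA_diff.
rewrite sumrN -mulr_sumr normrN normrM mulrC; apply: ler_wpM2r => //.
rewrite !sumrB big_split /= -[4]mulr1.
apply: norm4_le; rewrite ?normrN; apply: sum_mul_le1;
  do ?[exact: colA_le1 | exact: colB_le1 | exact: row_resA | exact: row_resB].
Qed.

Lemma trB_diff_le (u : pred 'I_n) :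
  `|\sum_(l | u l) B l l - \sum_(l | u l) B0 l l| <= 4 * `|eps|.
Proof.
rewrite -sumrB; under eq_bigr do rewrite resB_diff.
rewrite sumrN -mulr_sumr normrN normrM mulrC; apply: ler_wpM2r => //.
rewrite !big_split /= -[4]mulr1.
apply: norm4_le; apply: sum_mul_le1;
  do ?[exact: colA_le1 | exact: colB_le1 | exact: row_resA | exact: row_resB].
Qed.

(* Coefficients of the first-order changes of [B i j] and [A i j] when [H i j] and [H j i] change
   by [eps]: they change by [- eps * crossB A B] and [- eps * crossA A B], up to order [eps^2]. *)
Definition crossB (X Y : 'M[F]_n) :=
  X i i * Y j j + X i j * Y i j + Y i i * X j j + Y i j * X i j.
Definition crossA (X Y : 'M[F]_n) :=
  X i i * X j j + X i j * X i j - Y i i * Y j j - Y i j * Y i j.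

(** Common to [A] and [B]: [y] is the entry at (i, j), and the products [p * q] and [a * b] make up
    the cross terms after and before the perturbation. The error consists of [- s * x ^+ 2 * D1],
    from replacing [p] by [a] in the exact difference [y - y0], and of [s * D2], from replacing the
    whole cross term. The constants are 16 = 4 * 4 and 32 = 4 * 2 * 4: four products, whose factors
    move by at most [4 * |eps|]. *)
Lemma expand_aux (s x y y0 p1 p2 p3 p4 q1 q2 q3 q4 a1 a2 a3 a4 b1 b2 b3 b4 : F) :
  0 <= s -> eps = s * x ->
  `|p1| <= 1 -> `|p2| <= 1 -> `|p3| <= 1 -> `|p4| <= 1 ->
  `|b1| <= 1 -> `|b2| <= 1 -> `|b3| <= 1 -> `|b4| <= 1 ->
  `|p1 - a1| <= 4 * `|eps| -> `|p2 - a2| <= 4 * `|eps| ->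
  `|p3 - a3| <= 4 * `|eps| -> `|p4 - a4| <= 4 * `|eps| ->
  `|q1 - b1| <= 4 * `|eps| -> `|q2 - b2| <= 4 * `|eps| ->
  `|q3 - b3| <= 4 * `|eps| -> `|q4 - b4| <= 4 * `|eps| ->
  y - y0 = - (eps * (p1 * b1 + p2 * b2 + p3 * b3 + p4 * b4)) ->
  `|x * y + s * (p1 * q1 + p2 * q2 + p3 * q3 + p4 * q4)
    - (x * y0 - (x ^+ 2 - 1) * (s * (a1 * b1 + a2 * b2 + a3 * b3 + a4 * b4)))|
  <= s ^+ 2 * (16 * `|x| ^+ 3 + 32 * `|x|).
Proof.
move=> s0 epsE P1 P2 P3 P4 B1 B2 B3 B4 h1 h2 h3 h4 k1 k2 k3 k4 hy.
set D1 := (p1 - a1) * b1 + (p2 - a2) * b2 + (p3 - a3) * b3 + (p4 - a4) * b4.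
set D2 := (p1 * q1 - a1 * b1) + (p2 * q2 - a2 * b2) + (p3 * q3 - a3 * b3) +
   (p4 * q4 - a4 * b4).
have -> : x * y + s * (p1 * q1 + p2 * q2 + p3 * q3 + p4 * q4)
    - (x * y0 - (x ^+ 2 - 1) * (s * (a1 * b1 + a2 * b2 + a3 * b3 + a4 * b4)))
  = - (s * x ^+ 2 * D1) + s * D2.
  have -> : y = y0 - (eps * (p1 * b1 + p2 * b2 + p3 * b3 + p4 * b4)).
    by rewrite -hy addrC subrK.
  by rewrite epsE /D1 /D2; ring.
have hD1 : `|D1| <= 4 * (4 * `|eps|).
  apply: norm4_le; rewrite normrM -[leRHS]mulr1 ler_pM //.
have hD2 : `|D2| <= 4 * (2 * (4 * `|eps|)).
  by apply: norm4_le; apply: normB_mul.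
apply: le_trans (ler_normD _ _) _.
rewrite normrN [`|s * _ * _|]normrM [`|s * x ^+ 2|]normrM normrX [`|s * D2|]normrM (ger0_norm s0).
have ne : `|eps| = s * `|x| by rewrite epsE normrM (ger0_norm s0).
rewrite ne in hD1 hD2.
have : s * `|x| ^+ 2 * `|D1| <= s * `|x| ^+ 2 * (4 * (4 * (s * `|x|))).
  by rewrite ler_wpM2l // mulr_ge0 // sqr_ge0.
have : s * `|D2| <= s * (4 * (2 * (4 * (s * `|x|)))) by rewrite ler_wpM2l.
lra.
Qed.

(* If [x] has mean 0 and variance 1 and is independent of [H0], the two terms
   [x * B0 i j] and [(x ^+ 2 - 1) * (s * crossB A0 B0)] have mean zero. *)
Lemma zetaB_expand (s x : F) : 0 <= s -> eps = s * x ->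
  `|x * B i j + s * crossB A B - (x * B0 i j - (x ^+ 2 - 1) * (s * crossB A0 B0))|
  <= s ^+ 2 * (16 * `|x| ^+ 3 + 32 * `|x|).
Proof.
move=> s0 ee; apply: expand_aux => //;
  do ?[exact: resA_le1|exact: resB_le1|exact: resA_diff_le|exact: resB_diff_le].
exact: resB_diff.
Qed.

Lemma zetaA_expand (s x : F) : 0 <= s -> eps = s * x ->
  `|x * A i j + s * crossA A B - (x * A0 i j - (x ^+ 2 - 1) * (s * crossA A0 B0))|
  <= s ^+ 2 * (16 * `|x| ^+ 3 + 32 * `|x|).
Proof.
move=> s0 ee; rewrite /crossA.
have E (M : 'M[F]_n) p q r t : - (M p q * M r t) = M p q * (- M r t) by rewrite mulrN.
rewrite !E; apply: expand_aux => //; rewrite -?opprD ?normrN;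
  do ?[exact: resA_le1|exact: resB_le1|exact: resA_diff_le|exact: resB_diff_le].
rewrite resA_diff; ring.
Qed.

Lemma zetaB_le (s x : F) : 0 <= s <= 1 -> `|x * B i j + s * crossB A B| <= `|x| + 4.
Proof.
move=> /andP[s0 s1]; apply: le_trans (ler_normD _ _) _; apply: lerD.
  by rewrite normrM ler_piMr // resB_le1.
rewrite normrM (ger0_norm s0) -[leRHS]mul1r ler_pM // -[4]mulr1.
by apply: norm4_le; apply: ler_norm2M; do ?[exact: resA_le1 | exact: resB_le1].
Qed.

Lemma zetaA_le (s x : F) : 0 <= s <= 1 -> `|x * A i j + s * crossA A B| <= `|x| + 4.
Proof.
move=> /andP[s0 s1]; apply: le_trans (ler_normD _ _) _; apply: lerD.
  by rewrite normrM ler_piMr // resA_le1.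
rewrite normrM (ger0_norm s0) -[leRHS]mul1r ler_pM // -[4]mulr1.
by apply: norm4_le; rewrite ?normrN; apply: ler_norm2M; do ?[exact: resA_le1 | exact: resB_le1].
Qed.

End Perturbation.

(** * Partial traces and the self-consistent equations *)

Section SelfConsistent.
Variables (F : realFieldType) (n : nat) (eta s w : F).
Hypothesis eta_ge1 : 1 <= eta.
Variables (M : 'M[F]_n) (X : 'I_n -> 'I_n -> F) (u : pred 'I_n).
Hypothesis Msym : M^T = M.
Hypothesis Mu : forall i j, u i -> M i j = if u j then w else X i j.
Hypothesis s_norm : s ^+ 2 * n%:R = 1.
Hypothesis s01 : 0 <= s <= 1.

Local Notation H := (s *: M).
Local Notation A := (resA eta H).
Local Notation B := (resB eta H).

Let Hs : H^T = H. Proof. by rewrite linearZ /= Msym. Qed.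

(* In the applications [s = 1 / sqrt n], so that this is the trace over [v] divided by [n]. *)
Definition ptr (Y : 'M[F]_n) (v : pred 'I_n) := s ^+ 2 * \sum_(i | v i) Y i i.

Lemma ptr_split (Y : 'M[F]_n) : ptr Y predT - ptr Y u = s ^+ 2 * \sum_(i | ~~ u i) Y i i.
Proof. by rewrite /ptr (bigID u) /= mulrDr addrC addKr. Qed.

Definition ind_row : 'rV[F]_n := \row_i (u i)%:R.

Lemma normsq_ind : normsq ind_row <= n%:R.
Proof.
rewrite /normsq -[X in _ <= X%:R]card_ord -sum1_card natr_sum.
by apply: ler_sum => i _; rewrite mxE; case: (u i); rewrite ?expr1n ?expr0n.
Qed.

Lemma quad_ind (Y : 'M[F]_n) :
  (ind_row *m Y *m ind_row^T) 0 0 = \sum_(i | u i) \sum_(j | u j) Y j i.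
Proof.
rewrite mxE [RHS]big_mkcond; apply: eq_bigr => i _.
rewrite [ind_row^T _ _]mxE [ind_row _ _]mxE; case: (u i); rewrite ?mulr0 // mulr1.
rewrite mxE [RHS]big_mkcond; apply: eq_bigr => j _.
by rewrite [ind_row _ _]mxE; case: (u j); rewrite ?mul0r ?mul1r.
Qed.

Lemma sum_HY (Y : 'M[F]_n) : \sum_(i | u i) (H *m Y) i i =
  s * (w * \sum_(i | u i) \sum_(j | u j) Y j i +
       \sum_(i | u i) \sum_(j | ~~ u j) X i j * Y j i).
Proof.
rewrite mulr_sumr -big_split mulr_sumr; apply: eq_bigr => i ui.
rewrite mxE (bigID u) /= mulrDr !mulr_sumr; congr (_ + _).
  by apply: eq_bigr => j uj; rewrite mxE Mu // uj; ring.
by apply: eq_bigr => j uj; rewrite mxE Mu // (negbTE uj); ring.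
Qed.

(** To first order the mean of [X i j * B i j] is [- s] times the mean of the cross term, as in a
    cumulant expansion. Adding the cross term back leaves a nearly centred quantity. *)
Definition zetaB (i j : 'I_n) := X i j * B i j + s * crossB i j A B.
Definition zetaA (i j : 'I_n) := X i j * A i j + s * crossA i j A B.

(* The left-hand sides of the self-consistent equations of the header, the second one without - 1/k. *)
Definition resFA : F := eta * ptr A u + ptr A u * (ptr B predT - ptr B u)
   + ptr B u * (ptr A predT - ptr A u).
Definition resFB : F := eta * ptr B u - ptr A u * (ptr A predT - ptr A u)
   + ptr B u * (ptr B predT - ptr B u).

Lemma ptr_mul (Y Z : 'M[F]_n) : ptr Y u * (ptr Z predT - ptr Z u) =
  s ^+ 4 * \sum_(i | u i) \sum_(j | ~~ u j) Y i i * Z j j.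
Proof.
by rewrite ptr_split /ptr mulrACA -exprD big_distrlr.
Qed.

Let Bsym i j : B i j = B j i.
Proof. by rewrite -{1}(resB_sym eta Hs) mxE. Qed.
Let Asym i j : A i j = A j i.
Proof. by rewrite -{1}(resA_sym eta_ge1 Hs) mxE. Qed.

(** The trace of [eta * A = H B] over the class runs through all entries of the rows of the class.
    Of the cross terms put into [zetaB], the parts [A i i * B j j] and [B i i * A j j] sum to the
    products of partial traces in [resFA]; the parts [A i j * B i j] remain as an error. *)
Lemma resFAE : resFA = s ^+ 3 * w * \sum_(i | u i) \sum_(j | u j) B j i
   + s ^+ 3 * \sum_(i | u i) \sum_(j | ~~ u j) zetaB i j
   - 2 * s ^+ 4 * \sum_(i | u i) \sum_(j | ~~ u j) A i j * B i j.
Proof.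
rewrite /resFA !ptr_mul.
have -> : eta * ptr A u = s ^+ 2 * \sum_(i | u i) (H *m B) i i.
  rewrite /ptr mulrCA [eta * _]mulr_sumr; congr (_ * _); apply: eq_bigr => i _.
  by rewrite (mulHB eta H) [RHS]mxE.
rewrite sum_HY.
have -> : \sum_(i | u i) \sum_(j | ~~ u j) zetaB i j =
  \sum_(i | u i) \sum_(j | ~~ u j) X i j * B j i +
  s * \sum_(i | u i) \sum_(j | ~~ u j) A i i * B j j +
  s * \sum_(i | u i) \sum_(j | ~~ u j) B i i * A j j +
  2 * s * \sum_(i | u i) \sum_(j | ~~ u j) A i j * B i j.
  rewrite !mulr_sumr -!big_split; apply: eq_bigr => i _.
  rewrite !mulr_sumr -!big_split; apply: eq_bigr => j _.
  by rewrite /zetaB /crossB (Bsym j i) /=; ring.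
ring.
Qed.

Lemma resFBE : resFB = s ^+ 2 * #|u|%:R
   - s ^+ 3 * w * \sum_(i | u i) \sum_(j | u j) A j i
   - s ^+ 3 * \sum_(i | u i) \sum_(j | ~~ u j) zetaA i j
   + s ^+ 4 * \sum_(i | u i) \sum_(j | ~~ u j) (A i j ^+ 2 - B i j ^+ 2).
Proof.
rewrite /resFB !ptr_mul.
have -> : eta * ptr B u = s ^+ 2 * #|u|%:R - s ^+ 2 * \sum_(i | u i) (H *m A) i i.
  rewrite /ptr mulrCA [eta * _]mulr_sumr -mulrBr; congr (_ * _).
  rewrite -sum1_card natr_sum -sumrB; apply: eq_bigr => i _.
  have /matrixP/(_ i i) := mulHA eta_ge1 Hs.
  have -> : (H *m A + eta *: B) i i = (H *m A) i i + eta * B i i.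
    by rewrite mxE; congr (_ + _); rewrite mxE.
  by rewrite [X in _ = X]mxE eqxx => <-; rewrite addrAC subrr add0r.
rewrite sum_HY.
have -> : \sum_(i | u i) \sum_(j | ~~ u j) zetaA i j =
  \sum_(i | u i) \sum_(j | ~~ u j) X i j * A j i +
  s * \sum_(i | u i) \sum_(j | ~~ u j) A i i * A j j -
  s * \sum_(i | u i) \sum_(j | ~~ u j) B i i * B j j +
  s * \sum_(i | u i) \sum_(j | ~~ u j) (A i j ^+ 2 - B i j ^+ 2).
  rewrite !mulr_sumr -sumrN -!big_split; apply: eq_bigr => i _.
  rewrite !mulr_sumr -sumrN -!big_split; apply: eq_bigr => j _.
  by rewrite /zetaA /crossA (Asym j i) /=; ring.
ring.
Qed.

(** Rows of [A] and [B] have joint norm at most 1, so these sums over n^2 pairs are only of order n.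
    Multiplied by [s ^+ 4] they are negligible. *)
Lemma sum_subpairs_le (f : 'I_n -> 'I_n -> F) :
  (forall i j, `|f i j| <= A i j ^+ 2 + B i j ^+ 2) ->
  `|\sum_(i | u i) \sum_(j | ~~ u j) f i j| <= n%:R.
Proof.
move=> hf.
apply: (@le_trans _ _ (\sum_(i < n) 1)); last by rewrite sumr_const card_ord.
apply: le_trans (ler_norm_sum _ _ _) _; rewrite big_mkcond; apply: ler_sum => i _.
case: (u i) => //; apply: le_trans (row_resAB eta_ge1 Hs i).
apply: le_trans (ler_norm_sum _ _ _) _; rewrite -big_split big_mkcond /=.
apply: ler_sum => j _; case: (u j) => //=.
by rewrite addr_ge0 // sqr_ge0.
Qed.

Let s4n : s ^+ 4 * n%:R <= s.
Proof.
have -> : s ^+ 4 * n%:R = s ^+ 2 by rewrite (_ : 4%N = 2 + 2)%N // exprD -mulrA s_norm mulr1.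
by move: s01 => /andP[s0 s1]; rewrite expr2 ler_piMr.
Qed.

Let s3n : s ^+ 3 * n%:R = s.
Proof. by rewrite exprS -mulrA s_norm mulr1. Qed.

(** The term [|w|] comes from the constant entries: the quadratic form at the indicator of the class
    is at most n, and [s ^+ 3 * n = s]. The 2 comes from the off-diagonal products; in
    [resFB_approx] it is made up of 1 for these and 1 for the size of the class. *)
Lemma resFA_approx :
  `|resFA - s ^+ 3 * \sum_(i | u i) \sum_(j | ~~ u j) zetaB i j| <= s * (`|w| + 2).
Proof.
rewrite resFAE; set x1 := \sum_(i | _) _; set x2 := \sum_(i | _) _; set x3 := \sum_(i | _) _.
have -> : s ^+ 3 * w * x1 + s ^+ 3 * x2 - 2 * s ^+ 4 * x3 - s ^+ 3 * x2 =
   s ^+ 3 * (w * x1) - s ^+ 4 * (2 * x3) by ring.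
have s0 : 0 <= s by case/andP: s01.
apply: le_trans (ler_normB _ _) _.
rewrite mulrDr; apply: lerD.
  rewrite normrM (ger0_norm (exprn_ge0 _ s0)) -[in leRHS]s3n -mulrA ler_wpM2l ?exprn_ge0 //.
  rewrite normrM mulrC ler_wpM2r // /x1 -quad_ind.
  by apply: le_trans (quad_resB eta_ge1 Hs _) normsq_ind.
rewrite normrM (ger0_norm (exprn_ge0 _ s0)).
apply: le_trans (_ : s ^+ 4 * (n%:R * 2) <= _); last first.
  by rewrite mulrA ler_wpM2r.
rewrite ler_wpM2l ?exprn_ge0 // normrM ger0_norm // mulrC ler_wpM2r //.
apply: sum_subpairs_le => i j; rewrite ler_norml; apply/andP.
have := sqr_ge0 (A i j - B i j); have := sqr_ge0 (A i j + B i j).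
by have := sqr_ge0 (A i j); have := sqr_ge0 (B i j); split; nra.
Qed.

Lemma resFB_approx (q : F) : `|s ^+ 2 * #|u|%:R - q| <= s ->
  `|resFB - q + s ^+ 3 * \sum_(i | u i) \sum_(j | ~~ u j) zetaA i j| <= s * (`|w| + 2).
Proof.
move=> hq; rewrite resFBE; set x1 := \sum_(i | _) _; set x2 := \sum_(i | _) _; set x3 := \sum_(i | _) _.
have -> : s ^+ 2 * #|u|%:R - s ^+ 3 * w * x1 - s ^+ 3 * x2 + s ^+ 4 * x3 - q + s ^+ 3 * x2 =
   - (s ^+ 3 * (w * x1)) + (s ^+ 4 * x3 + (s ^+ 2 * #|u|%:R - q)) by ring.
have s0 : 0 <= s by case/andP: s01.
apply: le_trans (ler_normD _ _) _.
rewrite mulrDr normrN; apply: lerD.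
  rewrite normrM (ger0_norm (exprn_ge0 _ s0)) -[in leRHS]s3n -mulrA ler_wpM2l ?exprn_ge0 //.
  rewrite normrM mulrC ler_wpM2r // /x1 -quad_ind.
  by apply: le_trans (quad_resA eta_ge1 Hs _) normsq_ind.
apply: le_trans (ler_normD _ _) _; rewrite mulrDr mulr1; apply: lerD => //.
rewrite normrM (ger0_norm (exprn_ge0 _ s0)); apply: le_trans s4n.
rewrite ler_wpM2l ?exprn_ge0 //.
apply: sum_subpairs_le => i j; rewrite ler_norml; apply/andP.
by have := sqr_ge0 (A i j); have := sqr_ge0 (B i j); split; nra.
Qed.

Lemma ptr_norm_le1 (Y : 'M[F]_n) v : (forall i, `|Y i i| <= 1) -> `|ptr Y v| <= 1.
Proof.
move=> hY; rewrite /ptr normrM ger0_norm ?sqr_ge0 // -[leRHS]s_norm.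
rewrite ler_wpM2l ?sqr_ge0 //; apply: le_trans (ler_norm_sum _ _ _) _.
apply: (@le_trans _ _ (\sum_(i < n) 1)); last by rewrite sumr_const card_ord.
by rewrite big_mkcond; apply: ler_sum => i _; case: (v i).
Qed.

End SelfConsistent.

(** * Contraction towards the solution of the self-consistent equations *)

Lemma young31 (F : realFieldType) (x y : F) : 0 <= x -> 0 <= y ->
  4 * (x * y ^+ 3) <= x ^+ 4 + 3 * y ^+ 4.
Proof.
move=> x0 y0; rewrite -subr_ge0.
have -> : x ^+ 4 + 3 * y ^+ 4 - 4 * (x * y ^+ 3) =
  (x - y) ^+ 2 * ((x + y) ^+ 2 + 2 * y ^+ 2) by ring.
apply: mulr_ge0; first exact: sqr_ge0.
by apply: addr_ge0; [exact: sqr_ge0|apply: mulr_ge0; rewrite ?sqr_ge0].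
Qed.

Section Contraction.
Variables (F : realFieldType) (k : nat) (eta c : F) (al be : 'I_k -> F).
Hypothesis k0 : (0 < k)%N.
Hypothesis eta_large : 2 * k%:R + 1 <= eta.
Hypothesis c0 : 0 <= c.
Hypothesis cE : eta * c = k%:R^-1 - (k%:R - 1) * c ^+ 2.
Hypothesis al1 : forall u, `|al u| <= 1.
Hypothesis be1 : forall u, `|be u| <= 1.
Hypothesis be0 : forall u, 0 <= be u.

Let al_ := \sum_v al v.
Let be_ := \sum_v be v.
Let de u := be u - c.

Lemma sum_young (f g : 'I_k -> F) : (forall u, 0 <= f u) -> (forall u, 0 <= g u) ->
  \sum_u (\sum_v f v) * g u ^+ 3 <=
  k%:R / 4 * \sum_v f v ^+ 4 + k%:R * 3 / 4 * \sum_u g u ^+ 4.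
Proof.
move=> f0 g0.
apply: (@le_trans _ _ (\sum_u \sum_v (f v ^+ 4 / 4 + 3 / 4 * g u ^+ 4))).
  apply: ler_sum => u _; rewrite mulr_suml; apply: ler_sum => v _.
  have := young31 (f0 v) (g0 u); lra.
rewrite le_eqVlt; apply/orP; left; apply/eqP.
under eq_bigr do rewrite big_split /= sumr_const card_ord -mulr_suml.
have mn (x : F) : x *+ k = x * k%:R by rewrite mulr_natr.
rewrite big_split /= sumr_const card_ord sumrMnl -mulr_sumr (mn (_ / 4)) (mn (3 / 4 * _)); ring.
Qed.

Lemma others_norm (f : 'I_k -> F) u : `|\sum_v f v - f u| <= \sum_v `|f v|.
Proof.
rewrite (bigD1 u) //= addrAC subrr add0r [leRHS](bigD1 u) //=.
by apply: le_trans (ler_norm_sum _ _ _) _; rewrite lerDr.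
Qed.

(* The terms [al u ^+ 4 * (be_ - be u)] and [(k - 1) * c * de u ^+ 4] are nonnegative and dropped; the
   remaining products are of the form [f v * g u ^+ 3] up to a bounded factor, whence [sum_young]. *)
Lemma contraction :
  \sum_u (al u ^+ 4 + de u ^+ 4) <=
  \sum_u ((eta * al u + al u * (be_ - be u) + be u * (al_ - al u)) * al u ^+ 3 +
          (eta * be u - k%:R^-1 - al u * (al_ - al u) + be u * (be_ - be u)) * de u ^+ 3).
Proof.
have even4 (x : F) : `|x| ^+ 4 = x ^+ 4 by rewrite -normrX ger0_norm // exprn_even_ge0.
have hA := sum_young (fun v => normr_ge0 (al v)) (fun v => normr_ge0 (al v)).
have hAD := sum_young (fun v => normr_ge0 (al v)) (fun v => normr_ge0 (de v)).
have hD := sum_young (fun v => normr_ge0 (de v)) (fun v => normr_ge0 (de v)).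
have e4 (f : 'I_k -> F) : \sum_v `|f v| ^+ 4 = \sum_v f v ^+ 4 by apply: eq_bigr => v _.
rewrite !e4 in hA hAD hD.
have k1 : 1 <= k%:R :> F by rewrite ler1n.
pose sA := \sum_v `|al v|; pose sD := \sum_v `|de v|.
have key u : eta * (al u ^+ 4 + de u ^+ 4) - sA * `|al u| ^+ 3 - sA * `|de u| ^+ 3
     - sD * `|de u| ^+ 3 <=
   (eta * al u + al u * (be_ - be u) + be u * (al_ - al u)) * al u ^+ 3 +
          (eta * be u - k%:R^-1 - al u * (al_ - al u) + be u * (be_ - be u)) * de u ^+ 3.
  have e1 : 0 <= be_ - be u.
    by rewrite /be_ (bigD1 u) //= addrAC subrr add0r sumr_ge0.
  have e2 : be_ - be u = \sum_v de v - de u + (k%:R - 1) * c.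
    by rewrite /de sumrB sumr_const card_ord -mulr_natr /be_; ring.
  have h1 : 0 <= al u ^+ 4 * (be_ - be u) by rewrite mulr_ge0 // exprn_even_ge0.
  have h2 : `|be u * (al_ - al u) * al u ^+ 3| <= sA * `|al u| ^+ 3.
    rewrite normrM normrX ler_wpM2r ?exprn_ge0 // normrM -[leRHS]mul1r ler_pM //.
    exact: others_norm.
  have h3 : `|al u * (al_ - al u) * de u ^+ 3| <= sA * `|de u| ^+ 3.
    rewrite normrM normrX ler_wpM2r ?exprn_ge0 // normrM -[leRHS]mul1r ler_pM //.
    exact: others_norm.
  have h4 : `|be u * (\sum_v de v - de u) * de u ^+ 3| <= sD * `|de u| ^+ 3.
    rewrite normrM normrX ler_wpM2r ?exprn_ge0 // normrM -[leRHS]mul1r ler_pM //.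
    exact: others_norm.
  have h5 : 0 <= (k%:R - 1) * c * de u ^+ 4.
    by rewrite mulr_ge0 ?exprn_even_ge0 // mulr_ge0 // subr_ge0.
  have -> : (eta * be u - k%:R^-1 - al u * (al_ - al u) + be u * (be_ - be u)) * de u ^+ 3
    = eta * de u ^+ 4 - al u * (al_ - al u) * de u ^+ 3 +
      be u * (\sum_v de v - de u) * de u ^+ 3 + (k%:R - 1) * c * de u ^+ 4.
    (* The equation of [c] absorbs the constant 1/k and the products [(k - 1) * c ^+ 2], so that
       only terms with a factor [al] or [de] survive. *)
    have -> : k%:R^-1 = eta * c + (k%:R - 1) * c ^+ 2 by rewrite cE subrK.
    rewrite e2; have -> : be u = de u + c by rewrite /de subrK.
    ring.
  move: h2 h3 h4; rewrite !ler_norml => /andP[h2 _] /andP[_ h3] /andP[h4 _].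
  have -> : (eta * al u + al u * (be_ - be u) + be u * (al_ - al u)) * al u ^+ 3 =
     eta * al u ^+ 4 + al u ^+ 4 * (be_ - be u) + be u * (al_ - al u) * al u ^+ 3 by ring.
  lra.
apply: le_trans (ler_sum _ (fun u _ => key u)).
rewrite !sumrB -mulr_sumr !big_split /=.
have S1 : 0 <= \sum_u al u ^+ 4 by apply: sumr_ge0 => u _; rewrite exprn_even_ge0.
have S2 : 0 <= \sum_u de u ^+ 4 by apply: sumr_ge0 => u _; rewrite exprn_even_ge0.
move: hA hAD hD S1 S2; rewrite -/sA -/sD.
move: (\sum_u al u ^+ 4) (\sum_u de u ^+ 4) (\sum_u sA * `|al u| ^+ 3) => s1 s2 t1.
move: (\sum_u sA * `|de u| ^+ 3) (\sum_u sD * `|de u| ^+ 3) => t2 t3.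
move=> h1 h2 h3 p1 p2.
(* The three sums cost at most (5k/4) s1 + (7k/4) s2 <= 2k (s1 + s2); the bound [2k + 1] on [eta]
   leaves one full copy of s1 + s2. *)
have q1 : (2 * k%:R + 1) * (s1 + s2) <= eta * (s1 + s2) by rewrite ler_wpM2r // addr_ge0.
have q2 : 0 <= k%:R * s1 by rewrite mulr_ge0.
have q3 : 0 <= k%:R * s2 by rewrite mulr_ge0.
lra.
Qed.

End Contraction.

Lemma count_residue_class (k N u : nat) : (u < k)%N ->
  #|[pred i : 'I_N | (i %% k == u)%N]| = (N %/ k + (u < N %% k))%N.
Proof.
move=> uk; have k0 : (0 < k)%N by case: k uk.
rewrite -sum1_card -(big_mkord (fun i => i %% k == u)%N (fun=> 1%N)).
elim: N => [|N IH]; first by rewrite big_geq // div0n mod0n ltn0.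
rewrite big_mkcond big_nat_recr //= -big_mkcond IH modnS divnS //.
have [/dvdnP[q qE]|nd] := boolP (k %| N.+1)%N.
  have q0 : (0 < q)%N by case: q qE.
  have NE : N = (q.-1 * k + k.-1)%N by case: q q0 qE => // q _; lia.
  have -> : (N %% k = k.-1)%N by rewrite NE modnMDl modn_small // prednK.
  by rewrite ltn0 addn0 /=; case: eqP => h1; case: (ltnP u k.-1) => h2 /=; lia.
by rewrite /=; case: eqP => h1; case: (ltnP u (N %% k)) => h2;
  case: (ltnP u (N %% k).+1) => h3 /=; lia.
Qed.

Lemma card_residue_class (F : realFieldType) (k N u : nat) : (u < k)%N ->
  `|#|[pred i : 'I_N | (i %% k == u)%N]|%:R - N%:R / k%:R| <= 1 :> F.
Proof.
move=> uk; have k0 : (0 < k)%N by case: k uk.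
rewrite count_residue_class // [X in _ - X%:R / _](divn_eq N k) !natrD natrM.
have k0F : 0 < k%:R :> F by rewrite ltr0n.
rewrite mulrDl mulfK ?gt_eqF // opprD addrACA subrr add0r.
have h1 : 0 <= (N %% k)%:R / k%:R :> F by rewrite divr_ge0.
have h2 : (N %% k)%:R / k%:R <= 1 :> F by rewrite ler_pdivrMr // mul1r ler_nat ltnW // ltn_pmod.
by case: (u < _)%N; rewrite /= ?mulr1n ?mulr0n ler_norml; apply/andP; split; lra.
Qed.

(** * Independence *)

Section Independence.
Context {d} {T : measurableType d} {R : realType}.
Variable P : probability T R.

Definition independent_rv (X Y : T -> R) :=
  forall A B : set R, measurable A -> measurable B ->
  P (X @^-1` A `&` Y @^-1` B) = (P (X @^-1` A) * P (Y @^-1` B))%E.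

(** Independence identifies the law of the pair with the product of the two laws, because they agree
    on rectangles; Fubini then factors the integral. *)
Lemma independent_rv_integralM (X Y : {mfun T >-> R}) : independent_rv X Y ->
  P.-integrable setT (EFin \o X) -> P.-integrable setT (EFin \o Y) ->
  (\int[P]_w (X w * Y w)%:E = \int[P]_w (X w)%:E * \int[P]_w (Y w)%:E)%E.
Proof.
move=> ind iX iY.
have mXY : measurable_fun setT (fun w => (X w, Y w)) by apply/measurable_fun_pair.
pose Z : {mfun T >-> (R * R)%type} := mfun_Sub (mem_set mXY).
pose mu := (distribution P X \x distribution P Y)%E.
have muE A : measurable A -> mu A = distribution P Z A.
  move=> mA; apply: (@product_measure_unique _ _ _ _ _ (distribution P X)
    (distribution P Y) (distribution P Z)) => // B C mB mC.
pose h (z : R * R) : R := z.1 * z.2.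
have mf : measurable_fun setT (EFin \o h).
  by apply/measurable_EFinP; apply: measurable_funM.
have iXf : (\int[P]_w `|(X w)%:E| < +oo)%E by case/integrableP: iX.
have iYf : (\int[P]_w `|(Y w)%:E| < +oo)%E by case/integrableP: iY.
have mabs : measurable_fun setT (abse \o (@EFin R)).
  by apply: measurableT_comp => //; exact/measurable_EFinP.
have idX : (\int[distribution P X]_x `|x%:E| = \int[P]_w `|(X w)%:E|)%E.
  by rewrite ge0_integral_distribution.
have idY : (\int[distribution P Y]_x `|x%:E| = \int[P]_w `|(Y w)%:E|)%E.
  by rewrite ge0_integral_distribution.
have imf : mu.-integrable setT (EFin \o h).
  apply/(@integrable12ltyP _ _ _ _ _ (distribution P X) (distribution P Y) _ mf).
  have e1 x : (\int[distribution P Y]_y `|(EFin \o h) (x, y)| =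
      `|x%:E| * \int[distribution P Y]_y `|y%:E|)%E.
    rewrite -ge0_integralZl//.
    by apply: eq_integral => y _; rewrite /= /h normrM EFinM.
  under eq_integral => x _ do rewrite e1.
  rewrite ge0_integralZr// ?idX ?idY; last by apply: integral_ge0.
  by rewrite lte_mul_pinfty // ?ge0_fin_numE// integral_ge0.
have iZ : P.-integrable setT ((EFin \o h) \o Z).
  have := imf; move/integrableP => [_ hfin]; apply/integrableP; split.
    exact: measurableT_comp.
  move: hfin.
  rewrite (eq_measure_integral (distribution P Z)); last by move=> A mA _; exact: muE.
  by rewrite ge0_integral_distribution//; exact: measurableT_comp.
have <- : (\int[distribution P Z]_z (h z)%:E = \int[P]_w (X w * Y w)%:E)%E.
  by rewrite integral_distribution.
rewrite (eq_measure_integral (distribution P X \x distribution P Y)%E); last first.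
  by move=> A mA _; rewrite [LHS](esym (muE _ mA)).
rewrite -integral12_prod_meas1// /fubini_F /=.
have iX' : (distribution P X).-integrable setT EFin.
  by apply: integrable_pushforward => //; exact/measurable_EFinP.
have iY' : (distribution P Y).-integrable setT EFin.
  by apply: integrable_pushforward => //; exact/measurable_EFinP.
have fY : (\int[distribution P Y]_y y%:E)%E \is a fin_num.
  exact: integrable_fin_num.
have e1 x : (\int[distribution P Y]_y (EFin \o h) (x, y) =
    x%:E * \int[distribution P Y]_y y%:E)%E.
  rewrite -integralZl//.
under eq_integral => x _ do rewrite e1.
rewrite -(fineK fY) integralZr// (fineK fY).
by rewrite !integral_distribution//; exact/measurable_EFinP.
Qed.

End Independence.

Section CylinderSigmaAlgebra.
Context {d} {T : measurableType d} {R : realType}.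
Variable P : probability T R.
Context {I : eqType}.
Variables (J : set I) (X : I -> T -> R).
Hypothesis mX : forall i, J i -> measurable_fun setT (X i).
Hypothesis indX : mutually_independent P J X.

Definition cylinders (r : seq I) : set (set T) :=
  [set A | exists2 B : I -> set R, (forall i, measurable (B i)) &
           A = \big[setI/setT]_(i <- r) (X i @^-1` B i)].

Lemma measurable_cylinders r : (forall i, i \in r -> J i) ->
  cylinders r `<=` measurable.
Proof.
move=> rJ _ [B mB ->]; rewrite big_seq; apply: big_ind => //.
  by move=> A C mA mC; exact: measurableI.
by move=> i ir; rewrite -[X in measurable X]setTI; exact: (mX (rJ _ ir)).
Qed.

Lemma cylinders_setI_closed r : setI_closed (cylinders r).
Proof.
move=> _ _ [A mA ->] [B mB ->]; exists (fun i => A i `&` B i).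
  by move=> i; exact: measurableI.
by rewrite -big_split.
Qed.

Lemma cylinders_setT r : cylinders r setT.
Proof. by exists (fun=> setT) => //; rewrite big1_seq // => i _; rewrite preimage_setT. Qed.

Lemma measurable_cylinders_coord r i : i \in r ->
  measurable_fun setT (X i : g_sigma_algebraType (cylinders r) -> R).
Proof.
move=> ir _ B mB; rewrite setTI; apply: sub_sigma_algebra.
exists (fun j => if j == i then B else setT); first by move=> j; case: ifP.
rewrite (eq_big_seq (fun j => if j == i then X i @^-1` B else setT)); last first.
  by move=> j _; case: eqP => [->//|_]; rewrite preimage_setT.
rewrite -big_mkcond /=; elim: r ir => // j r IH.
rewrite inE big_cons eq_sym; case: (altP (j =P i)) => [_ _|_ /= /IH//].
have [ir|ir] := boolP (i \in r); first by rewrite -IH // setIid.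
rewrite big1_seq ?setIT // => l /andP[/eqP -> lr].
by rewrite lr in ir.
Qed.

(* Events defined by the coordinates in [r] form a sigma-algebra generated by the pi-system
   [cylinders r]; the measures P(X e in B, -) and P(X e in B) P agree on it. *)
Lemma independent_rv_cylinders e r (Y : T -> R) : uniq (e :: r) -> J e ->
  (forall i, i \in r -> J i) ->
  measurable_fun setT (Y : g_sigma_algebraType (cylinders r) -> R) ->
  independent_rv P (X e) Y.
Proof.
move=> /= /andP[er ur] Je rJ mY B C mB mC.
have mD : measurable (X e @^-1` B) by rewrite -[X in measurable X]setTI; exact: mX.
have sC : <<s cylinders r >> (Y @^-1` C) by rewrite -[X in <<s _ >> X]setTI; exact: mY.
have fD : P (X e @^-1` B) \is a fin_num by exact: fin_num_measure.
have pD : (0 <= fine (P (X e @^-1` B)))%R by rewrite fine_ge0.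
pose m1 : {measure set T -> \bar R} := mrestr P mD.
pose m2 : {measure set T -> \bar R} := mscale (NngNum pD) P.
have m2E A : m2 A = (P (X e @^-1` B) * P A)%E by rewrite -(fineK fD).
rewrite -m2E.
rewrite setIC -/(m1 (Y @^-1` C)).
apply: (g_sigma_algebra_measure_unique (cylinders r) _ (fun=> setT) _ _ m1 m2 _ _ _ _ sC) => //.
- exact: measurable_cylinders.
- by move=> _; exact: cylinders_setT.
- by rewrite bigcup_const //; exists 0%N.
- exact: cylinders_setI_closed.
- move=> _ [A mA ->]; rewrite m2E /m1 /mrestr /= (indX ur) //.
  (* Joint independence is used for [e :: r], with [B] at [e] and [A i] at the other coordinates; as
     [e] is not in [r], the two prescriptions do not interfere. *)
  have := indX (s := e :: r); move=> /(_ _ _ (fun i => if i == e then B else A i)).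
  rewrite /= er ur => /(_ isT) h.
  have {}h := h _ _; rewrite !big_cons eqxx in h.
  have e1 (V : Type) (op : V -> V -> V) (x0 : V) (F : set T -> V) :
    \big[op/x0]_(i <- r) F (X i @^-1` (if i == e then B else A i)) =
    \big[op/x0]_(i <- r) F (X i @^-1` A i).
    apply: eq_big_seq => i ir; case: eqP => // ie; by rewrite ie in ir; rewrite ir in er.
  rewrite (e1 _ _ _ id) (e1 _ _ _ P) in h.
  rewrite /mrestr setIC h //.
  + by move=> i; rewrite inE => /orP[/eqP ->//|/rJ].
  + by move=> i; case: ifP.
- by move=> _; rewrite /m1 /mrestr /= (le_lt_trans (probability_le1 _ _)) ?ltry //; exact: measurableI.
Qed.

End CylinderSigmaAlgebra.

(** * Measurability of the resolvent *)

(** Inversion is discontinuous at 0, so this point is split off; elsewhere it is continuous on an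
    open set. *)
Lemma measurable_inv (R : realType) : measurable_fun setT (@GRing.inv R).
Proof.
have -> : [set: R] = [set x | x != 0] `|` [set 0].
  by apply/seteqP; split => // x _ /=; case: (eqVneq x 0); [right|left].
have o0 : open [set x : R | x != 0] by exact: open_neq.
apply/measurable_funU.
- exact: open_measurable.
- exact: measurable_set1.
split; last exact: measurable_fun_set1.
apply: open_continuous_measurable_fun => // x; rewrite inE /= => x0.
exact: inv_continuous.
Qed.

Section MeasurableMatrix.
Context d (T : measurableType d) (R : realType).

Lemma measurable_funV (f : T -> R) : measurable_fun setT f ->
  measurable_fun setT (fun w => (f w)^-1).
Proof. by move=> mf; apply: measurableT_comp mf; exact: measurable_inv. Qed.

Lemma measurable_det n (M : T -> 'M[R]_n) :
  (forall i j, measurable_fun setT (fun w => M w i j)) ->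
  measurable_fun setT (fun w => \det (M w)).
Proof.
move=> mM; rewrite /determinant; apply: measurable_sum => s.
apply: measurable_funM => //; apply: measurable_prod => i _; exact: mM.
Qed.

Lemma measurable_mulmx m n p (M : T -> 'M[R]_(m, n)) (M' : T -> 'M[R]_(n, p)) :
  (forall i j, measurable_fun setT (fun w => M w i j)) ->
  (forall i j, measurable_fun setT (fun w => M' w i j)) ->
  forall i j, measurable_fun setT (fun w => (M w *m M' w) i j).
Proof.
move=> mM mM' i j; under eq_fun do rewrite mxE.
by apply: measurable_sum => l; exact: measurable_funM.
Qed.

Section resolvent.
Variables (n : nat) (eta : R) (M : T -> 'M[R]_n).
Hypothesis eta_ge1 : 1 <= eta.
Hypothesis Ms : forall w, (M w)^T = M w.
Hypothesis mM : forall i j, measurable_fun setT (fun w => M w i j).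

(** By the cofactor formula the entries of the inverse are quotients of polynomials in the entries
    of [M]. The measurable space is arbitrary: the statement serves for the full sigma-algebra and
    for the one generated by the other entries. *)
Lemma measurable_resK i j : measurable_fun setT (fun w => resK eta (M w) i j).
Proof.
have mS p q : measurable_fun setT (fun w => (M w *m M w + (eta ^+ 2)%:M) p q).
  under eq_fun do rewrite mxE.
  apply: measurable_funD; first exact: measurable_mulmx.
  by under eq_fun do rewrite mxE; exact: measurable_cst.
rewrite /resK /invmx.
under eq_fun do rewrite (res_unit eta_ge1 (Ms _)) mxE.
apply: measurable_funM; first by apply: measurable_funV; exact: measurable_det.
under eq_fun do rewrite mxE /cofactor.
apply: measurable_funM => //; apply: measurable_det => p q.
rewrite [X in measurable_fun _ X](_ : _ =
  fun w => (M w *m M w + (eta ^+ 2)%:M) (lift j p) (lift i q)) //.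
by apply/funext => w; rewrite [LHS]mxE [LHS]mxE.
Qed.

Lemma measurable_resA i j : measurable_fun setT (fun w => resA eta (M w) i j).
Proof. by apply: measurable_mulmx => // p q; exact: measurable_resK. Qed.

Lemma measurable_resB i j : measurable_fun setT (fun w => resB eta (M w) i j).
Proof.
by under eq_fun do rewrite mxE; apply: measurable_funM => //; exact: measurable_resK.
Qed.
End resolvent.
End MeasurableMatrix.

(** * Moment estimates *)

(** With t = c / e the claim is t y^3 <= y^4 + t^4, clear from comparing t and y. It trades an error
    of size [s] against a cube for a small multiple of the fourth power plus a term in [s ^+ 4], the
    order 1/N^2 that is aimed at. *)
Lemma absorb_cube (R : realFieldType) (c e y : R) : 0 <= y -> 0 <= c -> 0 < e ->
  c * y ^+ 3 <= e * y ^+ 4 + c ^+ 4 / e ^+ 3.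
Proof.
move=> y0 c00 e0.
have -> : c ^+ 4 / e ^+ 3 = e * (c / e) ^+ 4.
  by field; rewrite gt_eqF.
have -> : c * y ^+ 3 = e * ((c / e) * y ^+ 3) by field; rewrite gt_eqF.
rewrite -mulrDr ler_wpM2l ?(ltW e0) //.
have t0 : 0 <= c / e by rewrite divr_ge0 // ltW.
move: (c / e) t0 => t t0.
have [h|/ltW h] := leP t y.
  have : t * y ^+ 3 <= y * y ^+ 3 by rewrite ler_wpM2r ?exprn_ge0.
  rewrite -(exprS y 3) => hh. by apply: (le_trans hh); rewrite lerDl exprn_ge0.
have : y ^+ 3 <= t ^+ 3 by rewrite lerXn2r ?nnegrE.
move=> /(ler_wpM2l t0); rewrite -(exprS t 3) => h'; apply: le_trans h' _.
by rewrite lerDr exprn_ge0.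
Qed.

Section Expectation.
Context {d} {T : measurableType d} {R : realType}.
Variable P : probability T R.
Implicit Types f g : T -> R.

Definition integrableR f := P.-integrable setT (EFin \o f).
Definition Ex f : R := Rintegral P setT f.

Lemma integrableR_measurable f : integrableR f -> measurable_fun setT f.
Proof. by move/measurable_int/measurable_EFinP. Qed.

Lemma le_integrableR f g : measurable_fun setT f -> (forall w, `|f w| <= `|g w|) ->
  integrableR g -> integrableR f.
Proof.
move=> mf fg; apply: le_integrable => //; first exact/measurable_EFinP.
by move=> w _; rewrite /= lee_fin.
Qed.

Lemma integrableR_cst c : integrableR (fun=> c).
Proof.
apply/integrableP; split; first by apply/measurable_EFinP.
by rewrite /= integral_cst //= probability_setT mule1 ltry.
Qed.

Lemma integrableRD f g : integrableR f -> integrableR g -> integrableR (fun w => f w + g w).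
Proof. by move=> hf hg; have := integrableD measurableT hf hg. Qed.

Lemma integrableRB f g : integrableR f -> integrableR g -> integrableR (fun w => f w - g w).
Proof. by move=> hf hg; have := integrableB measurableT hf hg. Qed.

Lemma integrableRZ c f : integrableR f -> integrableR (fun w => c * f w).
Proof. by move=> hf; have := integrableZl measurableT c hf. Qed.

Lemma integrableR_sum (I : Type) (r : seq I) (Q : pred I) (f : I -> T -> R) :
  (forall i, Q i -> integrableR (f i)) -> integrableR (fun w => \sum_(i <- r | Q i) f i w).
Proof.
move=> hf; elim: r => [|i r IH].
  by under eq_fun do rewrite big_nil; exact: integrableR_cst.
under eq_fun do rewrite big_cons; case: (boolP (Q i)) => // Qi; apply: integrableRD => //.
exact: hf.
Qed.

Lemma integrableR_mulbounded f g M : integrableR f -> measurable_fun setT g ->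
  (forall w, `|g w| <= M) -> integrableR (fun w => f w * g w).
Proof.
move=> hf mg gM; apply: (@le_integrableR _ (fun w => M * f w)).
- by apply: measurable_funM => //; exact: integrableR_measurable.
- move=> w; rewrite !normrM mulrC ler_wpM2r //.
  by apply: le_trans (gM w) _; rewrite ler_norm.
- exact: integrableRZ.
Qed.

Lemma integrableR_bounded g M : measurable_fun setT g ->
  (forall w, `|g w| <= M) -> integrableR g.
Proof.
move=> mg gM; have := integrableR_mulbounded (integrableR_cst 1) mg gM.
by under eq_fun do rewrite mul1r.
Qed.

Lemma ExD f g : integrableR f -> integrableR g -> Ex (fun w => f w + g w) = Ex f + Ex g.
Proof. exact: RintegralD. Qed.

Lemma ExB f g : integrableR f -> integrableR g -> Ex (fun w => f w - g w) = Ex f - Ex g.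
Proof. exact: RintegralB. Qed.

Lemma ExZ c f : integrableR f -> Ex (fun w => c * f w) = c * Ex f.
Proof. by move=> hf; exact: RintegralZl. Qed.

Lemma Ex_cst c : Ex (fun=> c) = c.
Proof. by rewrite /Ex /Rintegral integral_cst //= probability_setT mule1. Qed.

Lemma le_Ex f g : integrableR f -> integrableR g -> (forall w, f w <= g w) -> Ex f <= Ex g.
Proof. by move=> hf hg fg; exact: le_Rintegral. Qed.

Lemma Ex_ge0 f : (forall w, 0 <= f w) -> 0 <= Ex f.
Proof. by move=> f0; exact: Rintegral_ge0. Qed.

Lemma Ex_sum (I : Type) (r : seq I) (Q : pred I) (f : I -> T -> R) :
  (forall i, Q i -> integrableR (f i)) ->
  Ex (fun w => \sum_(i <- r | Q i) f i w) = \sum_(i <- r | Q i) Ex (f i).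
Proof.
move=> hf; elim: r => [|i r IH].
  by under [in LHS]eq_fun do rewrite big_nil; rewrite big_nil Ex_cst.
under [in LHS]eq_fun do rewrite big_cons; rewrite big_cons.
case: (boolP (Q i)) => // Qi; rewrite ExD ?IH //; first exact: hf.
exact: integrableR_sum.
Qed.

Lemma norm_Ex f g : integrableR f -> integrableR g -> (forall w, `|f w| <= g w) ->
  `|Ex f| <= Ex g.
Proof.
move=> hf hg fg; have mf := integrableR_measurable hf.
apply: le_trans (le_normr_Rintegral measurableT hf) _.
apply: le_Ex => //; apply: le_integrableR hf => [|w]; last by rewrite normr_id.
exact: measurableT_comp.
Qed.

Lemma measurable_fun_sub_sigma (G : set (set T)) (Y : T -> R) : G `<=` measurable ->
  measurable_fun setT (Y : g_sigma_algebraType G -> R) -> measurable_fun setT Y.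
Proof.
move=> Gm mY _ B mB; have := mY measurableT B mB.
exact: (smallest_sub (@sigma_algebra_measurable _ T) Gm).
Qed.

Lemma Ex_indep (x Y : T -> R) (g : R -> R) : measurable_fun setT x ->
  measurable_fun setT g -> independent_rv P x Y ->
  integrableR (fun w => g (x w)) -> integrableR Y ->
  Ex (fun w => g (x w) * Y w) = Ex (fun w => g (x w)) * Ex Y.
Proof.
move=> mx mg ind ig iY.
have mY := integrableR_measurable iY.
have mgx : measurable_fun setT (fun w => g (x w)) by exact: measurableT_comp.
pose X' : {mfun T >-> R} := mfun_Sub (mem_set mgx).
pose Y' : {mfun T >-> R} := mfun_Sub (mem_set mY).
have ind' : independent_rv P X' Y'.
  move=> A B mA mB; apply: (ind (g @^-1` A) B) => //.
  by rewrite -[X in measurable X]setTI; exact: mg.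
have := independent_rv_integralM ind' ig iY.
rewrite /Ex /Rintegral => ->; rewrite fineM //.
- exact: (integrable_fin_num measurableT ig).
- exact: (integrable_fin_num measurableT iY).
Qed.

(* [x] is the entry, independent of the sigma-algebra generated by [G], to which [D0], [Y1], [Y2]
   belong; [D0] is the value taken by [D] when the entry is replaced by 0. *)
Section EntryEstimate.
Variables (G : set (set T)) (x z D D0 Y1 Y2 : T -> R) (s kap c2 c3 c4 m4 : R).
Hypothesis Gm : G `<=` measurable.
Hypothesis mx : measurable_fun setT x.
Hypothesis mz : measurable_fun setT z.
Hypothesis mD : measurable_fun setT D.
Hypothesis mD0 : measurable_fun setT (D0 : g_sigma_algebraType G -> R).
Hypothesis mY1 : measurable_fun setT (Y1 : g_sigma_algebraType G -> R).
Hypothesis mY2 : measurable_fun setT (Y2 : g_sigma_algebraType G -> R).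
Hypothesis ind : forall Y : T -> R,
  measurable_fun setT (Y : g_sigma_algebraType G -> R) -> independent_rv P x Y.
Hypothesis s01 : 0 <= s <= 1.
Hypothesis kap0 : 0 < kap.
Hypothesis ix : forall n, integrableR (fun w => `|x w| ^+ n).
Hypothesis Ex0 : Ex x = 0.
Hypothesis Ex2 : Ex (fun w => x w ^+ 2) = 1.
Hypothesis Ec2 : Ex (fun w => (`|x w| + 4) * (18 * `|x w|)) <= c2.
Hypothesis Ec3 : Ex (fun w => 16 * `|x w| ^+ 3 + 32 * `|x w|) <= c3.
Hypothesis Ec4 : Ex (fun w => (`|x w| + 4) * (160 * `|x w| ^+ 3)) <= c4.
Hypothesis Em4 : Ex (fun w => `|x w| ^+ 4) <= m4.
Hypothesis z_expand : forall w,
  `|z w - (x w * Y1 w - (x w ^+ 2 - 1) * (s * Y2 w))| <= s ^+ 2 * (16 * `|x w| ^+ 3 + 32 * `|x w|).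
Hypothesis z_le : forall w, `|z w| <= `|x w| + 4.
Hypothesis D_diff : forall w, `|D w - D0 w| <= 4 * s ^+ 3 * `|x w|.
Hypothesis Y1_le : forall w, `|Y1 w| <= 1.
Hypothesis Y2_le : forall w, `|Y2 w| <= 4.
Hypothesis D_le : forall w, `|D w| <= 2.
Hypothesis D0_le : forall w, `|D0 w| <= 2.

Let s0 : 0 <= s. Proof. by case/andP: s01. Qed.
Let s1 : s <= 1. Proof. by case/andP: s01. Qed.

Let bpow f M n : (forall w, `|f w| <= M) -> forall w, `|f w ^+ n| <= M ^+ n.
Proof. by move=> h w; rewrite normrX lerXn2r // nnegrE (le_trans _ (h w)). Qed.

Let bmul f g M N : (forall w, `|f w| <= M) -> (forall w, `|g w| <= N) ->
  forall w, `|f w * g w| <= M * N.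
Proof. by move=> h1 h2 w; rewrite normrM ler_pM. Qed.

Let ix1 : integrableR (fun w => `|x w|).
Proof. by have := ix 1; under eq_fun do rewrite expr1. Qed.

Let ixx : integrableR x.
Proof. by apply: le_integrableR ix1 => // w; rewrite normr_id. Qed.

Let ix2 : integrableR (fun w => x w ^+ 2).
Proof.
apply: le_integrableR (ix 2) => [|w]; first exact: measurable_funX.
by rewrite !normrX normr_id.
Qed.

Lemma Ex_indep_G (g : R -> R) (Y : T -> R) M : measurable_fun setT g ->
  integrableR (fun w => g (x w)) ->
  measurable_fun setT (Y : g_sigma_algebraType G -> R) -> (forall w, `|Y w| <= M) ->
  Ex (fun w => g (x w) * Y w) = Ex (fun w => g (x w)) * Ex Y.
Proof.
move=> mg ig mY YM; apply: Ex_indep => //; first exact: ind.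
by apply: integrableR_bounded YM; exact: measurable_fun_sub_sigma mY.
Qed.

Let mD0' : measurable_fun setT D0. Proof. exact: measurable_fun_sub_sigma mD0. Qed.
Let mY1' : measurable_fun setT Y1. Proof. exact: measurable_fun_sub_sigma mY1. Qed.
Let mY2' : measurable_fun setT Y2. Proof. exact: measurable_fun_sub_sigma mY2. Qed.

(** In a^3 - b^3 = y (3 b^2 + 3 b y + y^2) with y = a - b, the middle term is at most 3/2 (b^2 +
    y^2). For t = 4 s^3 |x| the coefficients 9/2 and 5/2 become the 18 and 160 of [h2] and [h4]. *)
Lemma cube_diff (a b t : R) : `|a - b| <= t ->
  `|a ^+ 3 - b ^+ 3| <= t * (9 / 2 * b ^+ 2 + 5 / 2 * t ^+ 2).
Proof.
move=> h; have t0 : 0 <= t by exact: le_trans h.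
have -> : a ^+ 3 - b ^+ 3 = (a - b) * (3 * b ^+ 2 + 3 * b * (a - b) + (a - b) ^+ 2) by ring.
rewrite normrM ler_pM //; set y := a - b in h *.
have y2 : y ^+ 2 <= t ^+ 2 by rewrite -real_normK ?num_real // lerXn2r ?nnegrE.
have -> : 3 * b ^+ 2 + 3 * b * y + y ^+ 2 = 3 * (b + y / 2) ^+ 2 + y ^+ 2 / 4 by field.
rewrite ger0_norm; last first.
  by apply: addr_ge0; [apply: mulr_ge0 => //|apply: divr_ge0 => //]; exact: sqr_ge0.
have := sqr_ge0 (b - y); lra.
Qed.

Let h3 w := 16 * `|x w| ^+ 3 + 32 * `|x w|.
Let h2 w := (`|x w| + 4) * (18 * `|x w|).
Let h4 w := (`|x w| + 4) * (160 * `|x w| ^+ 3).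

Let ih3 : integrableR h3.
Proof. by apply: integrableRD; apply: integrableRZ. Qed.

Let ih2 : integrableR h2.
Proof.
have -> : h2 = fun w => 18 * `|x w| ^+ 2 + 72 * `|x w|.
  by apply/funext => w; rewrite /h2; ring.
by apply: integrableRD; apply: integrableRZ.
Qed.

Let ih4 : integrableR h4.
Proof.
have -> : h4 = fun w => 160 * `|x w| ^+ 4 + 640 * `|x w| ^+ 3.
  by apply/funext => w; rewrite /h4; ring.
by apply: integrableRD; apply: integrableRZ.
Qed.

Let mnorm f : measurable_fun setT f -> measurable_fun setT (fun w => `|f w|).
Proof. by move=> mf; exact: measurableT_comp. Qed.

Let mnormG f : measurable_fun setT (f : g_sigma_algebraType G -> R) ->
  measurable_fun setT ((fun w => `|f w|) : g_sigma_algebraType G -> R).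
Proof. by move=> mf; exact: measurableT_comp. Qed.

Let Ef1 : Ex (fun w => x w * (Y1 w * D0 w ^+ 3)) = 0.
Proof.
rewrite (@Ex_indep_G id _ (1 * 2 ^+ 3)) ?Ex0 ?mul0r //.
  by apply: measurable_funM => //; exact: measurable_funX.
by apply: bmul => //; exact: bpow.
Qed.

Let Ef2 : Ex (fun w => (x w ^+ 2 - 1) * ((s * Y2 w) * D0 w ^+ 3)) = 0.
Proof.
rewrite (@Ex_indep_G (fun y => y ^+ 2 - 1) _ ((1 * 4) * 2 ^+ 3)) //.
- rewrite (@ExB (fun w => x w ^+ 2) (fun=> 1)) ?Ex2 ?Ex_cst ?subrr ?mul0r //.
  exact: integrableR_cst.
- by apply: measurable_funB => //; exact: measurable_funX.
- by apply: integrableRB => //; exact: integrableR_cst.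
- by apply: measurable_funM; [apply: measurable_funM|apply: measurable_funX].
- apply: bmul; last exact: bpow.
  by apply: (bmul (f := fun=> s)) => // w; rewrite ger0_norm.
Qed.

(** The first term bounds the remainder of the expansion of [z], the other two the effect of
    replacing [D ^+ 3] by [D0 ^+ 3]. Everything is expressed through [D0] and not [D], so that the
    factors [h3] and [h2], functions of the entry, are independent of what they multiply. *)
Let bnd w := s ^+ 2 * (h3 w * `|D0 w| ^+ 3) + s ^+ 3 * (h2 w * D0 w ^+ 2) + s ^+ 9 * h4 w.

Let ind3 : Ex (fun w => h3 w * `|D0 w| ^+ 3) = Ex h3 * Ex (fun w => `|D0 w| ^+ 3).
Proof.
apply: (@Ex_indep_G (fun y => 16 * `|y| ^+ 3 + 32 * `|y|) _ (2 ^+ 3)) => //.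
- have mn : measurable_fun setT (fun y : R => `|y|) by exact: normr_measurable.
  by apply: measurable_funD; apply: measurable_funM => //; exact: measurable_funX.
- by apply: measurable_funX; exact: mnormG.
- by apply: bpow => w; rewrite normr_id.
Qed.

Let ind2 : Ex (fun w => h2 w * D0 w ^+ 2) = Ex h2 * Ex (fun w => D0 w ^+ 2).
Proof.
apply: (@Ex_indep_G (fun y => (`|y| + 4) * (18 * `|y|)) _ (2 ^+ 2)) => //.
- have mn : measurable_fun setT (fun y : R => `|y|) by exact: normr_measurable.
  by apply: measurable_funM; [apply: measurable_funD|apply: measurable_funM].
- exact: measurable_funX.
- exact: bpow.
Qed.

Let iD0 n : integrableR (fun w => `|D0 w| ^+ n).
Proof.
apply: (@integrableR_bounded _ (2 ^+ n)); first by apply: measurable_funX; exact: mnorm.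
by apply: bpow => w; rewrite normr_id.
Qed.

Let iD0' n : integrableR (fun w => D0 w ^+ n).
Proof.
apply: (@integrableR_bounded _ (2 ^+ n)); first by apply: measurable_funX.
exact: bpow.
Qed.

Let iD4 : integrableR (fun w => D w ^+ 4).
Proof.
apply: (@integrableR_bounded _ (2 ^+ 4)); first by apply: measurable_funX.
exact: bpow.
Qed.

Let ib3 : integrableR (fun w => h3 w * `|D0 w| ^+ 3).
Proof.
apply: (@integrableR_mulbounded _ _ (2 ^+ 3)) => //.
  by apply: measurable_funX; exact: mnorm.
by apply: bpow => w; rewrite normr_id.
Qed.

Let ib2 : integrableR (fun w => h2 w * D0 w ^+ 2).
Proof.
apply: (@integrableR_mulbounded _ _ (2 ^+ 2)) => //; first exact: measurable_funX.
exact: bpow.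
Qed.

Let ibnd : integrableR bnd.
Proof.
by apply: integrableRD; [apply: integrableRD|]; apply: integrableRZ.
Qed.

Let iz : integrableR z.
Proof.
apply: (@le_integrableR _ (fun w => `|x w| + 4)) => //.
  by move=> w; apply: le_trans (z_le w) _; exact: ler_norm.
by apply: integrableRD => //; exact: integrableR_cst.
Qed.

Lemma integrable_zD3 : integrableR (fun w => z w * D w ^+ 3).
Proof.
apply: (@integrableR_mulbounded _ _ (2 ^+ 3)) => //; first exact: measurable_funX.
exact: bpow.
Qed.

Let Ebnd : `|Ex (fun w => z w * D w ^+ 3)| <= Ex bnd.
Proof.
pose f1 w := x w * (Y1 w * D0 w ^+ 3).
pose f2 w := (x w ^+ 2 - 1) * ((s * Y2 w) * D0 w ^+ 3).
have if1 : integrableR f1.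
  apply: (@integrableR_mulbounded _ _ (1 * 2 ^+ 3)) => //.
    by apply: measurable_funM => //; exact: measurable_funX.
  by apply: bmul => //; exact: bpow.
have if2 : integrableR f2.
  apply: (@integrableR_mulbounded _ _ ((1 * 4) * 2 ^+ 3)) => //.
  - by apply: integrableRB => //; exact: integrableR_cst.
  - by apply: measurable_funM; [apply: measurable_funM|apply: measurable_funX].
  - apply: bmul; last exact: bpow.
    by apply: (bmul (f := fun=> s)) => // w; rewrite ger0_norm.
have -> : Ex (fun w => z w * D w ^+ 3) = Ex (fun w => z w * D w ^+ 3 - (f1 w - f2 w)).
  rewrite ExB //; last exact: integrableRB; last exact: integrable_zD3.
  by rewrite ExB // Ef1 Ef2 !subr0.
apply: norm_Ex => //.
  by apply: integrableRB; [exact: integrable_zD3|exact: integrableRB].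
move=> w.
have -> : z w * D w ^+ 3 - (f1 w - f2 w) =
  (z w - (x w * Y1 w - (x w ^+ 2 - 1) * (s * Y2 w))) * D0 w ^+ 3 +
  z w * (D w ^+ 3 - D0 w ^+ 3) by rewrite /f1 /f2; ring.
apply: le_trans (ler_normD _ _) _; rewrite /bnd -addrA; apply: lerD.
  rewrite normrM [X in _ * X]normrX [leRHS]mulrA; apply: ler_wpM2r; last exact: z_expand.
  exact: exprn_ge0.
rewrite normrM.
apply: le_trans (ler_pM (normr_ge0 _) (normr_ge0 _) (z_le w) (cube_diff (D_diff w))) _.
by rewrite le_eqVlt; apply/orP; left; apply/eqP; rewrite /h2 /h4; field.
Qed.

(* E[x Y1 D0^3] = E[(x^2 - 1) Y2 D0^3] = 0 by independence, so only the remainders in the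
   expansions of [z] and of [D - D0] contribute. *)
Lemma entry_estimate : `|Ex (fun w => z w * D w ^+ 3)| <=
  s * (16 * kap * Ex (fun w => D w ^+ 4) +
       (c3 ^+ 4 / kap ^+ 3 + c2 ^+ 2 / (4 * kap) + c4 + 4096 * kap * m4) * s ^+ 4).
Proof.
apply: le_trans Ebnd _.
have h30 : 0 <= Ex h3.
  by apply: Ex_ge0 => w; rewrite addr_ge0 // mulr_ge0 // exprn_ge0.
have h20 : 0 <= Ex h2.
  by apply: Ex_ge0 => w; rewrite mulr_ge0 // ?addr_ge0 // mulr_ge0.
have c30 : 0 <= c3 by exact: le_trans Ec3.
have c20 : 0 <= c2 by exact: le_trans Ec2.
have -> : Ex bnd = s ^+ 2 * (Ex h3 * Ex (fun w => `|D0 w| ^+ 3)) +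
   s ^+ 3 * (Ex h2 * Ex (fun w => D0 w ^+ 2)) + s ^+ 9 * Ex h4.
  rewrite /bnd ExD; last 2 first.
  - by apply: integrableRD; apply: integrableRZ.
  - exact: integrableRZ.
  by rewrite ExD ?ExZ ?ind3 ?ind2 //; exact: integrableRZ.
apply: (@le_trans _ _ (s ^+ 2 * (c3 * Ex (fun w => `|D0 w| ^+ 3)) +
   s ^+ 3 * (c2 * Ex (fun w => D0 w ^+ 2)) + s ^+ 9 * c4)).
  by apply: lerD; [apply: lerD|]; rewrite ler_wpM2l ?exprn_ge0 // ?ler_wpM2r //;
    apply: Ex_ge0 => w; rewrite ?sqr_ge0 ?exprn_ge0.
pose E4 := Ex (fun w => D0 w ^+ 4).
have k1 : s * (c3 * Ex (fun w => `|D0 w| ^+ 3)) <= kap * E4 + (c3 * s) ^+ 4 / kap ^+ 3.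
  have -> : s * (c3 * Ex (fun w => `|D0 w| ^+ 3)) = Ex (fun w => c3 * s * `|D0 w| ^+ 3).
    by rewrite ExZ // mulrA (mulrC s).
  have -> : kap * E4 + (c3 * s) ^+ 4 / kap ^+ 3 =
     Ex (fun w => kap * D0 w ^+ 4 + (c3 * s) ^+ 4 / kap ^+ 3).
    by rewrite ExD ?ExZ ?Ex_cst //; first [exact: integrableRZ|exact: integrableR_cst].
  apply: le_Ex; first exact: integrableRZ.
    by apply: integrableRD; [exact: integrableRZ|exact: integrableR_cst].
  move=> w; have -> : D0 w ^+ 4 = `|D0 w| ^+ 4.
    by rewrite -normrX ger0_norm // exprn_even_ge0.
  by apply: absorb_cube => //; rewrite mulr_ge0.
have k2 : s ^+ 2 * (c2 * Ex (fun w => D0 w ^+ 2)) <= kap * E4 + (c2 * s ^+ 2) ^+ 2 / (4 * kap).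
  have -> : s ^+ 2 * (c2 * Ex (fun w => D0 w ^+ 2)) = Ex (fun w => c2 * s ^+ 2 * D0 w ^+ 2).
    by rewrite ExZ // mulrA (mulrC (s ^+ 2)).
  have -> : kap * E4 + (c2 * s ^+ 2) ^+ 2 / (4 * kap) =
     Ex (fun w => kap * D0 w ^+ 4 + (c2 * s ^+ 2) ^+ 2 / (4 * kap)).
    by rewrite ExD ?ExZ ?Ex_cst //; first [exact: integrableRZ|exact: integrableR_cst].
  apply: le_Ex; first exact: integrableRZ.
    by apply: integrableRD; [exact: integrableRZ|exact: integrableR_cst].
  move=> w; rewrite -subr_ge0.
  have -> : kap * D0 w ^+ 4 + (c2 * s ^+ 2) ^+ 2 / (4 * kap) - c2 * s ^+ 2 * D0 w ^+ 2 =
     (2 * kap * D0 w ^+ 2 - c2 * s ^+ 2) ^+ 2 / (4 * kap) by field; rewrite gt_eqF.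
  by rewrite divr_ge0 ?sqr_ge0 // mulr_ge0 // ltW.
(* Return from [D0] to [D] by b^4 <= 8 a^4 + 8 (a - b)^4, with 8 * 4^4 = 2048. Since [k1] and [k2]
   each spend [kap * E4], the final constants are 16 kap and 4096 kap. *)
have k3 : E4 <= 8 * Ex (fun w => D w ^+ 4) + 2048 * s ^+ 12 * m4.
  apply: (@le_trans _ _ (Ex (fun w => 8 * D w ^+ 4 + 2048 * s ^+ 12 * `|x w| ^+ 4))).
    apply: le_Ex => //; first by apply: integrableRD; exact: integrableRZ.
    move=> w; have := D_diff w; set t := 4 * s ^+ 3 * _ => ht.
    have t0 : 0 <= t by exact: le_trans ht.
    have -> : 2048 * s ^+ 12 * `|x w| ^+ 4 = 8 * t ^+ 4 by rewrite /t; ring.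
    have : (D w - D0 w) ^+ 4 <= t ^+ 4.
      have -> : (D w - D0 w) ^+ 4 = `|D w - D0 w| ^+ 4.
        by rewrite -normrX ger0_norm // exprn_even_ge0.
      by rewrite lerXn2r ?nnegrE.
    move: (D w) (D0 w) => a b hab.
    have e1 : (a - b) ^+ 4 * 8 + a ^+ 4 * 8 - b ^+ 4 =
       (2 * a - b) ^+ 2 * ((2*a - b) ^+ 2 + 6 * b ^+2) by ring.
    have : 0 <= (2 * a - b) ^+ 2 * ((2*a - b) ^+ 2 + 6 * b ^+2).
      by rewrite mulr_ge0 ?sqr_ge0 // addr_ge0 ?sqr_ge0 // mulr_ge0 ?sqr_ge0.
    rewrite -e1; lra.
  rewrite ExD ?ExZ //; try exact: integrableRZ.
  rewrite lerD2l; apply: ler_wpM2l Em4; apply: mulr_ge0; first exact: ler0n.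
  exact: exprn_ge0.
have m40 : 0 <= m4 by apply: le_trans Em4; apply: Ex_ge0 => w; rewrite exprn_ge0.
have c40 : 0 <= c4.
  by apply: le_trans Ec4; apply: Ex_ge0 => w; rewrite mulr_ge0 // ?addr_ge0 // mulr_ge0 // exprn_ge0.
have k4 : s ^+ 8 * c4 <= s ^+ 4 * c4.
  rewrite ler_wpM2r // (_ : 8%N = (4 + 4)%N) // exprD ler_piMr ?exprn_ge0 //.
  by rewrite exprn_ile1.
have k5 : s ^+ 12 * m4 <= s ^+ 4 * m4.
  rewrite ler_wpM2r // (_ : 12%N = (4 + 8)%N) // exprD ler_piMr ?exprn_ge0 //.
  by rewrite exprn_ile1.
(* One factor [s] is kept outside: together with the [s ^+ 3] in front of a sum over at most n^2
   entries it makes s^4 n^2 = 1. *)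
have -> : s ^+ 2 * (c3 * Ex (fun w => `|D0 w| ^+ 3)) +
   s ^+ 3 * (c2 * Ex (fun w => D0 w ^+ 2)) + s ^+ 9 * c4 =
  s * (s * (c3 * Ex (fun w => `|D0 w| ^+ 3)) + s ^+ 2 * (c2 * Ex (fun w => D0 w ^+ 2)) + s ^+ 8 * c4).
  by ring.
rewrite ler_wpM2l //.
have k6 : kap * E4 <= kap * (8 * Ex (fun w => D w ^+ 4) + 2048 * (s ^+ 4 * m4)).
  rewrite ler_wpM2l ?(ltW kap0) //; apply: le_trans k3 _; rewrite lerD2l -mulrA; apply: ler_wpM2l k5; exact: ler0n.
have -> : (c3 ^+ 4 / kap ^+ 3 + c2 ^+ 2 / (4 * kap) + c4 + 4096 * kap * m4) * s ^+ 4 =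
  (c3 * s) ^+ 4 / kap ^+ 3 + (c2 * s ^+ 2) ^+ 2 / (4 * kap) + s ^+ 4 * c4 +
  2 * (kap * (2048 * (s ^+ 4 * m4))).
  by field; rewrite gt_eqF.
lra.
Qed.

End EntryEstimate.
End Expectation.

(** * Summation over the entries of a class *)

Section Aggregate.
Context {d} {T : measurableType d} {R : realType}.
Variable P : probability T R.
Local Notation Ex := (Ex P).
Local Notation integrableR := (integrableR P).
Variables (n : nat) (u : pred 'I_n) (z : 'I_n -> 'I_n -> T -> R) (F D : T -> R).
Variables (s sg kap C Wm : R).
Hypothesis s_norm : s ^+ 2 * n%:R = 1.
Hypothesis s01 : 0 <= s <= 1.
Hypothesis sg1 : `|sg| = 1.
Hypothesis kap0 : 0 < kap.
Hypothesis C0 : 0 <= C.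
Hypothesis Wm0 : 0 <= Wm.
Hypothesis mF : measurable_fun setT F.
Hypothesis mD : measurable_fun setT D.
Hypothesis D_le : forall w, `|D w| <= 2.
Hypothesis iz : forall i j, u i -> ~~ u j -> integrableR (fun w => z i j w * D w ^+ 3).
Hypothesis hz : forall i j, u i -> ~~ u j ->
  `|Ex (fun w => z i j w * D w ^+ 3)| <= s * (16 * kap * Ex (fun w => D w ^+ 4) + C * s ^+ 4).
Hypothesis hF : forall w,
  `|F w - sg * s ^+ 3 * \sum_(i | u i) \sum_(j | ~~ u j) z i j w| <= s * Wm.

Let bpow m w : `|D w ^+ m| <= 2 ^+ m.
Proof. by rewrite normrX lerXn2r // nnegrE. Qed.

Let iD4 : integrableR (fun w => D w ^+ 4).
Proof. by apply: integrableR_bounded (bpow 4); exact: measurable_funX. Qed.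

Let Z w := \sum_(i | u i) \sum_(j | ~~ u j) z i j w * D w ^+ 3.

Let iZ : integrableR Z.
Proof. by apply: integrableR_sum => i ui; apply: integrableR_sum => j uj; exact: iz. Qed.

Let ZE w : Z w = (\sum_(i | u i) \sum_(j | ~~ u j) z i j w) * D w ^+ 3.
Proof. by rewrite mulr_suml; apply: eq_bigr => i _; rewrite mulr_suml. Qed.

Let rest_le w : `|F w * D w ^+ 3 - sg * s ^+ 3 * Z w| <= kap * D w ^+ 4 + (s * Wm) ^+ 4 / kap ^+ 3.
Proof.
rewrite ZE mulrA -mulrBl normrM normrX.
apply: le_trans (_ : s * Wm * `|D w| ^+ 3 <= _); first by rewrite ler_wpM2r // exprn_ge0.
have -> : D w ^+ 4 = `|D w| ^+ 4 by rewrite -normrX ger0_norm // exprn_even_ge0.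
by apply: absorb_cube => //; rewrite mulr_ge0 //; case/andP: s01.
Qed.

Let irest0 : integrableR (fun w => kap * D w ^+ 4 + (s * Wm) ^+ 4 / kap ^+ 3).
Proof. by apply: integrableRD; [exact: integrableRZ|exact: integrableR_cst]. Qed.

Lemma integrable_FD3 : integrableR (fun w => F w * D w ^+ 3).
Proof.
have -> : (fun w => F w * D w ^+ 3) =
  fun w => (F w * D w ^+ 3 - sg * s ^+ 3 * Z w) + sg * s ^+ 3 * Z w.
  by apply/funext => w; rewrite subrK.
apply: integrableRD; last exact: integrableRZ.
apply: le_integrableR irest0.
  apply: measurable_funB; first by apply: measurable_funM => //; exact: measurable_funX.
  by apply: measurable_funM => //; exact: integrableR_measurable iZ.
by move=> w; apply: le_trans (rest_le w) _; exact: ler_norm.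
Qed.

(** Of the 17 kap, 16 come from the entry estimates, whose sum over at most n^2 pairs is compensated
    by [s ^+ 4], and 1 from absorbing the deterministic error [s * Wm]. The sign [sg] lets both
    self-consistent equations be treated together. *)
Lemma aggregate_estimate : Ex (fun w => F w * D w ^+ 3) <=
  17 * kap * Ex (fun w => D w ^+ 4) + (C + Wm ^+ 4 / kap ^+ 3) * s ^+ 4.
Proof.
have s0 : 0 <= s by case/andP: s01.
have E40 : 0 <= Ex (fun w => D w ^+ 4).
  by apply: Ex_ge0 => w; rewrite exprn_even_ge0.
apply: (@le_trans _ _ (Ex (fun w => sg * s ^+ 3 * Z w +
   (kap * D w ^+ 4 + (s * Wm) ^+ 4 / kap ^+ 3)))).
  apply: le_Ex; first exact: integrable_FD3.
    by apply: integrableRD => //; exact: integrableRZ.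
  by move=> w; rewrite -lerBlDl; apply: le_trans (rest_le w); exact: ler_norm.
rewrite ExD //; last exact: integrableRZ.
rewrite ExZ // ExD //; last 2 first.
- exact: integrableRZ.
- exact: integrableR_cst.
rewrite ExZ // Ex_cst.
pose e := 16 * kap * Ex (fun w => D w ^+ 4) + C * s ^+ 4.
have e0 : 0 <= e by rewrite addr_ge0 // mulr_ge0 ?exprn_ge0 // mulr_ge0 // ltW.
have hZ : `|Ex Z| <= n%:R * (n%:R * (s * e)).
  rewrite Ex_sum; last by move=> i ui; apply: integrableR_sum => j uj; exact: iz.
  apply: le_trans (ler_norm_sum _ _ _) _.
  apply: (@le_trans _ _ (\sum_(i < n) n%:R * (s * e))); last first.
    by rewrite sumr_const card_ord [leRHS]mulr_natl.
  rewrite big_mkcond; apply: ler_sum => i _; case: ifPn => ui; last first.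
    by rewrite mulr_ge0 // mulr_ge0.
  rewrite Ex_sum; last by move=> j uj; exact: iz.
  apply: le_trans (ler_norm_sum _ _ _) _.
  apply: (@le_trans _ _ (\sum_(j < n) s * e)); last first.
    by rewrite sumr_const card_ord mulr_natl.
  rewrite big_mkcond; apply: ler_sum => j _; case: ifPn => uj; last first.
    by rewrite mulr_ge0.
  exact: hz.
have {}hZ : sg * s ^+ 3 * Ex Z <= e.
  apply: le_trans (ler_norm _) _; rewrite [X in X <= _]normrM [`|sg * _|]normrM sg1 mul1r (ger0_norm (exprn_ge0 _ s0)).
  apply: le_trans (ler_wpM2l (exprn_ge0 _ s0) hZ) _.
  have -> : s ^+ 3 * (n%:R * (n%:R * (s * e))) = (s ^+ 2 * n%:R) * (s ^+ 2 * n%:R) * e by ring.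
  by rewrite s_norm !mul1r.
have -> : (C + Wm ^+ 4 / kap ^+ 3) * s ^+ 4 = C * s ^+ 4 + (s * Wm) ^+ 4 / kap ^+ 3.
  by field; rewrite gt_eqF.
rewrite /e in hZ; lra.
Qed.

End Aggregate.

(** * The checkerboard ensemble *)

Lemma eq_distribution_Ex {d} {T : measurableType d} {R : realType} (P : probability T R)
  (x y : T -> R) (g : R -> R) : measurable_fun setT x -> measurable_fun setT y ->
  (forall B, measurable B -> P (x @^-1` B) = P (y @^-1` B)) ->
  measurable_fun setT g -> (forall t, 0 <= g t) ->
  Ex P (fun w => g (x w)) = Ex P (fun w => g (y w)).
Proof.
move=> mx my xy mg g0; rewrite /Ex /Rintegral; congr fine.
pose X : {mfun T >-> R} := mfun_Sub (mem_set mx).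
pose Y : {mfun T >-> R} := mfun_Sub (mem_set my).
have mEg : measurable_fun setT (EFin \o g) by exact/measurable_EFinP.
have e (Z : {mfun T >-> R}) : (\int[P]_w (g (Z w))%:E = \int[distribution P Z]_t (EFin \o g) t)%E.
  by rewrite ge0_integral_distribution // => t; rewrite /= lee_fin.
rewrite (e X) (e Y); apply: eq_measure_integral => B mB _.
exact: xy.
Qed.

Section Checkerboard.
Context {R : realType} {d : measure_display} {T : measurableType d}.
Variables (P : probability T R) (k : nat) (W : seq R).
Variable a : nat -> nat -> nat -> T -> R.
Hypothesis k0 : (0 < k)%N.
Hypothesis ma : forall t, upper_idx t -> measurable_fun setT (a t.1.1 t.1.2 t.2).
Hypothesis inda : mutually_independent P upper_idx (fun t => a t.1.1 t.1.2 t.2).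
Hypothesis ida : identically_distributed P upper_idx (fun t => a t.1.1 t.1.2 t.2).
Hypothesis inta : forall t, upper_idx t -> forall n : nat,
     P.-integrable setT (fun w => (`|a t.1.1 t.1.2 t.2 w| ^+ n)%:E).
Hypothesis Ea : forall t, upper_idx t -> ('E_P[a t.1.1 t.1.2 t.2])%E = 0%E.
Hypothesis Va : forall t, upper_idx t -> variance P (a t.1.1 t.1.2 t.2) = 1%E.

Local Notation Ex := (Ex P).
Local Notation integrableR := (integrableR P).
Local Notation X := (fun t : nat * nat * nat => a t.1.1 t.1.2 t.2).

Lemma entry_mean t : upper_idx t -> Ex (X t) = 0.
Proof. by move=> ut; have := Ea ut; rewrite unlock /Ex /Rintegral => ->. Qed.

Lemma entry_var t : upper_idx t -> Ex (fun w => X t w ^+ 2) = 1.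
Proof.
move=> ut; have := Va ut; rewrite /variance covariance.unlock (Ea ut) /= => h.
have <- : fine (1%E : \bar R) = 1 by [].
rewrite -h expectation.unlock /Ex /Rintegral; congr fine; apply: eq_integral => w _.
by congr EFin; rewrite -[RHS]/((X t w - 0) * (X t w - 0)) subr0 expr2.
Qed.

Lemma entry_Ex_eq t t' (g : R -> R) : upper_idx t -> upper_idx t' ->
  measurable_fun setT g -> (forall y, 0 <= g y) ->
  Ex (fun w => g (X t w)) = Ex (fun w => g (X t' w)).
Proof.
move=> ut ut' mg g0; apply: eq_distribution_Ex => //; try exact: ma.
by move=> B mB; exact: ida.
Qed.

Section FixedN.
Variables (N : nat).
Hypothesis N0 : (0 < N)%N.

Definition cb_board w := checkerboard k W (fun i j => a N i j w) N.

Lemma checkerboard_sym (x : nat -> nat -> R) : (checkerboard k W x N)^T = checkerboard k W x N.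
Proof.
apply/matrixP => i j; rewrite !mxE eq_sym minnC maxnC.
by case: eqP => // ->.
Qed.

Lemma upper_entry (i j : 'I_N) : (i %% k != j %% k)%N -> upper_idx (N, minn i j, maxn i j).
Proof.
move=> ij; rewrite /upper_idx /=.
have : i != j :> nat by apply: contraNneq ij => ->.
rewrite neq_ltn /minn /maxn => /orP[h|h]; first by rewrite h ltn_ord andbT.
have -> : (i < j)%N = false by rewrite ltnNge ltnW.
by rewrite h ltn_ord.
Qed.

Definition other_entries (e : nat * nat * nat) : seq (nat * nat * nat) :=
  [seq t <- [seq (N, p, q) | p <- iota 0 N, q <- iota 0 N] | (t.1.2 < t.2)%N && (t != e)].

Lemma other_entriesP e t : t \in other_entries e ->
  [/\ t.1.1 = N, (t.1.2 < t.2)%N, (t.2 < N)%N & t != e].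
Proof.
rewrite mem_filter => /andP[/andP[h1 h2]] /allpairsP[[p q] /= [hp hq e1]].
by rewrite e1 /= in h1 h2 *; split => //; rewrite mem_iota in hq.
Qed.

Lemma mem_other_entries e p q : (p < q < N)%N -> (N, p, q) != e -> (N, p, q) \in other_entries e.
Proof.
move=> /andP[pq qN] ne; rewrite mem_filter /= pq ne /=.
by apply/allpairsP; exists (p, q) => /=; rewrite !mem_iota /= !add0n qN (ltn_trans pq qN).
Qed.

Lemma uniq_other_entries e : uniq (e :: other_entries e).
Proof.
rewrite /= mem_filter eqxx andbF /= filter_uniq // allpairs_uniq ?iota_uniq //.
by move=> [p q] [p' q'] _ _ /= [-> ->].
Qed.

Lemma other_entries_upper e t : t \in other_entries e -> upper_idx t.
Proof. by move=> /other_entriesP[tN h1 h2 _]; rewrite /upper_idx /= tN h1 h2. Qed.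

(** The entry is erased in the array from which the board is formed, so that the result is again a
    checkerboard and every bound valid for all checkerboards applies to it. *)
Definition cb_board0 (i j : 'I_N) w :=
  checkerboard k W (fun p q => if (p == minn i j) && (q == maxn i j) then 0 else a N p q w) N.

Lemma cb_board_split (i j : 'I_N) w : (i %% k != j %% k)%N ->
  cb_board w = cb_board0 i j w + a N (minn i j) (maxn i j) w *: (delta_mx i j + delta_mx j i).
Proof.
move=> ij; apply/matrixP => p q; rewrite !mxE.
have nij : i != j by apply: contraNneq ij => ->.
have [pq|pq] := eqVneq (p %% k)%N (q %% k)%N.
  have -> : (p == i) && (q == j) = false.
    by apply/negP => /andP[/eqP pi /eqP qj]; move: ij; rewrite -pi -qj pq eqxx.
  have -> : (p == j) && (q == i) = false.
    by apply/negP => /andP[/eqP pi /eqP qj]; move: ij; rewrite -pi -qj pq eqxx.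
  by rewrite addr0 mulr0 addr0.
have [/andP[/eqP e1 /eqP e2]|ne] := boolP ((minn p q == minn i j) && (maxn p q == maxn i j)).
  rewrite e1 e2 add0r.
  have : ((p == i) && (q == j)) || ((p == j) && (q == i)).
    rewrite -!val_eqE /=; move: e1 e2; rewrite /minn /maxn.
    case: ifP => _; case: ifP => _ -> ->; rewrite ?eqxx ?orbT //.
  have [/andP[/eqP-> /eqP->]|_ /= /andP[/eqP-> /eqP->]] := boolP ((p == i) && (q == j)).
    by rewrite ?eqxx (negbTE nij) /= addr0 mulr1.
  by rewrite ?eqxx /= add0r mulr1.
have -> : (p == i) && (q == j) = false.
  by apply/negP => /andP[/eqP pi /eqP qj]; move: ne; rewrite pi qj !eqxx.
have -> : (p == j) && (q == i) = false.
  by apply/negP => /andP[/eqP pi /eqP qj]; move: ne; rewrite pi qj minnC maxnC !eqxx.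
by rewrite addr0 mulr0 addr0.
Qed.

Lemma measurable_cb_board p q : measurable_fun setT (fun w => cb_board w p q).
Proof.
under eq_fun do rewrite mxE.
case: eqP => [_|/eqP pq]; first exact: measurable_cst. have h := ma (upper_entry pq). exact: h.
Qed.

Lemma measurable_cb_board0 (i j : 'I_N) p q : measurable_fun setT
  ((fun w => cb_board0 i j w p q) :
    g_sigma_algebraType (cylinders X (other_entries (N, minn i j, maxn i j))) -> R).
Proof.
have -> : (fun w => cb_board0 i j w p q) = fun w =>
    if (p %% k == q %% k)%N then nth 0 W (p %% k) else
    if (minn p q == minn i j) && (maxn p q == maxn i j) then 0 else a N (minn p q) (maxn p q) w.
  by apply/funext => w; rewrite mxE.
case: eqP => [_|/eqP pq]; first exact: measurable_cst.
case: (boolP ((minn p q == _) && _)) => [_|ne]; first exact: measurable_cst.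
have := upper_entry pq; rewrite /upper_idx /= => u.
have h := @measurable_cylinders_coord  _ _ R _ X _ (N, minn p q, maxn p q).
apply: h; apply: mem_other_entries => //; apply: contraNN ne => /eqP[-> ->].
by rewrite !eqxx.
Qed.

Variables (eta c kap : R).
Hypothesis eta_large : 2 * k%:R + 1 <= eta.
Hypothesis c0 : 0 <= c.
Hypothesis cE : eta * c = k%:R^-1 - (k%:R - 1) * c ^+ 2.
Hypothesis kap0 : 0 < kap.

Let eta_ge1 : 1 <= eta.
Proof. by apply: le_trans eta_large; rewrite lerDr mulr_ge0. Qed.

Let k1 : 1 <= k%:R :> R. Proof. by rewrite ler1n. Qed.

Let c1 : c <= 1.
Proof.
have h : eta * c <= 1.
  rewrite cE; apply: (@le_trans _ _ (k%:R^-1)).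
    by rewrite gerBl mulr_ge0 ?sqr_ge0 // subr_ge0.
  by rewrite invf_le1 // (lt_le_trans ltr01).
have : 1 * c <= eta * c by rewrite ler_wpM2r.
by rewrite mul1r => /le_trans; apply.
Qed.

Local Notation s := ((Num.sqrt N%:R)^-1 : R).

Let N1 : 1 <= N%:R :> R. Proof. by rewrite ler1n. Qed.

Let s01 : 0 <= s <= 1.
Proof.
rewrite invr_ge0 sqrtr_ge0 /= invf_le1 ?sqrtr_gt0 ?(lt_le_trans ltr01) //.
by rewrite -{1}sqrtr1 ler_sqrt // (lt_le_trans ltr01).
Qed.

Let s_norm : s ^+ 2 * N%:R = 1.
Proof. by rewrite exprVn sqr_sqrtr // mulVf // gt_eqF // (lt_le_trans ltr01). Qed.

Definition cb_class (u : 'I_k) : pred 'I_N := fun i => (i %% k == u)%N.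

Local Notation Hm M := (s *: M).

Definition cb_al (M : 'M[R]_N) u := ptr s (resA eta (Hm M)) (cb_class u).
Definition cb_be (M : 'M[R]_N) u := ptr s (resB eta (Hm M)) (cb_class u).

Let scale_sym (x : nat -> nat -> R) : (Hm (checkerboard k W x N))^T = Hm (checkerboard k W x N).
Proof. by rewrite linearZ /= checkerboard_sym. Qed.

Lemma measurable_scale d' (T' : measurableType d') (M : T' -> 'M[R]_N) (t : R) :
  (forall i j, measurable_fun setT (fun w => M w i j)) ->
  forall i j, measurable_fun setT (fun w => (t *: M w) i j).
Proof.
by move=> mM i j; under eq_fun do rewrite mxE; exact: measurable_funM.
Qed.

Lemma measurable_ptr d' (T' : measurableType d') (M : T' -> 'M[R]_N) (t : R) v :
  (forall i j, measurable_fun setT (fun w => M w i j)) ->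
  measurable_fun setT (fun w => ptr t (M w) v).
Proof.
move=> mM; apply: measurable_funM => //; under eq_fun do rewrite big_mkcond.
by apply: measurable_sum => i; case: (v i).
Qed.

Lemma measurable_cross d' (T' : measurableType d') (M M' : T' -> 'M[R]_N) i j :
  (forall i j, measurable_fun setT (fun w => M w i j)) ->
  (forall i j, measurable_fun setT (fun w => M' w i j)) ->
  measurable_fun setT (fun w => crossA i j (M w) (M' w)) /\
  measurable_fun setT (fun w => crossB i j (M w) (M' w)).
Proof.
move=> mM mM'; split; rewrite /crossA /crossB.
- by apply: measurable_funB; [apply: measurable_funB; [apply: measurable_funD|]|]; exact: measurable_funM.
- by apply: measurable_funD; [apply: measurable_funD; [apply: measurable_funD|]|]; exact: measurable_funM.
Qed.

Let mH := @measurable_scale _ T (cb_board) s measurable_cb_board.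

Let mA i j : measurable_fun setT (fun w => resA eta (Hm (cb_board w)) i j).
Proof. by apply: measurable_resA => // w; exact: scale_sym. Qed.
Let mB i j : measurable_fun setT (fun w => resB eta (Hm (cb_board w)) i j).
Proof. by apply: measurable_resB => // w; exact: scale_sym. Qed.

Let A1 x i j : `|resA eta (Hm (checkerboard k W x N)) i j| <= 1.
Proof. by apply: resA_le1 => //; exact: scale_sym. Qed.
Let B1 x i j : `|resB eta (Hm (checkerboard k W x N)) i j| <= 1.
Proof. by apply: resB_le1 => //; exact: scale_sym. Qed.

Let al1 x u : `|cb_al (checkerboard k W x N) u| <= 1.
Proof. by apply: ptr_norm_le1. Qed.
Let be1 x u : `|cb_be (checkerboard k W x N) u| <= 1.
Proof. by apply: ptr_norm_le1. Qed.
Let be0 x u : 0 <= cb_be (checkerboard k W x N) u.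
Proof.
rewrite mulr_ge0 ?sqr_ge0 // sumr_ge0 // => i _.
by apply: resB_ge0 => //; exact: scale_sym.
Qed.

Let de2 x u : `|cb_be (checkerboard k W x N) u - c| <= 2.
Proof.
have := be1 x u; have := be0 x u; move=> h0; rewrite ger0_norm // => h1.
by have hc1 := c1; have hc0 := c0; rewrite ler_norml; apply/andP; split; lra.
Qed.

Definition cb_entry w (i j : 'I_N) := a N (minn i j) (maxn i j) w.

(* The entries have a common law, and (2, 0, 1) is one of their indices. *)
Definition mom2 := Ex (fun w => (`|X (2, 0, 1)%N w| + 4) * (18 * `|X (2, 0, 1)%N w|)).
Definition mom3 := Ex (fun w => 16 * `|X (2, 0, 1)%N w| ^+ 3 + 32 * `|X (2, 0, 1)%N w|).
Definition mom4 := Ex (fun w => (`|X (2, 0, 1)%N w| + 4) * (160 * `|X (2, 0, 1)%N w| ^+ 3)).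
Definition mom4' := Ex (fun w => `|X (2, 0, 1)%N w| ^+ 4).
Definition momC := mom3 ^+ 4 / kap ^+ 3 + mom2 ^+ 2 / (4 * kap) + mom4 + 4096 * kap * mom4'.

Section OneEntry.
Variables (u : 'I_k) (i j : 'I_N).
Hypothesis ui : cb_class u i.
Hypothesis uj : ~~ cb_class u j.

Let ij : (i %% k != j %% k)%N.
Proof. by move: ui uj; rewrite /cb_class => /eqP ->; rewrite eq_sym. Qed.

Let e := (N, minn i j, maxn i j).
Let ue : upper_idx e. Proof. exact: upper_entry. Qed.
Let G := cylinders X (other_entries e).

Let mM0 p q : measurable_fun setT ((fun w => (Hm (cb_board0 i j w)) p q) : g_sigma_algebraType G -> R).
Proof. apply: (measurable_scale (T' := g_sigma_algebraType G)) => p' q'. exact: measurable_cb_board0. Qed.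

Let mA0 p q : measurable_fun setT ((fun w => resA eta (Hm (cb_board0 i j w)) p q) : g_sigma_algebraType G -> R).
Proof. by apply: (measurable_resA (T := g_sigma_algebraType G)) => // w; exact: scale_sym. Qed.
Let mB0 p q : measurable_fun setT ((fun w => resB eta (Hm (cb_board0 i j w)) p q) : g_sigma_algebraType G -> R).
Proof. by apply: (measurable_resB (T := g_sigma_algebraType G)) => // w; exact: scale_sym. Qed.

Let HE w : Hm (cb_board w) = Hm (cb_board0 i j w) +
  (s * cb_entry w i j) *: (delta_mx i j + delta_mx j i).
Proof. by rewrite (cb_board_split w ij) scalerDr scalerA. Qed.

Let ptr_diff (Y Y' : 'M[R]_N) w :
  `|\sum_(l | cb_class u l) Y l l - \sum_(l | cb_class u l) Y' l l| <= 4 * `|s * cb_entry w i j| ->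
  `|ptr s Y (cb_class u) - ptr s Y' (cb_class u)| <= 4 * s ^+ 3 * `|X e w|.
Proof.
case/andP: s01 => s0 s1.
rewrite normrM (ger0_norm s0) => h; rewrite /ptr -mulrBr normrM ger0_norm ?sqr_ge0 //.
apply: le_trans (ler_wpM2l (sqr_ge0 _) h) _.
by rewrite le_eqVlt; apply/orP; left; apply/eqP; rewrite /cb_entry /=; ring.
Qed.

Let Gm : G `<=` measurable.
Proof. by apply: measurable_cylinders ma _ _ => t /other_entries_upper. Qed.

Let indG (Y : T -> R) : measurable_fun setT (Y : g_sigma_algebraType G -> R) ->
  independent_rv P (X e) Y.
Proof.
apply: (independent_rv_cylinders ma inda) => //; first exact: uniq_other_entries.
by move=> t /other_entries_upper.
Qed.

Let mX (g : R -> R) : measurable_fun setT g -> (forall y, 0 <= g y) ->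
  Ex (fun w => g (X e w)) <= Ex (fun w => g (X (2, 0, 1)%N w)).
Proof. by move=> mg g0; rewrite (@entry_Ex_eq e (2, 0, 1)%N g). Qed.

Let mn : measurable_fun setT (fun y : R => `|y|). Proof. exact: normr_measurable. Qed.

Lemma entry_generic (z D D0 Y1 Y2 : T -> R) :
  measurable_fun setT z -> measurable_fun setT D ->
  measurable_fun setT (D0 : g_sigma_algebraType G -> R) ->
  measurable_fun setT (Y1 : g_sigma_algebraType G -> R) ->
  measurable_fun setT (Y2 : g_sigma_algebraType G -> R) ->
  (forall w, `|z w - (X e w * Y1 w - (X e w ^+ 2 - 1) * (s * Y2 w))| <=
     s ^+ 2 * (16 * `|X e w| ^+ 3 + 32 * `|X e w|)) ->
  (forall w, `|z w| <= `|X e w| + 4) ->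
  (forall w, `|D w - D0 w| <= 4 * s ^+ 3 * `|X e w|) ->
  (forall w, `|Y1 w| <= 1) -> (forall w, `|Y2 w| <= 4) ->
  (forall w, `|D w| <= 2) -> (forall w, `|D0 w| <= 2) ->
  integrableR (fun w => z w * D w ^+ 3) /\
  `|Ex (fun w => z w * D w ^+ 3)| <= s * (16 * kap * Ex (fun w => D w ^+ 4) + momC * s ^+ 4).
Proof.
move=> mz mD mD0 mY1 mY2 h1 h2 h3 h4 h5 h6 h7.
have ix n : integrableR (fun w => `|X e w| ^+ n) by exact: (inta ue n).
split; first by apply: integrable_zD3 h2 h6 => //; exact: (ma ue).
apply: (entry_estimate Gm (ma ue) mz mD mD0 mY1 mY2 indG s01 kap0 ix _ _ _ _ _ _ h1 h2 h3 h4 h5 h6 h7).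
- exact: entry_mean.
- exact: entry_var.
- apply: (@mX (fun y => (`|y| + 4) * (18 * `|y|))).
    by apply: measurable_funM; [apply: measurable_funD|apply: measurable_funM].
  by move=> y; rewrite mulr_ge0 ?addr_ge0 ?mulr_ge0.
- apply: (@mX (fun y => 16 * `|y| ^+ 3 + 32 * `|y|)).
    by apply: measurable_funD; apply: measurable_funM => //; exact: measurable_funX.
  by move=> y; rewrite addr_ge0 ?mulr_ge0 ?exprn_ge0.
- apply: (@mX (fun y => (`|y| + 4) * (160 * `|y| ^+ 3))).
    apply: measurable_funM; [exact: measurable_funD|apply: measurable_funM => //].
    exact: measurable_funX.
  by move=> y; rewrite mulr_ge0 ?addr_ge0 ?mulr_ge0 ?exprn_ge0.
- apply: (@mX (fun y => `|y| ^+ 4)); first exact: measurable_funX.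
  by move=> y; rewrite exprn_ge0.
Qed.

Let Hs w := scale_sym (fun p q => a N p q w).
Let H0s w := scale_sym (fun p q => if (p == minn i j) && (q == maxn i j) then 0 else a N p q w).

Let mentry : measurable_fun setT (fun w => cb_entry w i j).
Proof. by have h := ma ue; exact: h. Qed.

Lemma entry_al : let z w := zetaB eta s (cb_board w) (cb_entry w) i j in
  let D w := cb_al (cb_board w) u in
  integrableR (fun w => z w * D w ^+ 3) /\
  `|Ex (fun w => z w * D w ^+ 3)| <= s * (16 * kap * Ex (fun w => D w ^+ 4) + momC * s ^+ 4).
Proof.
move=> z D; case/andP: (s01) => s0 s1.
apply: (entry_generic (D0 := fun w => cb_al (cb_board0 i j w) u)
  (Y1 := fun w => resB eta (Hm (cb_board0 i j w)) i j)
  (Y2 := fun w => crossB i j (resA eta (Hm (cb_board0 i j w))) (resB eta (Hm (cb_board0 i j w))))).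
- apply: measurable_funD; first exact: measurable_funM.
  by apply: measurable_funM => //; exact: (measurable_cross i j mA mB).2.
- exact: measurable_ptr.
- exact: (measurable_ptr (T' := g_sigma_algebraType G)).
- exact: mB0.
- exact: (measurable_cross (T' := g_sigma_algebraType G) i j mA0 mB0).2.
- by move=> w; apply: (zetaB_expand eta_ge1 (Hs w) (H0s w) (HE w)).
- by move=> w; have := zetaB_le eta_ge1 i j (Hs w) (cb_entry w i j) s01.
- by move=> w; apply: ptr_diff; exact: (trA_diff_le eta_ge1 (Hs w) (H0s w) (HE w)).
- by move=> w; exact: B1.
- by move=> w; rewrite -[4]mulr1; apply: norm4_le; apply: ler_norm2M; first [exact: A1|exact: B1].
- by move=> w; apply: le_trans (al1 _ _) _; rewrite ler1n.
- by move=> w; apply: le_trans (al1 _ _) _; rewrite ler1n.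
Qed.

Lemma entry_de : let z w := zetaA eta s (cb_board w) (cb_entry w) i j in
  let D w := cb_be (cb_board w) u - c in
  integrableR (fun w => z w * D w ^+ 3) /\
  `|Ex (fun w => z w * D w ^+ 3)| <= s * (16 * kap * Ex (fun w => D w ^+ 4) + momC * s ^+ 4).
Proof.
move=> z D; case/andP: (s01) => s0 s1.
apply: (entry_generic (D0 := fun w => cb_be (cb_board0 i j w) u - c)
  (Y1 := fun w => resA eta (Hm (cb_board0 i j w)) i j)
  (Y2 := fun w => crossA i j (resA eta (Hm (cb_board0 i j w))) (resB eta (Hm (cb_board0 i j w))))).
- apply: measurable_funD; first exact: measurable_funM.
  by apply: measurable_funM => //; exact: (measurable_cross i j mA mB).1.
- by apply: measurable_funB => //; exact: measurable_ptr.
- by apply: measurable_funB => //; exact: (measurable_ptr (T' := g_sigma_algebraType G)).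
- exact: mA0.
- exact: (measurable_cross (T' := g_sigma_algebraType G) i j mA0 mB0).1.
- by move=> w; apply: (zetaA_expand eta_ge1 (Hs w) (H0s w) (HE w)).
- by move=> w; have := zetaA_le eta_ge1 i j (Hs w) (cb_entry w i j) s01.
- move=> w; rewrite opprB addrA subrK; apply: ptr_diff; exact: (trB_diff_le eta_ge1 (Hs w) (H0s w) (HE w)).
- by move=> w; exact: A1.
- by move=> w; rewrite -[4]mulr1; apply: norm4_le; rewrite ?normrN; apply: ler_norm2M;
    first [exact: A1|exact: B1].
- by move=> w; exact: de2.
- by move=> w; exact: de2.
Qed.

End OneEntry.

Definition cb_dev (M : 'M[R]_N) := \sum_(u < k) (cb_al M u ^+ 4 + (cb_be M u - c) ^+ 4).

(** One constant for all classes; the 2 is that of [resFA_approx] and [resFB_approx]. *)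
Definition boundW : R := \sum_(x <- W) `|x| + 2.

Lemma nth_le_boundW i : `|nth 0 W i| + 2 <= boundW.
Proof.
rewrite lerD2r; have [iW|iW] := ltnP i (size W); last first.
  by rewrite nth_default // normr0 sumr_ge0.
by rewrite (big_nth 0) big_mkord (bigD1 (Ordinal iW)) //= lerDl sumr_ge0.
Qed.

Lemma ptr_classes (Y : 'M[R]_N) : \sum_(u < k) ptr s Y (cb_class u) = ptr s Y predT.
Proof.
rewrite /ptr -mulr_sumr; congr (_ * _).
by rewrite [RHS](partition_big (fun i : 'I_N => Ordinal (ltn_pmod i k0)) predT).
Qed.

Section OneClass.
Variable u : 'I_k.

Let FA w := resFA eta s (cb_board w) (cb_class u).
Let FB w := resFB eta s (cb_board w) (cb_class u) - k%:R^-1.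
Let DA w := cb_al (cb_board w) u.
Let DB w := cb_be (cb_board w) u - c.

Let mFA : measurable_fun setT FA.
Proof.
rewrite /FA /resFA; apply: measurable_funD; [apply: measurable_funD|];
  apply: measurable_funM => //; do ?[apply: measurable_funB]; exact: measurable_ptr.
Qed.

Let mFB : measurable_fun setT FB.
Proof.
rewrite /FB /resFB; apply: measurable_funB => //; apply: measurable_funD; [apply: measurable_funB|];
  apply: measurable_funM => //; do ?[apply: measurable_funB]; exact: measurable_ptr.
Qed.

Let mDA : measurable_fun setT DA. Proof. exact: measurable_ptr. Qed.
Let mDB : measurable_fun setT DB.
Proof. by apply: measurable_funB => //; exact: measurable_ptr. Qed.

Let Mu w (i j : 'I_N) : cb_class u i ->
  cb_board w i j = if cb_class u j then nth 0 W u else cb_entry w i j.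
Proof.
rewrite /cb_class => /eqP iu; rewrite mxE iu eq_sym.
by case: ifP.
Qed.

Let bsym w : (cb_board w)^T = cb_board w. Proof. exact: checkerboard_sym. Qed.

Let wm : 0 <= boundW. Proof. by rewrite addr_ge0 // sumr_ge0. Qed.

Let momC0 : 0 <= momC.
Proof.
have m4 : 0 <= mom4' by apply: Ex_ge0 => w; rewrite exprn_ge0.
have m3 : 0 <= mom4 by apply: Ex_ge0 => w; rewrite mulr_ge0 ?addr_ge0 // mulr_ge0 // exprn_ge0.
apply: addr_ge0; last first.
  by apply: mulr_ge0 m4; apply: mulr_ge0; [exact: ler0n|exact: ltW].
apply: addr_ge0 m3; apply: addr_ge0; apply: divr_ge0.
- exact: exprn_even_ge0.
- by apply: exprn_ge0; exact: ltW.
- exact: sqr_ge0.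
- by apply: mulr_ge0 => //; exact: ltW.
Qed.

Let DA2 w : `|DA w| <= 2.
Proof. by apply: le_trans (al1 _ _) _; rewrite ler1n. Qed.

Let DB2 w : `|DB w| <= 2. Proof. exact: de2. Qed.

Let FA_approx w : `|FA w - 1 * s ^+ 3 * \sum_(i | cb_class u i) \sum_(j | ~~ cb_class u j)
    zetaB eta s (cb_board w) (cb_entry w) i j| <= s * boundW.
Proof.
have [s0 s1] := andP s01; rewrite mul1r.
apply: le_trans (resFA_approx eta_ge1 (bsym w) (@Mu w) s_norm s01) _.
by rewrite ler_wpM2l // nth_le_boundW.
Qed.

Let FB_approx w : `|FB w - (- 1) * s ^+ 3 * \sum_(i | cb_class u i) \sum_(j | ~~ cb_class u j)
    zetaA eta s (cb_board w) (cb_entry w) i j| <= s * boundW.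
Proof.
have [s0 s1] := andP s01; rewrite !mulNr mul1r opprK.
apply: le_trans (_ : s * (`|nth 0 W u| + 2) <= _); last by rewrite ler_wpM2l // nth_le_boundW.
apply: (resFB_approx eta_ge1 (bsym w) (@Mu w) s_norm s01).
(* The size of a class differs from N / k by at most 1, so its multiple by [s ^+ 2] differs from 1/k
   by at most s^2 <= s. *)
have -> : k%:R^-1 = s ^+ 2 * (N%:R / k%:R) :> R by rewrite mulrA s_norm mul1r.
rewrite -mulrBr normrM ger0_norm ?sqr_ge0 //.
apply: (@le_trans _ _ (s ^+ 2 * 1)); last by rewrite mulr1 expr2 ler_piMr.
by rewrite ler_wpM2l ?sqr_ge0 //; exact: card_residue_class.
Qed.

Lemma class_al : integrableR (fun w => FA w * DA w ^+ 3) /\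
  Ex (fun w => FA w * DA w ^+ 3) <= 17 * kap * Ex (fun w => DA w ^+ 4) +
    (momC + boundW ^+ 4 / kap ^+ 3) * s ^+ 4.
Proof.
have iz i j ui uj := (@entry_al u i j ui uj).1.
have hz i j ui uj := (@entry_al u i j ui uj).2.
split.
- exact: (integrable_FD3 s01 kap0 wm mFA mDA DA2 iz FA_approx).
- exact: (aggregate_estimate s_norm s01 (normr1 _) kap0 momC0 wm mFA mDA DA2 iz hz FA_approx).
Qed.

Lemma class_de : integrableR (fun w => FB w * DB w ^+ 3) /\
  Ex (fun w => FB w * DB w ^+ 3) <= 17 * kap * Ex (fun w => DB w ^+ 4) +
    (momC + boundW ^+ 4 / kap ^+ 3) * s ^+ 4.
Proof.
have iz i j ui uj := (@entry_de u i j ui uj).1.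
have hz i j ui uj := (@entry_de u i j ui uj).2.
split.
- exact: (integrable_FD3 s01 kap0 wm mFB mDB DB2 iz FB_approx).
- exact: (aggregate_estimate s_norm s01 (normrN1 _) kap0 momC0 wm mFB mDB DB2 iz hz FB_approx).
Qed.

Lemma integrable_al4 : integrableR (fun w => DA w ^+ 4).
Proof.
apply: (@integrableR_bounded _ _ _ _ _ (2 ^+ 4)); first exact: measurable_funX.
by move=> w; rewrite normrX lerXn2r // nnegrE.
Qed.

Lemma integrable_de4 : integrableR (fun w => DB w ^+ 4).
Proof.
apply: (@integrableR_bounded _ _ _ _ _ (2 ^+ 4)); first exact: measurable_funX.
by move=> w; rewrite normrX lerXn2r // nnegrE.
Qed.

End OneClass.

Lemma cb_dev_contraction w : cb_dev (cb_board w) <= \sum_(u < k)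
  (resFA eta s (cb_board w) (cb_class u) * cb_al (cb_board w) u ^+ 3 +
   (resFB eta s (cb_board w) (cb_class u) - k%:R^-1) * (cb_be (cb_board w) u - c) ^+ 3).
Proof.
apply: le_trans (contraction k0 eta_large c0 cE (al1 _) (be1 _) (be0 _)) _.
rewrite le_eqVlt; apply/orP; left; apply/eqP; apply: eq_bigr => u _.
rewrite /cb_al /cb_be !ptr_classes /resFA /resFB; move: (k%:R^-1) => ki; ring.
Qed.

Lemma integrable_cb_dev : integrableR (fun w => cb_dev (cb_board w)).
Proof.
by apply: integrableR_sum => u _; apply: integrableRD; [exact: integrable_al4|exact: integrable_de4].
Qed.

(* For [kap = 1 / 34] the first term on the right is half of the left-hand side. *)
Lemma cb_dev_mean : Ex (fun w => cb_dev (cb_board w)) <=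
  17 * kap * Ex (fun w => cb_dev (cb_board w)) +
   2 * k%:R * (momC + boundW ^+ 4 / kap ^+ 3) * s ^+ 4.
Proof.
apply: (@le_trans _ _ (\sum_(u < k)
  (Ex (fun w => resFA eta s (cb_board w) (cb_class u) * cb_al (cb_board w) u ^+ 3) +
   Ex (fun w => (resFB eta s (cb_board w) (cb_class u) - k%:R^-1) * (cb_be (cb_board w) u - c) ^+ 3)))).
  under eq_bigr => u _ do rewrite -(ExD (class_al u).1 (class_de u).1).
  rewrite -Ex_sum; last by move=> u _; exact: integrableRD (class_al u).1 (class_de u).1.
  apply: le_Ex; [exact: integrable_cb_dev| |exact: cb_dev_contraction].
  by apply: integrableR_sum => u _; exact: integrableRD (class_al u).1 (class_de u).1.
apply: le_trans (ler_sum _ (fun u _ => lerD (class_al u).2 (class_de u).2)) _.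
rewrite Ex_sum; last first.
  by move=> u _; apply: integrableRD; [exact: integrable_al4|exact: integrable_de4].
under [in leRHS]eq_bigr => u _ do rewrite (ExD (integrable_al4 u) (integrable_de4 u)).
set C := (momC + _) * _.
rewrite mulr_sumr -[2 * _ * _ * _]mulrA -/C.
have -> : 2 * k%:R * C = \sum_(u < k) (2 * C).
  by rewrite sumr_const card_ord -[RHS]mulr_natr; ring.
by rewrite -big_split le_eqVlt; apply/orP; left; apply/eqP; apply: eq_bigr => u _ /=; ring.
Qed.

End FixedN.
End Checkerboard.

(** * From summable means to almost sure convergence *)

Lemma sum_inv_sqr_le (R : realType) n : \sum_(0 <= i < n) (i.+1%:R ^+ 2)^-1 <= 2 :> R.
Proof.
(* The stronger bound telescopes, since 1/(y + 1)^2 <= 1/(y (y + 1)) = 1/y - 1/(y + 1). *)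
suff h m : \sum_(0 <= i < m.+1) (i.+1%:R ^+ 2)^-1 <= 2 - m.+1%:R^-1 :> R.
  case: n => [|n]; first by rewrite big_geq.
  by apply: le_trans (h n) _; rewrite gerBl invr_ge0.
elim: m => [|m IH]; first by rewrite big_nat1 expr1n invr1; lra.
rewrite big_nat_recr //=; apply: le_trans (lerD IH (lexx _)) _.
have a0 : 0 < m.+1%:R :> R by rewrite ltr0n.
rewrite -[m.+2%:R]natr1; set y : R := m.+1%:R in a0 *.
have -> : (2 - (y + 1)^-1) = 2 - y^-1 + (y * (y + 1))^-1.
  by field; rewrite gt_eqF //= gt_eqF // addr_gt0.
rewrite lerD2l lef_pV2 ?posrE ?exprn_gt0 ?mulr_gt0 ?addr_gt0 //.
by rewrite expr2 ler_wpM2r ?lerDl // addr_ge0 // ltW.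
Qed.

(** By monotone convergence the sum of the [f n.+1] has finite mean, hence it is finite almost
    everywhere, and there its terms tend to 0. The sum starts at index 1, from which the bound 1/n^2
    makes sense. *)
Lemma ae_cvg0_of_Ex_bound {d} {T : measurableType d} {R : realType} (P : probability T R)
  (f : nat -> T -> R) (C : R) :
  (forall n w, 0 <= f n w) -> (forall n, integrableR P (f n)) ->
  (forall n, Ex P (f n.+1) <= C / n.+1%:R ^+ 2) ->
  {ae P, forall w, (fun n => f n w) @ \oo --> (0 : R)}.
Proof.
move=> f0 fi fC.
pose h w := (\sum_(n <oo) (f n.+1 w)%:E)%E.
have C0 : 0 <= C.
  have := fC 0%N; rewrite expr1n divr1; apply: le_trans; apply: Ex_ge0 => w; exact: f0.
have mf n : measurable_fun setT (EFin \o f n) by apply/measurable_EFinP; exact: integrableR_measurable (fi n).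
have h0 w : (0 <= h w)%E by apply: nneseries_ge0 => n _ _; rewrite lee_fin.
have ih : P.-integrable setT h.
  apply/integrableP; split.
    apply: ge0_emeasurable_sum; last by move=> n _; exact: mf.
    by move=> n w _ _; rewrite lee_fin.
  under eq_integral do rewrite gee0_abs //.
  rewrite /h integral_nneseries //; last 2 first.
  - by move=> n; exact: mf.
  - by move=> n w _; rewrite lee_fin.
  apply: (@le_lt_trans _ _ (C * 2)%:E); last exact: ltry.
  apply: lime_le.
    by apply: is_cvg_nneseries => n _ _; apply: integral_ge0 => w _; rewrite lee_fin.
  apply: nearW => n.
  have -> : (\sum_(0 <= i < n) \int[P]_w (f i.+1 w)%:E = (\sum_(0 <= i < n) Ex P (f i.+1))%:E)%E.
    rewrite -sumEFin; apply: eq_bigr => i _; rewrite /Ex /Rintegral fineK //.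
    exact: (integrable_fin_num measurableT (fi i.+1)).
  rewrite lee_fin; apply: le_trans (_ : \sum_(0 <= i < n) C * (i.+1%:R ^+ 2)^-1 <= _).
    by apply: ler_sum => i _; exact: fC.
  by rewrite -mulr_sumr ler_wpM2l // sum_inv_sqr_le.
have := integrable_ae measurableT ih; apply: filterS => w /(_ I) hw.
rewrite -(cvg_shiftS (fun n => f n w)).
apply: cvg_series_cvg_0; apply: nondecreasing_is_cvgn.
  by apply/nondecreasing_seqP => n; rewrite /series /= big_nat_recr //= lerDl.
exists (fine (h w)) => _ [n _ <-]; rewrite -lee_fin fineK // /series /= -sumEFin.
by apply: nneseries_lim_ge => i _ _; rewrite lee_fin.
Qed.

Section CheckerboardAE.
Context {R : realType} {d : measure_display} {T : measurableType d}.
Variables (P : probability T R) (k : nat) (W : seq R).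
Variable a : nat -> nat -> nat -> T -> R.
Hypothesis k0 : (0 < k)%N.
Hypothesis ma : forall t, upper_idx t -> measurable_fun setT (a t.1.1 t.1.2 t.2).
Hypothesis inda : mutually_independent P upper_idx (fun t => a t.1.1 t.1.2 t.2).
Hypothesis ida : identically_distributed P upper_idx (fun t => a t.1.1 t.1.2 t.2).
Hypothesis inta : forall t, upper_idx t -> forall n : nat,
     P.-integrable setT (fun w => (`|a t.1.1 t.1.2 t.2 w| ^+ n)%:E).
Hypothesis Ea : forall t, upper_idx t -> ('E_P[a t.1.1 t.1.2 t.2])%E = 0%E.
Hypothesis Va : forall t, upper_idx t -> variance P (a t.1.1 t.1.2 t.2) = 1%E.
Variables (eta c : R).
Hypothesis eta_large : 2 * k%:R + 1 <= eta.
Hypothesis c0 : 0 <= c.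
Hypothesis cE : eta * c = k%:R^-1 - (k%:R - 1) * c ^+ 2.

Let dev N w := cb_dev k (N := N) eta c (cb_board k W a N w).

Lemma dev_ae : {ae P, forall w, (fun N => dev N w) @ \oo --> (0 : R)}.
Proof.
pose C' := @momC R d T P a (34^-1) + boundW W ^+ 4 / (34^-1) ^+ 3.
apply: (@ae_cvg0_of_Ex_bound _ _ _ P dev (4 * k%:R * C')).
- by move=> N w; apply: sumr_ge0 => u _; rewrite addr_ge0 // exprn_even_ge0.
- case=> [|N].
    (* The matrix of size 0 does not depend on [w]. *)
    have -> : dev 0%N = fun=> dev 0%N point.
      by apply/funext => w; rewrite /dev; congr (cb_dev _ _ _ _); apply/matrixP => -[].
    exact: integrableR_cst.
  apply: integrable_cb_dev => //.
- move=> N.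
  have kap0 : 0 < 34^-1 :> R by rewrite invr_gt0.
  have := @cb_dev_mean R d T P k W a k0 ma inda ida inta Ea Va N.+1 isT eta c _ eta_large c0 cE kap0.
  rewrite -/C' -/(dev N.+1); set S := Ex P _; set s := (Num.sqrt _)^-1 => hS.
  have -> : 4 * k%:R * C' / N.+1%:R ^+ 2 = 4 * k%:R * C' * s ^+ 4.
    congr (_ * _); rewrite /s exprVn (_ : 4%N = (2 * 2)%N) // exprM sqr_sqrtr //.
  have e17 : 17 * (34^-1) = 2^-1 :> R by field.
  rewrite e17 in hS.
  have -> : 4 * k%:R * C' * s ^+ 4 = 2 * (2 * k%:R * C' * s ^+ 4) by ring.
  move: (2 * k%:R * C' * s ^+ 4) hS => y hS; lra.
Qed.

Lemma ptr_cvg_ae : {ae P, forall w,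
  (fun N => ptr (Num.sqrt N%:R)^-1 (resA eta ((Num.sqrt N%:R)^-1 *: cb_board k W a N w)) predT) @ \oo --> (0 : R) /\
  (fun N => ptr (Num.sqrt N%:R)^-1 (resB eta ((Num.sqrt N%:R)^-1 *: cb_board k W a N w)) predT) @ \oo --> k%:R * c}.
Proof.
have := dev_ae; apply: filterS => w hw.
have root4 (y e : R) : 0 < e -> y ^+ 4 < e ^+ 4 -> `|y| < e.
  move=> e0 h; rewrite -(@ltr_pXn2r _ 4) ?nnegrE ?(ltW e0) //.
  by rewrite -normrX ger0_norm // exprn_even_ge0.
have kR : 0 < k%:R :> R by rewrite ltr0n.
have small t : 0 < t -> \forall N \near \oo, forall u : 'I_k,
   `|cb_al eta (cb_board k W a N w) u| < t / k%:R /\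
   `|cb_be eta (cb_board k W a N w) u - c| < t / k%:R.
  move=> e0; have ek : 0 < t / k%:R by rewrite divr_gt0.
  move/cvgrPdist_lt : hw => /(_ ((t / k%:R) ^+ 4)) /(_ (exprn_gt0 _ ek)).
  apply: filterS => N; rewrite sub0r normrN => h u.
  have {}h : dev N w < (t / k%:R) ^+ 4 by apply: le_lt_trans h; exact: ler_norm.
  rewrite /dev /cb_dev (bigD1 u) //= in h.
  have r0 : 0 <= \sum_(i < k | i != u) (cb_al eta (cb_board k W a N w) i ^+ 4 +
        (cb_be eta (cb_board k W a N w) i - c) ^+ 4).
    by apply: sumr_ge0 => v _; rewrite addr_ge0 // exprn_even_ge0.
  have p1 : 0 <= cb_al eta (cb_board k W a N w) u ^+ 4 by rewrite exprn_even_ge0.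
  have p2 : 0 <= (cb_be eta (cb_board k W a N w) u - c) ^+ 4 by rewrite exprn_even_ge0.
  split; apply: root4 => //; apply: le_lt_trans h; rewrite -addrA.
    by rewrite lerDl addr_ge0.
  by rewrite addrCA lerDl addr_ge0.
have sumlt (f : 'I_k -> R) t : 0 < t -> (forall u, `|f u| < t / k%:R) -> `|\sum_u f u| < t.
  move=> e0 h; apply: le_lt_trans (ler_norm_sum _ _ _) _.
  have -> : t = \sum_(u < k) (t / k%:R).
    by rewrite sumr_const card_ord -[RHS]mulr_natr divfK // gt_eqF.
  by apply: ltr_sum => //; apply/hasP; exists (Ordinal k0); rewrite ?mem_index_enum.
split; apply/cvgrPdist_lt => e1 e10; have := small e1 e10; apply: filterS => N h.
  rewrite sub0r normrN -(ptr_classes k0); apply: sumlt => // u; exact: (h u).1.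
rewrite distrC -(ptr_classes k0).
have -> : k%:R * c = \sum_(u < k) c by rewrite sumr_const card_ord mulr_natl.
rewrite -sumrB; apply: sumlt => // u; exact: (h u).2.
Qed.

End CheckerboardAE.

(** * Eigenvalues *)

Lemma char_poly_conj (F : comUnitRingType) n (V D U : 'M[F]_n) :
  V *m U = 1%:M -> char_poly (V *m D *m U) = char_poly D.
Proof.
move=> VU; rewrite /char_poly /char_poly_mx !map_mxM.
have VU' : map_mx polyC V *m map_mx polyC U = 1%:M by rewrite -map_mxM VU map_mx1.
have -> : 'X%:M - map_mx polyC V *m map_mx polyC D *m map_mx polyC U =
   map_mx polyC V *m ('X%:M - map_mx polyC D) *m map_mx polyC U.
  rewrite mulmxBr mulmxBl; congr (_ - _).
  by rewrite mul_mx_scalar -scalemxAl VU' scalemx1.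
by rewrite !det_mulmx mulrAC -det_mulmx VU' det1 mul1r.
Qed.

Section RealSpectral.
Variable R : rcfType.
Local Notation toC := (real_complex R).

(* The spectral theorem of the library is over the complex numbers, whence [R[i]]. *)
Lemma real_sym_diag n (A : 'M[R]_n) : A^T = A ->
  exists (U V : 'M[R[i]]_n) (l : 'rV[R]_n), [/\ V *m U = 1%:M, U *m V = 1%:M &
    map_mx toC A = V *m diag_mx (map_mx toC l) *m U].
Proof.
move=> As; pose A' := map_mx toC A.
have hA : A' \is hermsymmx.
  apply: realsym_hermsym.
    apply/is_hermitianmxP; rewrite expr0 scale1r; apply/matrixP => i j.
    by rewrite !mxE -{1}As mxE.
  by apply/mxOverP => i j; rewrite mxE complex_real.
have /hermitian_spectral_diag_real /mxOverP hD := hA.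
have /hermitian_normalmx /orthomx_spectralP A_eq := hA.
have uU := spectral_unit A'.
exists (spectralmx A'), (invmx (spectralmx A')), (\row_j complex.Re (spectral_diag A' 0 j)).
split; [exact: mulVmx|exact: mulmxV|].
rewrite -/A' {1}A_eq; congr (_ *m diag_mx _ *m _).
by apply/rowP => j; rewrite !mxE RRe_real.
Qed.

Lemma real_sym_spectrum n (A : 'M[R]_n) : A^T = A -> exists l : 'rV[R]_n,
  char_poly A = \prod_(x <- [seq l 0 i | i <- enum 'I_n]) ('X - x%:P) /\
  forall (s eta : R), eta != 0 ->
    \tr (resA eta (s *: A)) = \sum_i (s * l 0 i) / ((s * l 0 i) ^+ 2 + eta ^+ 2) /\
    \tr (resB eta (s *: A)) = \sum_i eta / ((s * l 0 i) ^+ 2 + eta ^+ 2).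
Proof.
move=> As; have [U [V [l [VU UV Al]]]] := real_sym_diag As.
exists l; split.
  apply: (map_inj_poly (@complexI R)); first by rewrite rmorph0.
  rewrite map_char_poly Al char_poly_conj // char_poly_trig ?diag_mx_is_trig //.
  rewrite big_map rmorph_prod big_enum; apply: eq_bigr => i _.
  by rewrite !mxE eqxx mulr1n rmorphB /= map_polyX map_polyC.
move=> s eta eta0.
have den0 i : (s * l 0 i) ^+ 2 + eta ^+ 2 != 0.
  by rewrite gt_eqF // ltr_wpDl ?sqr_ge0 // exprn_even_gt0.
(* [D f] is the functional calculus of [A]: it turns sums and products of functions into those of
   matrices and constants into scalar matrices. The resolvent is then the image of a reciprocal, and
   traces are sums of values at the eigenvalues. *)
pose D (f : R -> R) : 'M[R[i]]_n := V *m diag_mx (map_mx toC (map_mx f l)) *m U.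
have DM f g : D f *m D g = D (fun x => f x * g x).
  rewrite /D !mulmxA -[V *m _ *m U *m V]mulmxA UV mulmx1 -[V *m _ *m diag_mx _]mulmxA mulmx_diag.
  by congr (_ *m diag_mx _ *m _); apply/rowP => j; rewrite !mxE rmorphM.
have DD f g : D f + D g = D (fun x => f x + g x).
  rewrite /D -mulmxDl -mulmxDr -raddfD.
  by congr (_ *m diag_mx _ *m _); apply/rowP => j; rewrite !mxE rmorphD.
have Dc t : D (fun=> t) = (toC t)%:M.
  rewrite /D (_ : diag_mx _ = (toC t)%:M); last first.
    by apply/matrixP => i j; rewrite !mxE.
  by rewrite mul_mx_scalar -scalemxAl VU scalemx1.
have trD (M : 'M[R]_n) f : map_mx toC M = D f -> \tr M = \sum_i f (l 0 i).
  move=> MD; apply: (@complexI R); rewrite -trace_map_mx MD /D mxtrace_mulC mulmxA UV mul1mx.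
  by rewrite mxtrace_diag rmorph_sum; apply: eq_bigr => i _; rewrite !mxE.
have HD : map_mx toC (s *: A) = D (fun x => s * x).
  have -> : D (fun x => s * x) = D (fun=> s) *m D id by rewrite DM.
  rewrite Dc mul_scalar_mx map_mxZ Al /D; congr (_ *: (_ *m diag_mx _ *m _)).
  by apply/rowP => j; rewrite !mxE.
have KD : map_mx toC (resK eta (s *: A)) = D (fun x => ((s * x) ^+ 2 + eta ^+ 2)^-1).
  rewrite /resK map_invmx map_mxD map_mxM map_scalar_mx HD.
  have -> : D (fun x : R => s * x) *m D (fun x : R => s * x) + (toC (eta ^+ 2))%:M =
     D (fun x => (s * x) ^+ 2 + eta ^+ 2) by rewrite DM -Dc DD.
  have inv1 : D (fun x => ((s * x) ^+ 2 + eta ^+ 2)) *m D (fun x => ((s * x) ^+ 2 + eta ^+ 2)^-1) = 1%:M.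
    rewrite DM /D -[RHS]VU; congr (_ *m _); rewrite -[RHS]mulmx1; congr (_ *m _).
    apply/matrixP => i j; rewrite !mxE.
    by case: eqP => // _; rewrite mulfV ?rmorph1.
  have [u1 _] := mulmx1_unit inv1.
  by rewrite -[RHS]mul1mx -(mulVmx u1) -mulmxA inv1 mulmx1.
split; [apply: (trD _ (fun x => s * x / ((s * x) ^+ 2 + eta ^+ 2)))|
        apply: (trD _ (fun x => eta / ((s * x) ^+ 2 + eta ^+ 2)))].
  by rewrite /resA map_mxM HD KD DM.
have -> : D (fun x => eta / ((s * x) ^+ 2 + eta ^+ 2)) =
  D (fun=> eta) *m D (fun x => ((s * x) ^+ 2 + eta ^+ 2)^-1) by rewrite DM.
by rewrite /resB map_mxZ KD Dc mul_scalar_mx.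
Qed.
End RealSpectral.

(** A product of linear factors determines its roots with multiplicity, so the sequence chosen in
    [eigenvalues] is any other one up to order. *)
Lemma eigenvalues_perm (R : realType) N (A : 'M[R]_N) (s : seq R) :
  char_poly A = \prod_(x <- s) ('X - x%:P) -> perm_eq (eigenvalues A) s.
Proof.
move=> cA; rewrite /eigenvalues; case: pselect => [h|]; last by case; exists s.
by apply: prod_XsubC_eq; rewrite -cA; case: (cid h).
Qed.

Lemma esm_integral_spectrum (R : realType) N (A : 'M[R]_N) : A^T = A ->
  exists l : 'I_N -> R, let s := (Num.sqrt N%:R)^-1 in
  (forall f, esm_integral A f = N%:R^-1 * \sum_i f (l i)) /\
  forall eta, eta != 0 ->
    \tr (resA eta (s *: A)) = \sum_i l i / (l i ^+ 2 + eta ^+ 2) /\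
    \tr (resB eta (s *: A)) = \sum_i eta / (l i ^+ 2 + eta ^+ 2).
Proof.
move=> As; have [l [cA tA]] := real_sym_spectrum As.
exists (fun i => (Num.sqrt N%:R)^-1 * l 0 i) => s; split; last by move=> eta; exact: tA.
move=> f; rewrite /esm_integral (perm_big _ (eigenvalues_perm cA)) /= big_map big_enum /=.
by congr (_ * _); apply: eq_bigr => i _; rewrite mulrC.
Qed.

Lemma esm_integral_resolvent (R : realType) N (A : 'M[R]_N) eta : A^T = A -> eta != 0 ->
  let s := (Num.sqrt N%:R)^-1 in
  esm_integral A (fun x => x / (x ^+ 2 + eta ^+ 2)) = ptr s (resA eta (s *: A)) predT /\
  esm_integral A (fun x => eta / (x ^+ 2 + eta ^+ 2)) = ptr s (resB eta (s *: A)) predT.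
Proof.
move=> As e0 s; have [l [fE tE]] := esm_integral_spectrum As; have [tA tB] := tE _ e0.
rewrite !fE -tA -tB /ptr /mxtrace.
have -> : s ^+ 2 = N%:R^-1 by rewrite /s exprVn sqr_sqrtr.
by [].
Qed.

(** * Bernstein polynomials *)

Section Bernstein.
Variable R : realType.
Implicit Types (G : nat -> R) (y : R).

(* The Bernstein polynomial sum_i C(n, i) G(i) X^i (1 - X)^(n - i), by the recursion obtained from
   conditioning on the first of n Bernoulli trials. *)
Fixpoint bern n G : {poly R} :=
  if n is m.+1 then 'X * bern m (fun i => G i.+1) + (1 - 'X) * bern m G else (G 0%N)%:P.

Lemma bernS n G y :
  (bern n.+1 G).[y] = y * (bern n (fun i => G i.+1)).[y] + (1 - y) * (bern n G).[y].
Proof. by rewrite /= !hornerE. Qed.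

Lemma bern_lin n G G' (t : R) y : (bern n (fun i => G i + t * G' i)).[y] =
  (bern n G).[y] + t * (bern n G').[y].
Proof.
elim: n G G' => [|n IH] G G'; first by rewrite /= !hornerC.
by rewrite !bernS !IH; ring.
Qed.

Lemma bern_cst n (t : R) y : (bern n (fun=> t)).[y] = t.
Proof.
elim: n => [|n IH]; first by rewrite /= hornerC.
by rewrite bernS IH; ring.
Qed.

Lemma bern_le n G G' y : 0 <= y <= 1 -> (forall i, (i <= n)%N -> G i <= G' i) ->
  (bern n G).[y] <= (bern n G').[y].
Proof.
move=> /andP[y0 y1]; elim: n G G' => [|n IH] G G' h.
  by rewrite /= !hornerC h.
rewrite !bernS; apply: lerD; apply: ler_wpM2l; rewrite ?subr_ge0 //; apply: IH => i hi.
- exact: h.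
- exact/h/leqW.
Qed.

(** The second moment about [t] of the binomial law: its variance plus the squared distance from its
    mean to [t]. The centre is left free because the induction shifts it by 1. *)
Lemma bern_sqr n (t : R) y : (bern n (fun i => (i%:R - t) ^+ 2)).[y] =
  n%:R * y * (1 - y) + (n%:R * y - t) ^+ 2.
Proof.
elim: n t => [|n IH] t; first by rewrite /= hornerC mulr0n; ring.
rewrite bernS IH (_ : (fun i => (i.+1%:R - t) ^+ 2) = fun i => (i%:R - (t - 1)) ^+ 2).
  by rewrite IH -natr1; ring.
by apply/funext => i; rewrite -natr1; congr (_ ^+ 2); ring.
Qed.

Lemma itv_bounded (g : R -> R) a b : continuous g ->
  exists M : R, forall y : R, a <= y <= b -> `|g y| <= M.
Proof.
move=> gc; have [ab|ba] := leP a b; last first.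
  by exists 0 => y /andP[ay yb]; have := le_lt_trans (le_trans ay yb) ba; rewrite ltxx.
have c' : {within `[a, b], continuous (fun y => `|g y|)}.
  by apply: continuous_subspaceT => y; apply: cvg_norm; exact: gc.
have [c _ hc] := EVT_max ab c'; exists `|g c| => y hy.
by apply: hc; rewrite in_itv.
Qed.

(** Heine-Cantor, from compactness in its near-covering form. Only [y] is confined to the interval;
    [z] may leave it. *)
Lemma itv_unif_continuous (g : R -> R) a b e : continuous g -> 0 < e ->
  exists2 de : R, 0 < de & forall y z : R, a <= y <= b -> `|y - z| < de -> `|g y - g z| <= e.
Proof.
move=> gc e0.
have /compact_near_coveringP nc := @segment_compact R a b.
pose Q (de y : R) := forall z, `|y - z| < de -> `|g y - g z| <= e.
have H x : `[a, b]%classic x -> \forall x' \near x & de \near (0 : R)^'+, Q de x'.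
  have e20 : 0 < e / 2 by rewrite divr_gt0.
  move=> _; have := gc x; move/cvgrPdist_lt => /(_ (e / 2) e20).
  move=> /nbhs_ballP[r /= r0 hr].
  exists (ball x (r / 2), [set de | de < r / 2]) => /=.
    split; first by apply: nbhsx_ballx; rewrite divr_gt0.
    by apply: nbhs_right_lt; rewrite divr_gt0.
  move=> [y de] /= [xy der] z yz.
  have rr : r = r / 2 + r / 2 by rewrite -splitr.
  have h1 : `|x - y| < r / 2 by exact: xy.
  have h2 : `|y - z| < r / 2 by apply: lt_trans der.
  have hy : `|g x - g y| < e / 2.
    by apply: hr; rewrite /ball /=; apply: lt_trans h1 _; rewrite ltr_pdivrMr // ltr_pMr // ltr1n.
  have hz : `|g x - g z| < e / 2.
    apply: hr; rewrite /ball /= rr.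
    have -> : x - z = (x - y) + (y - z) by rewrite addrA subrK.
    by apply: le_lt_trans (ler_normD _ _) _; exact: ltrD.
  have -> : g y - g z = (g x - g z) - (g x - g y) by ring.
  apply: le_trans (ler_normB _ _) _; lra.
have [r /= r0 hr] := nc _ _ Q (at_right_proper_filter (0 : R)) H.
exists (r / 2); first by rewrite divr_gt0.
move=> y z hy; apply: (hr (r / 2)) => /=.
- by rewrite sub0r normrN gtr0_norm ?divr_gt0 // ltr_pdivrMr // ltr_pMr // ltr1n.
- by rewrite divr_gt0.
- by rewrite in_itv.
Qed.

(** Bernstein's proof. Where i/n is within [de] of y, uniform continuity bounds the difference;
    elsewhere 2M is at most 2M (y - i/n)^2 / de^2. The Bernstein mean of the latter is a binomial
    variance over n^2, hence of order 1/n. *)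
Lemma poly_approx01 (g : R -> R) : continuous g ->
  forall e, 0 < e -> exists p : {poly R}, forall y, 0 <= y <= 1 -> `|g y - p.[y]| <= e.
Proof.
move=> gc e e0.
have e20 : 0 < e / 2 by rewrite divr_gt0.
have [M Mg] := itv_bounded 0 1 gc.
have [de de0 gd] := itv_unif_continuous 0 1 gc e20.
have M0 : 0 <= M by apply: le_trans (Mg 0 _); rewrite ?lexx ?ler01.
have [n n0 hn] : exists2 n, (0 < n)%N & 2 * M / de ^+ 2 / n%:R <= e / 2.
  set t := 2 * M / de ^+ 2.
  have t0 : 0 <= t by apply: divr_ge0; [exact: mulr_ge0|exact: sqr_ge0].
  exists (Num.truncn (t / (e / 2))).+1 => //.
  rewrite ler_pdivrMr ?ltr0n // mulrC -ler_pdivrMr //.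
  by apply: ltW; apply: real_truncnS_gt; exact: num_real.
exists (bern n (fun i => g (i%:R / n%:R))) => y hy.
have nR : 0 < n%:R :> R by rewrite ltr0n.
have hi i : (i <= n)%N -> 0 <= (i%:R / n%:R : R) <= 1.
  by move=> h; rewrite divr_ge0 //= ler_pdivrMr // mul1r ler_nat.
pose K := 2 * M / de ^+ 2 / n%:R ^+ 2.
have key i : (i <= n)%N -> `|g y - g (i%:R / n%:R)| <= e / 2 + K * (i%:R - n%:R * y) ^+ 2.
  move=> h; have := hi _ h; set z := i%:R / n%:R => hz.
  have -> : K * (i%:R - n%:R * y) ^+ 2 = 2 * M * ((y - z) ^+ 2 / de ^+ 2).
    have -> : i%:R = z * n%:R by rewrite /z divfK // gt_eqF.
    by rewrite /K; field; rewrite !gt_eqF.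
  have [yz|yz] := ltP `|y - z| de.
    apply: le_trans (gd y z hy yz) _.
    rewrite lerDl; apply: mulr_ge0; first exact: mulr_ge0.
    by apply: divr_ge0; exact: sqr_ge0.
  apply: le_trans (ler_normB _ _) _.
  apply: (@le_trans _ _ (2 * M * 1)).
    by have := Mg y hy; have := Mg z hz; lra.
  apply: le_trans (_ : 2 * M * ((y - z) ^+ 2 / de ^+ 2) <= _); last first.
    by rewrite lerDr; apply: divr_ge0 => //; exact: ltW.
  rewrite ler_wpM2l ?mulr_ge0 // ler_pdivlMr ?exprn_gt0 // mul1r.
  by rewrite -[leRHS]real_normK ?num_real // lerXn2r // nnegrE // ltW.
have dec : (bern n (fun i => g y + (-1) * g (i%:R / n%:R))).[y] =
   g y - (bern n (fun i => g (i%:R / n%:R))).[y].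
  by rewrite bern_lin bern_cst mulN1r.
have up : (bern n (fun i => e / 2 + K * (i%:R - n%:R * y) ^+ 2)).[y] <= e.
  rewrite bern_lin bern_cst bern_sqr subrr expr0n addr0.
  have -> : K * (n%:R * y * (1 - y)) = 2 * M / de ^+ 2 / n%:R * (y * (1 - y)).
    by rewrite /K; field; rewrite !gt_eqF.
  have h1 : y * (1 - y) <= 1.
    by case/andP: hy => y0 y1; have := sqr_ge0 y; lra.
  have h2 : 0 <= 2 * M / de ^+ 2 / n%:R by apply: divr_ge0 => //; apply: divr_ge0; [exact: mulr_ge0|exact: sqr_ge0].
  have := ler_wpM2l h2 h1; rewrite mulr1; lra.
have dn : (bern n (fun i => 0 + (-1) * (e / 2 + K * (i%:R - n%:R * y) ^+ 2))).[y] =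
   - (bern n (fun i => e / 2 + K * (i%:R - n%:R * y) ^+ 2)).[y].
  by rewrite bern_lin bern_cst mulN1r add0r.
rewrite -dec ler_norml; apply/andP; split.
- apply: (@le_trans _ _ (- (bern n (fun i => e / 2 + K * (i%:R - n%:R * y) ^+ 2)).[y])).
    by rewrite lerN2.
  rewrite -dn; apply: bern_le => // i h; rewrite add0r !mulN1r.
  by have := key i h; rewrite ler_norml => /andP[].
- apply: le_trans up; apply: bern_le => // i h; rewrite mulN1r.
  by have := key i h; rewrite ler_norml => /andP[].
Qed.

End Bernstein.

(** * Convergence of positive functionals *)

Section PositiveFunctionals.
Variable R : realType.
Implicit Types (f g h q : R -> R) (L : (R -> R) -> R).

(** What is kept of integration against a probability measure. Spectral measures and the semicircle
    law are given as functionals, and these three properties are all that the approximation argument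
    uses. *)
Definition posfun L : Prop :=
  [/\ forall c f g, continuous f -> continuous g ->
        L (fun x => c * f x + g x) = c * L f + L g,
      forall f g, continuous f -> continuous g -> (forall x, f x <= g x) -> L f <= L g &
      L (fun=> 1) = 1].

Lemma cst_cont (c : R) : continuous (fun _ : R => c).
Proof. by move=> x; exact: cvg_cst. Qed.

Lemma lin_cont c f g : continuous f -> continuous g -> continuous (fun x => c * f x + g x).
Proof. by move=> hf hg x; apply: cvgD; [apply: cvgM; [exact: cvg_cst|exact: hf]|exact: hg]. Qed.

Lemma mul_cont f g : continuous f -> continuous g -> continuous (fun x => f x * g x).
Proof. by move=> hf hg x; apply: cvgM; [exact: hf|exact: hg]. Qed.

Lemma add_cont f g : continuous f -> continuous g -> continuous (fun x => f x + g x).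
Proof. by move=> hf hg x; apply: cvgD; [exact: hf|exact: hg]. Qed.

Lemma exp_cont f n : continuous f -> continuous (fun x => f x ^+ n).
Proof.
move=> hf; elim: n => [|n IH]; first by under eq_fun do rewrite expr0; exact: cst_cont.
by under eq_fun do rewrite exprS; exact: mul_cont.
Qed.

Lemma posfun_cst L c : posfun L -> L (fun=> c) = c.
Proof.
move=> [lin _ one].
have -> : (fun=> c) = fun _ : R => (c - 1) * 1 + 1 by apply/funext => x; rewrite mulr1 subrK.
by rewrite (lin _ (fun=> 1) (fun=> 1)) ?one ?mulr1 ?subrK //; exact: cst_cont.
Qed.

Lemma posfun_dist L f g (e : R) : posfun L -> continuous f -> continuous g ->
  (forall x, `|f x - g x| <= e) -> `|L f - L g| <= e.
Proof.
move=> hL cf cg fg; have [lin mono _] := hL.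
have Le : L (fun x => (-1) * g x + f x) = L f - L g by rewrite lin // mulN1r addrC.
have c1 := lin_cont (c := -1) cg cf.
rewrite -Le ler_norml; apply/andP; split.
- rewrite -(posfun_cst (- e) hL); apply: mono => //; first exact: cst_cont.
  by move=> x; rewrite mulN1r addrC; have := fg x; rewrite ler_norml => /andP[].
- rewrite -(posfun_cst e hL); apply: mono => //; first exact: cst_cont.
  by move=> x; rewrite mulN1r addrC; have := fg x; rewrite ler_norml => /andP[].
Qed.

Section Convergence.
Variables (mu : nat -> (R -> R) -> R) (nu : (R -> R) -> R).
Hypothesis mu_pos : forall N, posfun (mu N).
Hypothesis nu_pos : posfun nu.

Definition cvg_on f := continuous f /\ ((fun N => mu N f) @ \oo --> nu f).

Lemma cvg_on_lin c f g : cvg_on f -> cvg_on g -> cvg_on (fun x => c * f x + g x).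
Proof.
move=> [cf hf] [cg hg]; split; first exact: lin_cont.
have [lin _ _] := nu_pos; rewrite lin //.
have -> : (fun N => mu N (fun x => c * f x + g x)) = fun N => c * mu N f + mu N g.
  by apply/funext => N; have [linN _ _] := mu_pos N; rewrite linN.
by apply: cvgD => //; apply: cvgM => //; exact: cvg_cst.
Qed.

Lemma cvg_on_cst c : cvg_on (fun=> c).
Proof.
split; first exact: cst_cont.
rewrite posfun_cst //; under eq_fun do rewrite posfun_cst //.
exact: cvg_cst.
Qed.

Lemma cvg_on_unif f : continuous f ->
  (forall e : R, 0 < e -> exists2 g, cvg_on g & forall x, `|f x - g x| <= e) -> cvg_on f.
Proof.
move=> cf h; split => //; apply/cvgrPdist_le => e e0.
have e30 : 0 < e / 3 by rewrite divr_gt0.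
have [g [cg hg] fg] := h _ e30.
move/cvgrPdist_le : hg => /(_ _ e30); apply: filterS => N hN.
have h1 := posfun_dist nu_pos cf cg fg.
have h2 := posfun_dist (mu_pos N) cf cg fg.
have -> : nu f - mu N f = (nu f - nu g) + (nu g - mu N g) - (mu N f - mu N g) by ring.
apply: le_trans (ler_normB _ _) _.
have := ler_normD (nu f - nu g) (nu g - mu N g); lra.
Qed.

Lemma eq_cvg_on f g : (forall x, f x = g x) -> cvg_on f -> cvg_on g.
Proof. by move=> fg; rewrite (funext fg). Qed.

Variables (s : R) (sn : nat -> R).
Hypothesis s0 : 0 < s.
Hypothesis sn_gt : forall n, s < sn n.
Hypothesis sn_cvg : sn @ \oo --> s.

Definition cauchyk (t x : R) : R := (x ^+ 2 + t)^-1.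
Local Notation phi := (cauchyk s).

Let den_gt0 (t x : R) : 0 < t -> 0 < x ^+ 2 + t.
Proof. by move=> t0; rewrite ltr_wpDl ?sqr_ge0. Qed.

Lemma cauchyk_cont (t : R) : 0 < t -> continuous (cauchyk t).
Proof.
have c : continuous (fun x : R => x ^+ 2 + t).
  by apply: add_cont; [apply: exp_cont => y; exact: cvg_id|exact: cst_cont].
by move=> t0 x; apply: cvgV; [rewrite gt_eqF // den_gt0|exact: c].
Qed.

Let sn0 n : 0 < sn n. Proof. exact: lt_trans (sn_gt n). Qed.

Lemma cauchyk_gt0 (t x : R) : 0 < t -> 0 < cauchyk t x.
Proof. by move=> t0; rewrite invr_gt0 den_gt0. Qed.

Lemma cauchyk_le (t x : R) : s <= t -> cauchyk t x <= s^-1.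
Proof.
move=> st; rewrite lef_pV2 ?posrE // ?den_gt0 ?(lt_le_trans s0 st) //.
by apply: le_trans st _; rewrite lerDr sqr_ge0.
Qed.

Let partial_fraction n x : phi x * cauchyk (sn n) x = (phi x - cauchyk (sn n) x) / (sn n - s).
Proof.
have h1 := den_gt0 x s0; have h2 := den_gt0 x (sn0 n).
by rewrite /cauchyk; field; rewrite !gt_eqF //= subr_gt0.
Qed.

Section Multiplier.
Variables (q : R -> R) (K : R).
Hypothesis cq : continuous q.
Hypothesis qK : forall x, `|q x * phi x| <= K.
Hypothesis q_cvg : forall n, cvg_on (fun x => q x * cauchyk (sn n) x).

Let K0 : 0 <= K. Proof. exact: le_trans (qK 0). Qed.

Let phi_cont := cauchyk_cont s0.

(* [cauchyk (sn n)] tends to [phi] uniformly, so one more factor [phi] can be reached although [phi]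
   itself is not among the test functions. *)
Lemma cvg_on_power_step p :
  (forall n, cvg_on (fun x => q x * phi x ^+ p * cauchyk (sn n) x)) ->
  cvg_on (fun x => q x * phi x ^+ p.+1).
Proof.
move=> h; apply: cvg_on_unif; first by apply: mul_cont => //; exact: exp_cont.
move=> e e0.
pose B := K * s^-1 ^+ p.+1 + 1.
have B0 : 0 < B by rewrite ltr_wpDl // mulr_ge0 // exprn_ge0 // invr_ge0 ltW.
have [n hn] : exists n, `|s - sn n| <= e / B.
  move/cvgrPdist_le : sn_cvg => /(_ (e / B)) /(_ (divr_gt0 e0 B0)) [n _ hn].
  by exists n; apply: hn => /=.
exists (fun x => q x * phi x ^+ p * cauchyk (sn n) x) => // x.
have h1 := den_gt0 x s0; have h2 := den_gt0 x (sn0 n).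
have -> : q x * phi x ^+ p.+1 - q x * phi x ^+ p * cauchyk (sn n) x =
   (q x * phi x) * (phi x ^+ p * cauchyk (sn n) x) * (sn n - s).
  rewrite exprS /cauchyk; field; rewrite !gt_eqF //.
rewrite normrM normrM distrC.
apply: le_trans (_ : B * (e / B) <= _); last by rewrite mulrC divfK // gt_eqF.
apply: ler_pM => //.
apply: (@le_trans _ _ (K * s^-1 ^+ p.+1)); last by rewrite lerDl.
apply: ler_pM => //.
have p1 := ltW (cauchyk_gt0 x s0); have p2 := ltW (cauchyk_gt0 x (sn0 n)).
rewrite ger0_norm; last by rewrite mulr_ge0 // exprn_ge0.
rewrite exprSr ler_pM ?exprn_ge0 //; last by rewrite cauchyk_le // ltW.
by apply: lerXn2r; rewrite ?nnegrE ?invr_ge0 ?(ltW h1) ?(ltW s0) ?cauchyk_le.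
Qed.

(* Partial fractions: [phi * cauchyk (sn n)] is a multiple of [phi - cauchyk (sn n)]. *)
Lemma cvg_on_power_mixed p n : cvg_on (fun x => q x * phi x ^+ p * cauchyk (sn n) x).
Proof.
elim: p n => [|p IH] n.
  by apply: eq_cvg_on (q_cvg n) => x; rewrite expr0 mulr1.
have snB : sn n - s != 0 by rewrite gt_eqF // subr_gt0.
apply: (@eq_cvg_on (fun x => (sn n - s)^-1 * (q x * phi x ^+ p.+1) +
   (- (sn n - s)^-1 * (q x * phi x ^+ p * cauchyk (sn n) x) + 0))).
  move=> x; rewrite [RHS](_ : _ = q x * phi x ^+ p * (phi x * cauchyk (sn n) x)).
    by rewrite partial_fraction exprS; field.
  by rewrite exprSr; ring.
apply: cvg_on_lin; first by apply: cvg_on_power_step => m; exact: IH.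
by apply: cvg_on_lin; [exact: IH|exact: cvg_on_cst].
Qed.

(** Applied with [q = 1] for even functions and with the identity for odd ones, where at least one
    factor [phi] keeps the product bounded. The exponent is general because multiplying [p] by the
    indeterminate raises it. *)
Lemma cvg_on_poly m (p : {poly R}) : cvg_on (fun x => q x * phi x ^+ m.+1 * p.[phi x]).
Proof.
elim/poly_ind: p m => [|p c IH] m.
  by apply: eq_cvg_on (cvg_on_cst 0) => x; rewrite horner0 mulr0.
apply: (@eq_cvg_on (fun x => c * (q x * phi x ^+ m.+1) + q x * phi x ^+ m.+2 * p.[phi x])).
  by move=> x; rewrite hornerMXaddC [phi x ^+ m.+2]exprSr; ring.
by apply: cvg_on_lin => //; apply: cvg_on_power_step => n; exact: cvg_on_power_mixed.
Qed.

End Multiplier.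

(* An even function supported in [-L, L] is a continuous function of [s * phi], which takes values
   in [0, 1]; the truncation [m] makes this function defined and continuous on the whole line. *)
Lemma even_approx h (L : R) : continuous h -> (forall x, h (- x) = h x) -> 0 < L ->
  (forall x, L <= `|x| -> h x = 0) ->
  forall e : R, 0 < e -> exists p : {poly R}, forall x, `|h x - p.[phi x]| <= e.
Proof.
move=> ch hev L0 hL e e0.
have L2 : 0 < L ^+ 2 + s by exact: den_gt0.
pose yL := s / (L ^+ 2 + s).
have yL0 : 0 < yL by rewrite divr_gt0.
pose m y := (y + yL + `|y - yL|) / 2.
have mE y : m y = Num.max y yL.
  rewrite /m; case: (leP y yL) => yyL.
    by rewrite ler0_norm ?subr_le0 //; field.
  by rewrite gtr0_norm ?subr_gt0 //; field.
(* If y = s / (x^2 + s), then |x| = sqrt (s / y - s), and [h] depends on |x| only. The threshold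
   [yL] is the value of y at |x| = L, beyond which [h] vanishes. *)
pose g y := h (Num.sqrt (s / m y - s)).
have cm : continuous m.
  move=> y; apply: cvgM; last exact: cvg_cst.
  apply: cvgD; first by apply: cvgD; [exact: cvg_id|exact: cvg_cst].
  by apply: cvg_norm; apply: cvgB; [exact: cvg_id|exact: cvg_cst].
have cg : continuous g.
  move=> y; rewrite /g.
  apply: (@continuous_comp _ _ _ (fun y => Num.sqrt (s / m y - s)) h); last exact: ch.
  apply: (@continuous_comp _ _ _ (fun y => s / m y - s) Num.sqrt); last exact: sqrt_continuous.
  apply: cvgB; last exact: cvg_cst.
  apply: cvgM; first exact: cvg_cst.
  apply: cvgV; last exact: cm.
  by rewrite mE gt_eqF // lt_max yL0 orbT.
have [p hp] := poly_approx01 cg e0.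
exists (p \Po (s *: 'X)) => x.
have y01 : 0 <= s * phi x <= 1.
  apply/andP; split; first by rewrite ltW // mulr_gt0 // cauchyk_gt0.
  by rewrite -(divff (lt0r_neq0 s0)) ler_pM2l // cauchyk_le.
have -> : (p \Po (s *: 'X)).[phi x] = p.[s * phi x] by rewrite horner_comp hornerZ hornerX.
have -> : h x = g (s * phi x); last exact: hp.
have x2 := den_gt0 x s0.
rewrite /g mE; have [xL|xL] := leP `|x| L.
  have -> : Num.max (s * phi x) yL = s * phi x.
    apply/max_idPl; rewrite /yL ler_pM2l // lef_pV2 ?posrE // lerD2r.
    by rewrite -real_normK ?num_real // lerXn2r ?nnegrE // ltW.
  have -> : s / (s * phi x) - s = x ^+ 2.
    by rewrite /cauchyk; field; rewrite !gt_eqF.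
  by rewrite sqrtr_sqr; case: (ger0P x) => _; rewrite ?hev.
have -> : Num.max (s * phi x) yL = yL.
  apply/max_idPr; rewrite /yL ler_pM2l // lef_pV2 ?posrE // lerD2r.
  by rewrite -[leRHS]real_normK ?num_real // lerXn2r ?nnegrE // ltW.
have -> : s / yL - s = L ^+ 2 by rewrite /yL; field; rewrite !gt_eqF.
by rewrite sqrtr_sqr gtr0_norm // hL ?(ltW xL) // hL // gtr0_norm.
Qed.

Hypothesis even_cvg : forall n, cvg_on (cauchyk (sn n)).
Hypothesis odd_cvg : forall n, cvg_on (fun x => x * cauchyk (sn n) x).

Let cid : continuous (fun x : R => x). Proof. by move=> x; exact: cvg_id. Qed.

Lemma cvg_on_even_poly (p : {poly R}) : cvg_on (fun x => p.[phi x]).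
Proof.
elim/poly_ind: p => [|p c _].
  by apply: eq_cvg_on (cvg_on_cst 0) => x; rewrite horner0.
apply: (@eq_cvg_on (fun x => 1 * (1 * phi x ^+ 1 * p.[phi x]) + c)).
  by move=> x; rewrite hornerMXaddC; ring.
apply: cvg_on_lin; last exact: cvg_on_cst.
apply: (@cvg_on_poly (fun=> 1) s^-1) => [|x|n].
- exact: cst_cont.
- by rewrite mul1r gtr0_norm ?cauchyk_gt0 // cauchyk_le.
- by apply: eq_cvg_on (even_cvg n) => x; rewrite mul1r.
Qed.

Let Kx := 1 + s^-1.

Let xphi x : `|x * phi x| <= Kx.
Proof.
have x2 := den_gt0 x s0.
rewrite normrM (gtr0_norm (cauchyk_gt0 x s0)) ler_pdivrMr // /Kx.
have -> : (1 + s^-1) * (x ^+ 2 + s) = x ^+ 2 + 1 + s + x ^+ 2 / s by field; rewrite gt_eqF.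
have : 0 <= x ^+ 2 / s by rewrite divr_ge0 ?sqr_ge0 // ltW.
have := sqr_ge0 (`|x| - 1); have := sqr_ge0 `|x|; have : `|x| ^+ 2 = x ^+ 2 by rewrite real_normK ?num_real.
have := s0; lra.
Qed.

Lemma cvg_on_even h (L : R) : continuous h -> (forall x, h (- x) = h x) -> 0 < L ->
  (forall x, L <= `|x| -> h x = 0) -> cvg_on h.
Proof.
move=> ch hev L0 hL; apply: cvg_on_unif => // e e0.
have [p hp] := even_approx ch hev L0 hL e0.
by exists (fun x => p.[phi x]) => //; exact: cvg_on_even_poly.
Qed.

(* [f] is uniformly close to [x ^+ 2 / (x ^+ 2 + t) * f x = x * phi x * h x] with [h] even and compactly
   supported, and [h] is uniformly close to a polynomial in [phi]. *)
Lemma cvg_on_odd f (L M : R) : continuous f -> (forall x, f (- x) = - f x) -> 0 < L ->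
  (forall x, L <= `|x| -> f x = 0) -> (forall x, `|f x| <= M) -> cvg_on f.
Proof.
move=> cf fodd L0 fL fM; apply: cvg_on_unif => // e e0.
have f00 : f 0 = 0 by have := fodd 0; rewrite oppr0 => h; lra.
have M0 : 0 <= M by exact: le_trans (fM 0).
have e20 : 0 < e / 2 by rewrite divr_gt0.
have [r r0 hr] : exists2 r, 0 < r & forall x, `|x| < r -> `|f x| <= e / 2.
  have := cf 0; move/cvgrPdist_le => /(_ _ e20) /nbhs_ballP[r /= r0 hr].
  exists r => // x xr; have := hr x; rewrite /ball /= f00 !sub0r !normrN; exact.
(* The error to control is |f x| t / (x^2 + t). For |x| < r the function itself is at most e / 2;
   for |x| >= r the quotient is at most t / r^2 = (e / 2) / (M + 1). *)
have [t tE] : exists t, t = e / 2 * r ^+ 2 / (M + 1) by eexists.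
have M10 : 0 < M + 1 by rewrite ltr_wpDl.
have t0 : 0 < t by rewrite tE divr_gt0 // mulr_gt0 // exprn_gt0.
pose h x := f x * (x * (x ^+ 2 + s) * cauchyk t x).
have ch : continuous h.
  apply: mul_cont => //; apply: mul_cont; last exact: cauchyk_cont.
  apply: mul_cont => //; apply: add_cont; [exact: exp_cont|exact: cst_cont].
have hev x : h (- x) = h x by rewrite /h /cauchyk fodd sqrrN; ring.
have hL x : L <= `|x| -> h x = 0 by move=> Lx; rewrite /h fL // mul0r.
have Kx0 : 0 < Kx by rewrite addr_gt0 // invr_gt0.
have [p hp] := even_approx ch hev L0 hL (divr_gt0 e20 Kx0).
exists (fun x => x * phi x ^+ 1 * p.[phi x]).
  by apply: (cvg_on_poly (K := Kx)).
move=> x; rewrite expr1.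
have x2 := den_gt0 x s0; have xt := den_gt0 x t0.
have -> : f x - x * phi x * p.[phi x] = f x * (t * cauchyk t x) + x * phi x * (h x - p.[phi x]).
  by rewrite /h /cauchyk; field; rewrite !gt_eqF.
apply: le_trans (ler_normD _ _) _; rewrite [e]splitr; apply: lerD; last first.
  rewrite normrM; apply: le_trans (ler_pM _ _ (xphi x) (hp x)) _ => //.
  by rewrite mulrC divfK // gt_eqF.
rewrite normrM [`|t * _|]gtr0_norm ?mulr_gt0 ?cauchyk_gt0 //.
have [xr|rx] := ltP `|x| r.
  rewrite -[leRHS]mulr1; apply: ler_pM => //; first by rewrite mulr_ge0 // ltW // cauchyk_gt0.
    exact: hr.
  by rewrite ler_pdivrMr // mul1r lerDr sqr_ge0.
apply: (@le_trans _ _ ((M + 1) * (t / r ^+ 2))).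
  apply: ler_pM => //; first by rewrite mulr_ge0 // ltW // cauchyk_gt0.
    by apply: le_trans (fM x) _; rewrite lerDl.
  rewrite ler_pM2l // lef_pV2 ?posrE ?exprn_gt0 //.
  apply: (@le_trans _ _ (x ^+ 2)); last by rewrite lerDl ltW.
  by rewrite -[leRHS]real_normK ?num_real // lerXn2r ?nnegrE // ltW.
rewrite le_eqVlt; apply/orP; left; apply/eqP; rewrite tE; field.
by rewrite !gt_eqF.
Qed.

Lemma cvg_on_compact f (L M : R) : continuous f -> 0 < L ->
  (forall x, L <= `|x| -> f x = 0) -> (forall x, `|f x| <= M) -> cvg_on f.
Proof.
move=> cf L0 fL fM.
have cN : continuous (fun x => f (- x)).
  by move=> x; apply: (@continuous_comp _ _ _ (fun x => - x) f); [exact: opp_continuous|exact: cf].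
have half g : continuous g -> continuous (fun x => 2^-1 * g x).
  by move=> cg; apply: mul_cont => //; exact: cst_cont.
apply: (@eq_cvg_on (fun x => 1 * (2^-1 * (1 * f x + f (- x))) + 2^-1 * ((-1) * f (- x) + f x))).
  by move=> x; field.
apply: cvg_on_lin.
  apply: (@cvg_on_even _ L) => //; first by apply: half; exact: lin_cont.
    by move=> x; rewrite opprK; ring.
  by move=> x Lx; rewrite !fL ?normrN // mulr0 addr0 mulr0.
apply: (@cvg_on_odd _ L M) => //; first by apply: half; exact: lin_cont.
- by move=> x; rewrite opprK; ring.
- by move=> x Lx; rewrite !fL ?normrN // mulr0 addr0 mulr0.
- move=> x; have := fM x; have := fM (- x); rewrite !ler_norml => /andP[? ?] /andP[? ?].
  by apply/andP; split; lra.
Qed.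

Variable r : R.
Hypothesis r0 : 0 <= r.
Hypothesis nu_supp : forall f, continuous f -> (forall x, `|x| <= r -> f x = 0) -> nu f = 0.

(* No mass escapes to infinity: for a cutoff [chi] equal to 1 on [-r, r], mu N (1 - chi) tends to 0. *)
Lemma cvg_on_bounded f (M : R) : continuous f -> (forall x, `|f x| <= M) -> cvg_on f.
Proof.
move=> cf fM; have M0 : 0 <= M by exact: le_trans (fM 0).
have cabs : continuous (fun x : R => `|x|) by move=> x; apply: cvg_norm; exact: cvg_id.
pose clamp (y : R) : R := (1 + `|y| - `|y - 1|) / 2.
have clampE y : clamp y = if y <= 0 then 0 else if y <= 1 then y else 1.
  rewrite /clamp; case: (leP y 0) => y0.
    by rewrite ler0_norm // ler0_norm; [field|lra].
  rewrite (gtr0_norm y0); case: (leP y 1) => y1.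
    by rewrite ler0_norm; [field|lra].
  by rewrite gtr0_norm; [field|lra].
pose chi (x : R) : R := clamp (r + 2 - `|x|).
have cchi : continuous chi.
  move=> x; apply: (@continuous_comp _ _ _ (fun x => r + 2 - `|x|) clamp).
    by apply: cvgB; [exact: cvg_cst|exact: cabs].
  apply: cvgM; last exact: cvg_cst.
  apply: cvgB; first by apply: cvgD; [exact: cvg_cst|exact: cabs].
  by apply: cvg_norm; apply: cvgB; [exact: cvg_id|exact: cvg_cst].
have chi01 x : 0 <= chi x <= 1.
  rewrite /chi clampE; case: (leP (r + 2 - `|x|) 0) => h1; last case: (leP (r + 2 - `|x|) 1) => h2;
    by apply/andP; split; lra.
have chi0 x : r + 2 <= `|x| -> chi x = 0.
  by move=> h; rewrite /chi clampE; case: (leP (r + 2 - `|x|) 0) => // h1; lra.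
have chi1 x : `|x| <= r -> 1 - chi x = 0.
  by move=> h; rewrite /chi clampE; case: (leP (r + 2 - `|x|) 0) => h1;
    [|case: (leP (r + 2 - `|x|) 1) => h2]; lra.
have r0' := r0; have L0 : 0 < r + 2 by lra.
have V1 : cvg_on (fun x => f x * chi x).
  apply: (@cvg_on_compact _ (r + 2) M) => //; first exact: mul_cont.
    by move=> x h; rewrite chi0 // mulr0.
  move=> x; have /andP[h1 h2] := chi01 x.
  by rewrite normrM (ger0_norm h1) -[leRHS]mulr1 ler_pM.
have Vchi : cvg_on chi.
  apply: (@cvg_on_compact _ (r + 2) 1) => // x.
  by have /andP[h1 h2] := chi01 x; rewrite ger0_norm.
have V2 : cvg_on (fun x => (-1) * chi x + 1) by apply: cvg_on_lin => //; exact: cvg_on_cst.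
have c1 : continuous (fun x => (-1) * chi x + 1) by apply: lin_cont => //; exact: cst_cont.
have V3 : cvg_on (fun x => f x * ((-1) * chi x + 1)).
  have c3 : continuous (fun x => f x * ((-1) * chi x + 1)) by exact: mul_cont.
  split => //; rewrite nu_supp //; last first.
    by move=> x h; rewrite mulN1r addrC chi1 // mulr0.
  have n1 : nu (fun x => (-1) * chi x + 1) = 0.
    by apply: nu_supp => // x h; rewrite mulN1r addrC chi1.
  have [_] := V2; rewrite n1 => cv.
  have bnd N : `|mu N (fun x => f x * ((-1) * chi x + 1))| <= M * mu N (fun x => (-1) * chi x + 1).
    have [lin mono _] := mu_pos N.
    have E (b : R) : b * mu N (fun x => (-1) * chi x + 1) = mu N (fun x => b * ((-1) * chi x + 1) + 0).
      by rewrite lin ?posfun_cst ?addr0 //; exact: cst_cont.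
    have cE (b : R) : continuous (fun x => b * ((-1) * chi x + 1) + 0) by apply: lin_cont => //; exact: cst_cont.
    rewrite ler_norml -mulNr !E; apply/andP; split; apply: mono => // x;
      have /andP[h1 h2] := chi01 x; rewrite addr0 ler_wpM2r //; try lra;
      by have := fM x; rewrite ler_norml => /andP[].
  apply/cvgrPdist_le => e e0.
  have M1 : 0 < M + 1 by lra.
  move/cvgrPdist_le : cv => /(_ (e / (M + 1)) (divr_gt0 e0 M1)); apply: filterS => N.
  rewrite !sub0r !normrN => h; apply: le_trans (bnd N) _.
  apply: le_trans (ler_wpM2l M0 (le_trans (ler_norm _) h)) _.
  by rewrite mulrCA ler_piMr ?ltW // ltr_pdivrMr // mul1r ltrDl.
apply: eq_cvg_on (cvg_on_lin 1 V1 V3) => x; ring.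
Qed.

End Convergence.
End PositiveFunctionals.

(** * The semicircle law *)

Section SemicircleIntegral.
Variable R : realType.
Local Notation mu := (@lebesgue_measure R).

(** Continuity up to the endpoints, obtained for the inverse of the sine on a segment. The
    antiderivatives below are not differentiable at the endpoints, and [FTC_within] asks there for
    continuity only. *)
Lemma asin_within : {within `[-1, 1], continuous (@asin R)}.
Proof.
have h : - (pi / 2) <= pi / 2 :> R.
  by have := pi_ge0 R; lra.
have := @segment_can_le_continuous R _ _ (@sin R) (@asin R) h.
rewrite sinN sin_pihalf; apply.
- by apply: continuous_subspaceT; exact: continuous_sin.
- exact: sinK.
Qed.

Lemma asin_comp_within (u : R -> R) a b : continuous u ->
  (forall x, a <= x <= b -> -1 <= u x <= 1) ->
  {within `[a, b], continuous (fun x => asin (u x))}.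
Proof.
move=> cu hu; apply/subspace_continuousP => x xab.
have ux : `[-1, 1]%classic (u x) by have := hu x; rewrite /= !in_itv /=; apply.
have := (subspace_continuousP _ (@asin R)).1 asin_within _ ux.
move=> ha; apply/cvgrPdist_lt => e e0; move/cvgrPdist_lt : ha => /(_ e e0).
rewrite !near_withinE => hS; have hx := cu x _ hS.
near=> y => yab.
have hy : `[-1, 1]%classic (u y) -> `|asin (u x) - asin (u y)| < e by near: y; exact: hx.
by apply: hy; have := hu y; move: yab; rewrite /= !in_itv /= => yab; apply.
Unshelve. all: by end_near. Qed.

Lemma FTC_within (f F : R -> R) a b : a < b ->
  {within `[a, b], continuous f} -> {within `[a, b], continuous F} ->
  (forall x, a < x < b -> is_derive x 1 F (f x)) ->
  Rintegral mu `[a, b] f = F b - F a.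
Proof.
move=> ab cf cF dF.
have [_ ca cb] := (continuous_within_itvP F ab).1 cF.
have h : derivable_oo_LRcontinuous F a b.
  by split=> // x; rewrite in_itv /= => /dF [].
rewrite /Rintegral (continuous_FTC2 ab cf h) // => x; rewrite in_itv /= => /dF hx.
by rewrite derive1E; apply: derive_val.
Qed.

Variable r : R.
Hypothesis r0 : 0 < r.

Let rN : - r < r. Proof. have := r0; lra. Qed.

Lemma sqrt_semicircle_cont : continuous (fun x : R => Num.sqrt (r ^+ 2 - x ^+ 2)).
Proof.
have c : continuous (fun x : R => r ^+ 2 - x ^+ 2).
  by move=> x; apply: cvgB; [exact: cvg_cst|apply: exp_cont => y; exact: cvg_id].
by move=> x; apply: (continuous_comp (c x)); exact: sqrt_continuous.
Qed.

Lemma semicircle_integrable (f : R -> R) : continuous f -> mu.-integrable `[- r, r] (EFin \o f).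
Proof.
move=> cf; apply: continuous_compact_integrable; first exact: segment_compact.
exact: continuous_subspaceT.
Qed.

Lemma asin1 : asin 1 = pi / 2 :> R.
Proof.
rewrite -[X in asin X](@sin_pihalf R) sinK // in_itv /=.
by have := pi_ge0 R; move=> h; apply/andP; split; lra.
Qed.

Lemma asinN1 : asin (- 1) = - (pi / 2) :> R.
Proof.
rewrite (_ : -1 = sin (- (pi / 2)) :> R); last by rewrite sinN sin_pihalf.
rewrite sinK // in_itv /=.
by have := pi_ge0 R; move=> h; apply/andP; split; lra.
Qed.

Let sq_lt x : - r < x < r -> 0 < r ^+ 2 - x ^+ 2.
Proof. by move=> /andP[h1 h2]; rewrite subr_sqr mulr_gt0 //; lra. Qed.

Lemma is_deriveD_fun (f g : R -> R) (x p q : R) : is_derive x 1 f p -> is_derive x 1 g q ->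
  is_derive x 1 (fun y => f y + g y) (p + q).
Proof. exact: is_deriveD. Qed.

Lemma is_deriveM_fun (f g : R -> R) (x p q : R) : is_derive x 1 f p -> is_derive x 1 g q ->
  is_derive x 1 (fun y => f y * g y) (f x * q + g x * p).
Proof. exact: is_deriveM. Qed.

Lemma is_deriveZ_fun (f : R -> R) (c x p : R) : is_derive x 1 f p ->
  is_derive x 1 (fun y => c * f y) (c * p).
Proof. exact: is_deriveZ. Qed.

Lemma is_derive_comp_fun (f g : R -> R) (x p q : R) : is_derive (g x) 1 f p ->
  is_derive x 1 g q -> is_derive x 1 (fun y => f (g y)) (p * q).
Proof. exact: is_derive1_comp. Qed.

Lemma is_derive_sqr (x : R) : is_derive x 1 (fun y => y ^+ 2) (2 * x).
Proof.
have h := is_deriveM_fun (is_derive_id x 1) (is_derive_id x 1).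
rewrite (_ : (fun y : R => y ^+ 2) = fun y => id y * id y); last by apply/funext => y; rewrite expr2.
by apply: (is_derive_eq h); rewrite /=; ring.
Qed.

Let dw x : - r < x < r ->
  is_derive x 1 (fun y => Num.sqrt (r ^+ 2 - y ^+ 2)) (- x / Num.sqrt (r ^+ 2 - x ^+ 2)).
Proof.
move=> hx; have w0 := sq_lt hx.
have w1 : Num.sqrt (r ^+ 2 - x ^+ 2) != 0 by rewrite gt_eqF // sqrtr_gt0.
have d1 := is_derive1_sqrt w0.
have d2 := is_deriveD_fun (is_derive_cst (r ^+ 2) x 1) (is_deriveZ_fun (-1) (is_derive_sqr x)).
have -> : (fun y => Num.sqrt (r ^+ 2 - y ^+ 2)) = fun y => Num.sqrt (r ^+ 2 + -1 * y ^+ 2).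
  by apply/funext => y; rewrite mulN1r.
have d1' : is_derive (r ^+ 2 + -1 * x ^+ 2) 1 Num.sqrt (2 * Num.sqrt (r ^+ 2 - x ^+ 2))^-1.
  by rewrite mulN1r.
apply: (is_derive_eq (@is_derive_comp_fun Num.sqrt (fun y => r ^+ 2 + -1 * y ^+ 2) x _ _ d1' d2)).
by rewrite add0r; field.
Qed.

Let dasin x : - r < x < r ->
  is_derive x 1 (fun y => asin (y / r)) (Num.sqrt (r ^+ 2 - x ^+ 2))^-1.
Proof.
move=> hx; have w0 := sq_lt hx.
have h1 : -1 < x / r < 1.
  by case/andP: hx => h1 h2; rewrite ltr_pdivlMr // ltr_pdivrMr //; apply/andP; split; lra.
have d2 := is_deriveZ_fun (r^-1) (is_derive_id x 1).
have -> : (fun y => asin (y / r)) = fun y => asin (r^-1 * y).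
  by apply/funext => y; rewrite mulrC.
have d1 : is_derive (r^-1 * x) 1 (@asin R) (Num.sqrt (1 - (x / r) ^+ 2))^-1.
  by rewrite mulrC; exact: is_derive1_asin h1.
apply: (is_derive_eq (@is_derive_comp_fun (@asin R) (fun y => r^-1 * y) x _ _ d1 d2)).
have w1 : Num.sqrt (r ^+ 2 - x ^+ 2) != 0 by rewrite gt_eqF // sqrtr_gt0.
have -> : Num.sqrt (1 - (x / r) ^+ 2) = Num.sqrt (r ^+ 2 - x ^+ 2) / r.
  have -> : 1 - (x / r) ^+ 2 = (Num.sqrt (r ^+ 2 - x ^+ 2) / r) ^+ 2.
    by rewrite [RHS]exprMn sqr_sqrtr ?ltW //; field; rewrite gt_eqF.
  by rewrite sqrtr_sqr ger0_norm // divr_ge0 ?sqrtr_ge0 // ltW.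
by rewrite mulr1; field; rewrite w1 gt_eqF.
Qed.

Let asin_r_within : {within `[- r, r], continuous (fun x => asin (x / r))}.
Proof.
apply: asin_comp_within; first by apply: mul_cont; [move=> x; exact: cvg_id|exact: cst_cont].
move=> x /andP[h1 h2]; rewrite ler_pdivlMr // ler_pdivrMr //; apply/andP; split; lra.
Qed.

Lemma within_add (A : set R) (f g : R -> R) : {within A, continuous f} ->
  {within A, continuous g} -> {within A, continuous (fun x => f x + g x)}.
Proof. by move=> hf hg x; apply: cvgD; [exact: hf|exact: hg]. Qed.

Lemma within_scale (A : set R) (f : R -> R) (c : R) : {within A, continuous f} ->
  {within A, continuous (fun x => c * f x)}.
Proof. by move=> hf x; apply: cvgM; [exact: cvg_cst|exact: hf]. Qed.

Lemma semicircle_area : Rintegral mu `[- r, r] (fun x => Num.sqrt (r ^+ 2 - x ^+ 2)) = pi * r ^+ 2 / 2.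
Proof.
have cid : continuous (fun x : R => x) by move=> x; exact: cvg_id.
pose F x := 2^-1 * (x * Num.sqrt (r ^+ 2 - x ^+ 2)) + (r ^+ 2 / 2) * asin (x / r).
transitivity (F r - F (- r)); last first.
  by rewrite /F sqrrN subrr sqrtr0 !mulr0 !add0r mulNr divff ?gt_eqF // asin1 asinN1; field.
apply: FTC_within => //.
- exact/continuous_subspaceT/sqrt_semicircle_cont.
- apply: within_add; apply: within_scale => //.
  by apply/continuous_subspaceT/mul_cont => //; exact: sqrt_semicircle_cont.
- move=> x hx; have w0 := sq_lt hx.
  have w1 : Num.sqrt (r ^+ 2 - x ^+ 2) != 0 by rewrite gt_eqF // sqrtr_gt0.
  have := is_deriveD_fun
    (is_deriveZ_fun 2^-1 (is_deriveM_fun (is_derive_id x 1) (dw hx)))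
    (is_deriveZ_fun (r ^+ 2 / 2) (dasin hx)).
  move=> h; apply: (is_derive_eq h).
  have : Num.sqrt (r ^+ 2 - x ^+ 2) ^+ 2 = r ^+ 2 - x ^+ 2 by rewrite sqr_sqrtr ?ltW.
  move: (Num.sqrt _) w1 => w w1 w2 /=.
  have -> : r ^+ 2 = w ^+ 2 + x ^+ 2 by rewrite w2 subrK.
  by field.
Qed.

Lemma semicircle_cauchy (eta : R) : 0 < eta ->
  Rintegral mu `[- r, r] (fun x => eta / (x ^+ 2 + eta ^+ 2) * Num.sqrt (r ^+ 2 - x ^+ 2)) =
  pi * (Num.sqrt (r ^+ 2 + eta ^+ 2) - eta).
Proof.
move=> eta0.
have cid : continuous (fun x : R => x) by move=> x; exact: cvg_id.
have [S SE] : exists S, S = Num.sqrt (r ^+ 2 + eta ^+ 2) by eexists.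
have S0 : 0 < S by rewrite SE sqrtr_gt0 addr_gt0 ?exprn_gt0.
have S2 : S ^+ 2 = r ^+ 2 + eta ^+ 2 by rewrite SE sqr_sqrtr // addr_ge0 ?sqr_ge0.
rewrite -SE.
have den0 x : 0 < x ^+ 2 + eta ^+ 2 by rewrite ltr_wpDl ?sqr_ge0 // exprn_gt0.
pose m x := Num.sqrt (x ^+ 2 + eta ^+ 2).
have m0 x : 0 < m x by rewrite sqrtr_gt0.
have m2 x : m x ^+ 2 = x ^+ 2 + eta ^+ 2 by rewrite sqr_sqrtr // ltW.
have cm : continuous m.
  have c : continuous (fun x : R => x ^+ 2 + eta ^+ 2).
    by apply: add_cont; [exact: exp_cont|exact: cst_cont].
  by move=> x; apply: (continuous_comp (c x)); exact: sqrt_continuous.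
pose u x := S / r * (x * (m x)^-1).
have cu : continuous u.
  apply: mul_cont; first exact: cst_cont.
  by apply: mul_cont => // x; apply: cvgV; [rewrite gt_eqF|exact: cm].
have u2 x : 1 - u x ^+ 2 = (eta / (r * m x)) ^+ 2 * (r ^+ 2 - x ^+ 2).
  have -> : u x ^+ 2 = S ^+ 2 * x ^+ 2 / (r ^+ 2 * m x ^+ 2).
    by rewrite /u; field; rewrite !gt_eqF.
  have -> : (eta / (r * m x)) ^+ 2 = eta ^+ 2 / (r ^+ 2 * m x ^+ 2).
    by field; rewrite !gt_eqF.
  by rewrite S2 m2; field; rewrite !gt_eqF.
have u01 x : - r <= x <= r -> -1 <= u x <= 1.
  move=> /andP[h1 h2]; rewrite -ler_norml -(@ler_pXn2r _ 2) ?nnegrE // expr1n.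
  rewrite real_normK ?num_real // -subr_ge0 u2 mulr_ge0 ?sqr_ge0 //.
  by rewrite subr_sqr mulr_ge0; lra.
have uE : u r = 1.
  have mE : m r = S by rewrite SE.
  by rewrite /u mE; field; rewrite !gt_eqF.
have uNE : u (- r) = -1.
  have -> : u (- r) = - u r by rewrite /u /m sqrrN mulNr mulrN.
  by rewrite uE.
(* Write w for the root of r^2 - x^2. As w^2 = S^2 - (x^2 + eta^2), the integrand is - eta / w + eta
   S^2 / (w (x^2 + eta^2)). The second term integrates to S arctan (S x / (eta w)), expressed
   through the arcsine to remain continuous at the endpoints, where w = 0. *)
pose F x := - eta * asin (x / r) + S * asin (u x).
transitivity (F r - F (- r)); last first.
  by rewrite /F uE uNE (mulNr r) divff ?gt_eqF // asin1 asinN1; field.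
apply: FTC_within => //.
- apply: continuous_subspaceT; apply: mul_cont; last exact: sqrt_semicircle_cont.
  apply: mul_cont; first exact: cst_cont.
  have c : continuous (fun x : R => x ^+ 2 + eta ^+ 2).
    by apply: add_cont; [exact: exp_cont|exact: cst_cont].
  by move=> x; apply: cvgV; [rewrite gt_eqF|exact: c].
- apply: within_add; apply: within_scale => //.
  exact: asin_comp_within.
- move=> x hx; have w0 := sq_lt hx.
  have w1 : 0 < Num.sqrt (r ^+ 2 - x ^+ 2) by rewrite sqrtr_gt0.
  have w2 : Num.sqrt (r ^+ 2 - x ^+ 2) ^+ 2 = r ^+ 2 - x ^+ 2 by rewrite sqr_sqrtr ?ltW.
  have sE : Num.sqrt (1 - u x ^+ 2) = eta / (r * m x) * Num.sqrt (r ^+ 2 - x ^+ 2).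
    have e0 : 0 <= eta / (r * m x) by rewrite ltW // divr_gt0 // mulr_gt0.
    by rewrite u2 sqrtrM ?sqr_ge0 // sqrtr_sqr ger0_norm.
  have ux : -1 < u x < 1.
    rewrite -ltr_norml -(@ltr_pXn2r _ 2) ?nnegrE // expr1n.
    rewrite real_normK ?num_real // -subr_gt0 u2 mulr_gt0 // exprn_gt0 //.
    by rewrite divr_gt0 // mulr_gt0.
  have dm : is_derive x 1 m (x / m x).
    have d2 := is_deriveD_fun (is_derive_sqr x) (is_derive_cst (eta ^+ 2) x 1).
    apply: (is_derive_eq (@is_derive_comp_fun Num.sqrt (fun y => y ^+ 2 + eta ^+ 2) x _ _ (is_derive1_sqrt (den0 x)) d2)).
    by rewrite -/(m x) addr0; field; rewrite gt_eqF.
  have dV : is_derive x 1 (fun y => (m y)^-1) (- (x / m x) / m x ^+ 2).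
    apply: (is_derive_eq (is_deriveV _ dm)); first by rewrite gt_eqF.
    by rewrite /GRing.scale /=; field; rewrite gt_eqF.
  have du := is_deriveZ_fun (S / r) (is_deriveM_fun (is_derive_id x 1) dV).
  have da := @is_derive_comp_fun (@asin R) u x _ _ (is_derive1_asin ux) du.
  have h := is_deriveD_fun (is_deriveZ_fun (- eta) (dasin hx)) (is_deriveZ_fun S da).
  apply: (is_derive_eq h).
  rewrite sE /=; move: (Num.sqrt _) w1 w2 => w w1 w2.
  have := m0 x; have := m2 x; move: (m x) => y y2 y0.
  have -> : x ^+ 2 + eta ^+ 2 = y ^+ 2 by [].
  transitivity (eta * (S ^+ 2 - y ^+ 2) / (w * y ^+ 2)).
    transitivity (- eta / w + S ^+ 2 * (y ^+ 2 - x ^+ 2) / (eta * w * y ^+ 2)).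
      by field; rewrite !gt_eqF.
    have -> : y ^+ 2 - x ^+ 2 = eta ^+ 2 by rewrite y2 addrAC subrr add0r.
    by field; rewrite !gt_eqF.
  have -> : S ^+ 2 - y ^+ 2 = w ^+ 2 by rewrite S2 y2 w2; ring.
  by field; rewrite !gt_eqF.
Qed.

Lemma semicircle_odd (f : R -> R) : continuous f -> (forall x, f (- x) = - f x) ->
  Rintegral mu `[- r, r] f = 0.
Proof.
move=> cf fo.
have h := @integration_by_substitution_oppr R f (- r) r (ltW rN).
rewrite opprK in h; have {}h := h (continuous_subspaceT cf).
have E : Rintegral mu `[- r, r] f = Rintegral mu `[- r, r] (fun x => -1 * f x).
  rewrite /Rintegral h; congr fine; apply: eq_integral => x _.
  by rewrite /= fo mulN1r.
rewrite RintegralZl // in E; last exact: semicircle_integrable.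
by move: E; move: (Rintegral _ _ _) => I; lra.
Qed.

End SemicircleIntegral.

Section SemicircleFunctional.
Variables (R : realType) (r : R).
Hypothesis r_ge0 : 0 <= r.
Local Notation mu := (@lebesgue_measure R).
Local Notation w x := (Num.sqrt (r ^+ 2 - x ^+ 2)).

Lemma semicircle_integralE (f : R -> R) : r != 0 -> continuous f ->
  semicircle_integral r f = 2 / (pi * r ^+ 2) * Rintegral mu `[- r, r] (fun x => f x * w x).
Proof.
move=> r0 cf; rewrite /semicircle_integral (negbTE r0) -RintegralZl //.
  by apply: eq_Rintegral => x _; rewrite mulrCA.
by apply: semicircle_integrable; apply: mul_cont => //; exact: sqrt_semicircle_cont.
Qed.

Lemma posfun_semicircle : posfun (semicircle_integral r).
Proof.
(* Radius 0 occurs for k = 1, where the limit is the point mass at 0. *)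
case: (eqVneq r 0) => [->|r0]; first by rewrite /semicircle_integral eqxx; split.
have r_gt0 : 0 < r by rewrite lt_neqAle eq_sym r0.
have int (f : R -> R) : continuous f -> mu.-integrable `[- r, r] (EFin \o (fun x => f x * w x)).
  by move=> cf; apply: semicircle_integrable; apply: mul_cont => //; exact: sqrt_semicircle_cont.
have d0 : 0 < pi * r ^+ 2 by rewrite mulr_gt0 ?pi_gt0 // exprn_gt0.
split.
- move=> c f g cf cg; rewrite !semicircle_integralE //; last exact: lin_cont.
  rewrite [c * _]mulrCA -[RHS]mulrDr; congr (_ * _).
  rewrite -RintegralZl ?int // -RintegralD //; last 2 first.
  + have -> : (fun x => c * (f x * w x)) = fun x => (c * f x) * w x.
      by apply/funext => x; rewrite mulrA.
    by apply: (int (fun x => c * f x)); apply: mul_cont => //; exact: cst_cont.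
  + exact: int.
  by apply: eq_Rintegral => x _; rewrite mulrDl mulrA.
- move=> f g cf cg fg; rewrite !semicircle_integralE // ler_pM2l ?divr_gt0 //.
  apply: le_Rintegral => //; [exact: int|exact: int|] => x _.
  by rewrite ler_wpM2r ?sqrtr_ge0.
- rewrite semicircle_integralE //; last exact: cst_cont.
  under eq_Rintegral do rewrite mul1r.
  have p0 : pi != 0 :> R by rewrite gt_eqF // pi_gt0.
  rewrite semicircle_area //; move: pi p0 => p p0.
  by field; rewrite r0 p0.
Qed.

Lemma semicircle_support (f : R -> R) : continuous f -> (forall x, `|x| <= r -> f x = 0) ->
  semicircle_integral r f = 0.
Proof.
move=> cf f0; case: (eqVneq r 0) => [r0|r0].
  by rewrite /semicircle_integral r0 eqxx f0 // normr0.
rewrite semicircle_integralE // -[RHS](mulr0 (2 / (pi * r ^+ 2))); congr (_ * _).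
rewrite -[RHS](@mul0r _ (Rintegral mu `[- r, r] (cst 1))) -RintegralZl //.
  apply: eq_Rintegral => x; rewrite inE /= in_itv /= -ler_norml => /f0 ->.
  by rewrite !mul0r.
by apply: semicircle_integrable; exact: cst_cont.
Qed.

(** The integral gives 2 (S - eta) / r^2 with S^2 = r^2 + eta^2; in the rationalized form 2 / (eta +
    S) the value is also correct for r = 0. *)
Lemma semicircle_cauchy_even (eta : R) : 0 < eta ->
  semicircle_integral r (fun x => eta / (x ^+ 2 + eta ^+ 2)) =
  2 / (eta + Num.sqrt (r ^+ 2 + eta ^+ 2)).
Proof.
move=> eta0; case: (eqVneq r 0) => [->|r0].
  rewrite /semicircle_integral eqxx expr0n /= !add0r sqrtr_sqr gtr0_norm //.
  by field; rewrite -mulr2n mulrn_eq0 /= gt_eqF.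
have r_gt0 : 0 < r by rewrite lt_neqAle eq_sym r0.
rewrite semicircle_integralE ?semicircle_cauchy //; last first.
  apply: mul_cont; first exact: cst_cont.
  have c : continuous (fun x : R => x ^+ 2 + eta ^+ 2).
    by apply: add_cont; [apply: exp_cont => x; exact: cvg_id|exact: cst_cont].
  by move=> x; apply: cvgV; [rewrite gt_eqF // ltr_wpDl ?sqr_ge0 ?exprn_gt0|exact: c].
have S0 : 0 < Num.sqrt (r ^+ 2 + eta ^+ 2) by rewrite sqrtr_gt0 addr_gt0 ?exprn_gt0.
have S2 : Num.sqrt (r ^+ 2 + eta ^+ 2) ^+ 2 = r ^+ 2 + eta ^+ 2.
  by rewrite sqr_sqrtr // addr_ge0 ?sqr_ge0.
move: (Num.sqrt _) S0 S2 => S S0 S2.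
have p0 : pi != 0 :> R by rewrite gt_eqF // pi_gt0.
move: pi p0 => p p0; apply: (mulIf (x := (eta + S) * r ^+ 2)).
  by rewrite mulf_neq0 ?expf_neq0 // gt_eqF // addr_gt0.
transitivity (2 * (S ^+ 2 - eta ^+ 2)).
  by field; rewrite r0 p0.
by rewrite S2 addrK; field; rewrite gt_eqF // addr_gt0.
Qed.

Lemma semicircle_cauchy_odd (eta : R) : 0 < eta ->
  semicircle_integral r (fun x => x / (x ^+ 2 + eta ^+ 2)) = 0.
Proof.
move=> eta0; case: (eqVneq r 0) => [->|r0].
  by rewrite /semicircle_integral eqxx mul0r.
have r_gt0 : 0 < r by rewrite lt_neqAle eq_sym r0.
have cf : continuous (fun x : R => x / (x ^+ 2 + eta ^+ 2)).
  apply: mul_cont; first by move=> x; exact: cvg_id.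
  have c : continuous (fun x : R => x ^+ 2 + eta ^+ 2).
    by apply: add_cont; [apply: exp_cont => x; exact: cvg_id|exact: cst_cont].
  by move=> x; apply: cvgV; [rewrite gt_eqF // ltr_wpDl ?sqr_ge0 ?exprn_gt0|exact: c].
rewrite semicircle_integralE // semicircle_odd ?mulr0 //.
  by apply: mul_cont => //; exact: sqrt_semicircle_cont.
by move=> x; rewrite sqrrN !mulNr.
Qed.

End SemicircleFunctional.

Lemma posfun_esm (R : realType) N (A : 'M[R]_N) : (0 < N)%N -> A^T = A -> posfun (esm_integral A).
Proof.
move=> N0 As; have [l [fE _]] := esm_integral_spectrum As.
have Ni : 0 < (N%:R : R) by rewrite ltr0n.
split.
- move=> c f g _ _; rewrite !fE big_split /= -mulr_sumr; ring.
- by move=> f g _ _ fg; rewrite !fE ler_pM2l ?invr_gt0 //; apply: ler_sum.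
- by rewrite fE sumr_const card_ord mulVf // gt_eqF.
Qed.

(* The Stieltjes transform of the semicircle law of radius r at i eta is i k c. *)
Lemma self_consistent_root (R : realType) (k : nat) (eta : R) (r := 2 * Num.sqrt (1 - k%:R^-1)) :
  (0 < k)%N -> 0 < eta -> exists c, [/\ 0 <= c,
    eta * c = k%:R^-1 - (k%:R - 1) * c ^+ 2 &
    k%:R * c = 2 / (eta + Num.sqrt (r ^+ 2 + eta ^+ 2))].
Proof.
move=> k0 eta0; have k_gt0 : 0 < (k%:R : R) by rewrite ltr0n.
have k_ge1 : 1 <= (k%:R : R) by rewrite ler1n.
have r2 : r ^+ 2 = 4 * (1 - k%:R^-1).
  rewrite /r exprMn sqr_sqrtr ?subr_ge0 ?invf_le1 //; ring.
have S0 : 0 <= Num.sqrt (r ^+ 2 + eta ^+ 2) by exact: sqrtr_ge0.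
have S2 : Num.sqrt (r ^+ 2 + eta ^+ 2) ^+ 2 = r ^+ 2 + eta ^+ 2.
  by rewrite sqr_sqrtr // addr_ge0 ?sqr_ge0.
move: (Num.sqrt (_ + _)) S0 S2 => S S0 S2.
have D0 : 0 < eta + S by rewrite ltr_pwDl.
exists (2 / (eta + S) / k%:R); split.
- by rewrite !divr_ge0 // ?(ltW D0) ?(ltW k_gt0).
- apply: (mulIf (x := (eta + S) ^+ 2 * k%:R)).
    by rewrite mulf_neq0 ?expf_neq0 // gt_eqF.
  transitivity (2 * eta * (eta + S)); first by field; rewrite !gt_eqF.
  transitivity ((eta + S) ^+ 2 - 4 * (1 - k%:R^-1)); last by field; rewrite !gt_eqF.
  have -> : (eta + S) ^+ 2 = S ^+ 2 + 2 * eta * S + eta ^+ 2 by ring.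
  by rewrite S2 r2; ring.
- by field; rewrite !gt_eqF.
Qed.

Theorem theorem1p3 (R : realType) (d : measure_display) (T : measurableType d)
  (P : probability T R) (k : nat) (W : seq R)
  (a : nat -> nat -> nat -> T -> R) :
  (0 < k)%N -> size W = k ->
  (forall t, upper_idx t -> measurable_fun setT (a t.1.1 t.1.2 t.2)) ->
  mutually_independent P upper_idx (fun t => a t.1.1 t.1.2 t.2) ->
  identically_distributed P upper_idx (fun t => a t.1.1 t.1.2 t.2) ->
  (forall t, upper_idx t -> forall n : nat,
     P.-integrable setT (fun w => (`|a t.1.1 t.1.2 t.2 w| ^+ n)%:E)) ->
  (forall t, upper_idx t -> ('E_P[a t.1.1 t.1.2 t.2])%E = 0%E) ->
  (forall t, upper_idx t -> variance P (a t.1.1 t.1.2 t.2) = 1%E) ->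
  {ae P, forall w,
     weak_cvg (fun N => esm_integral (checkerboard k W (fun i j => a N i j w) N))
              (semicircle_integral (2 * Num.sqrt (1 - k%:R^-1)))}.
Proof.
move=> k0 _ ma inda ida inta Ea Va.
set r := 2 * _; have r0 : 0 <= r by rewrite mulr_ge0 ?sqrtr_ge0.
(* Countably many values, so that one null set serves for all of them and hence for every test
   function [f]; all lie above the threshold of the contraction and accumulate at it. *)
pose eta n : R := 2 * k%:R + 1 + n.+1%:R^-1.
pose s : R := (2 * k%:R + 1) ^+ 2; pose sn n : R := eta n ^+ 2.
have k1 : 0 < 2 * k%:R + 1 :> R by rewrite ltr_wpDl // mulr_ge0.
have n1 n : 0 < (n.+1%:R^-1 : R) by rewrite invr_gt0 ltr0n.
have eta_gt n : 2 * k%:R + 1 < eta n by rewrite ltrDl.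
have eta0 n : 0 < eta n by exact: lt_trans (eta_gt n).
have [c hc] := choice (fun n => self_consistent_root k0 (eta0 n)).
have : {ae P, forall w, forall n,
  (fun N => ptr (Num.sqrt N%:R)^-1 (resA (eta n) ((Num.sqrt N%:R)^-1 *: cb_board k W a N w)) predT) @ \oo --> (0 : R) /\
  (fun N => ptr (Num.sqrt N%:R)^-1 (resB (eta n) ((Num.sqrt N%:R)^-1 *: cb_board k W a N w)) predT) @ \oo --> k%:R * c n}.
  apply: ae_foralln => n; have [cn0 cnE _] := hc n.
  by apply: ptr_cvg_ae => //; exact: ltW.
apply: filterS => w hw f cf [M fM].
pose A N := checkerboard k W (fun i j => a N i j w) N.
have As N : (A N)^T = A N by exact: checkerboard_sym.
have s0 : 0 < s by rewrite exprn_gt0.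
have sn_gt n : s < sn n by rewrite ltr_pXn2r // nnegrE ltW.
have sn_cvg : sn @ \oo --> s.
  apply: cvgM; rewrite -[X in _ --> X]addr0; apply: cvgD;
    [exact: cvg_cst|exact: cvg_harmonic|exact: cvg_cst|exact: cvg_harmonic].
(* Sizes are shifted to [N.+1]: the spectral functional of the empty matrix has total mass 0 and is
   not a [posfun]. *)
have cvgA n : cvg_on (fun N => esm_integral (A N.+1)) (semicircle_integral r)
    (fun x => x * cauchyk (sn n) x).
  split.
    apply: mul_cont; first by move=> x; exact: cvg_id.
    by apply: cauchyk_cont; rewrite exprn_gt0.
  rewrite (semicircle_cauchy_odd r0 (eta0 n)); have [h _] := hw n.
  have e N := (esm_integral_resolvent (As N) (lt0r_neq0 (eta0 n))).1.
  move: h; rewrite -cvg_shiftS; apply: cvg_trans; apply: near_eq_cvg.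
  by apply: nearW => N; exact/esym/e.
have cvgB n : cvg_on (fun N => esm_integral (A N.+1)) (semicircle_integral r)
    (cauchyk (sn n)).
  have posE N := posfun_esm (ltn0Sn N) (As N.+1).
  have h : cvg_on (fun N => esm_integral (A N.+1)) (semicircle_integral r)
      (fun x => eta n / (x ^+ 2 + eta n ^+ 2)).
    split.
      apply: mul_cont; first exact: cst_cont.
      by apply: (@cauchyk_cont _ (sn n)); rewrite exprn_gt0.
    have [_ h] := hw n; have [_ _ cE] := hc n.
    rewrite (semicircle_cauchy_even r0 (eta0 n)) -cE.
    have e N := (esm_integral_resolvent (As N) (lt0r_neq0 (eta0 n))).2.
    move: h; rewrite -cvg_shiftS; apply: cvg_trans; apply: near_eq_cvg.
    by apply: nearW => N; exact/esym/e.
  have := cvg_on_lin posE (posfun_semicircle r0) (eta n)^-1 h (cvg_on_cst posE (posfun_semicircle r0) 0).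
  by apply: eq_cvg_on => x; rewrite addr0 mulKf // gt_eqF.
rewrite -cvg_shiftS.
have [] := @cvg_on_bounded R (fun N => esm_integral (A N.+1)) (semicircle_integral r)
  (fun N => posfun_esm (ltn0Sn N) (As N.+1)) (posfun_semicircle r0) s sn s0 sn_gt sn_cvg cvgB cvgA r r0
  (semicircle_support r0) f M cf fM.
by [].
Qed.
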